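(* Let $G=(V,E,w)$ be an undirected graph with $n$ vertices, $m$ edges and nonnegative edge weights, let $\{p_e\}_{e\in E}\subseteq[0,1]$ be predictions, and let $C^*$ be a minimum cut of $G$ with respect to which $\eta,\rho$ are defined (as in the context), with $\rho\ge1$. For a suitable setting of the parameters $B$ and $t$, the Boosted FPZ algorithm can be implemented to run in expected time $$\begin{cases}O(m^{1-\eta}n^{2\eta}\log n)&\text{if }\rho=O(\sqrt m),\\ O(\rho^{2(1-\eta)}n^{2\eta}\log n)&\text{otherwise,}\end{cases}$$ and it outputs a minimum cut of $G$ with probability at least $\Omega(1/\log n)$.
   Context: For $E'\subseteq E$, $w(E')=\sum_{e\in E'}w(e)$; a minimum cut is a minimum-weight set of edges crossing a partition of $V$ into two nonempty parts. Define $\eta:=\sum_{e\in C^*}(1-p_e)w(e)/w(C^* )$ and $\rho:=\sum_{e\in E\setminus C^*}p_ew(e)/w(C^* )$. Contracting an edge merges its endpoints into a metavertex, removing self-loops and keeping parallel edges. FPZ$(G,n)$: if $n=2$ return the edges between the two metavertices. Otherwise pick an edge $\bar e$ with probability $w(\bar e)/w(E)$, contract it to get $G'$, and set $C_1\gets$FPZ$(G',n-1)$. With probability $1-2/n$ return $C_1$; otherwise set $C_2\gets$FPZ$(G,n)$ (an independent fresh run on the same graph) and return the lighter of $C_1,C_2$. BoostedFPZ$(G,n,p)$ with parameters $B$, $t$: if $n=2$ return the edges between the two metavertices; else if $n\le t$ return FPZ$(G,n)$. Otherwise let $w_B(e)=(1+(B-1)(1-p_e))w(e)$, pick an edge $\bar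 e$ with probability $w_B(\bar e)/\sum_e w_B(e)$, contract it to get $G'$, and set $C_1\gets$BoostedFPZ$(G',n-1,p)$. With probability $q_n$ return $C_1$; otherwise set $C_2\gets$BoostedFPZ$(G,n,p)$ and return the lighter of $C_1,C_2$. Here $q_n:=1-\frac{1+(B-1)\eta}{Bn/2-(B-1)(\rho+(1-\eta))}$ for $n>t$ (and $q_n=1-2/n$ for $n\le t$). *)

(* Defs.v *)
From HB Require Import structures.
From mathcomp Require Import all_boot all_order all_algebra.
From mathcomp Require Import reals ereal topology normedtype sequences exp.

Set Implicit Arguments.
Unset Strict Implicit.
Unset Printing Implicit Defensive.

Import Order.TTheory GRing.Theory Num.Theory.
Import numFieldNormedType.Exports.

Local Open Scope ring_scope.

(* The edge set is a set of unordered pairs of distinct vertices, so there are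
   no parallel edges; parallel edges only appear through contractions.  The
   orientation (src, dst) and the numbering are an arbitrary presentation. *)
Record wgraph (R : realType) (n m : nat) := WGraph {
  src : 'I_m -> 'I_n;
  dst : 'I_m -> 'I_n;
  wt : 'I_m -> R;
  src_neq_dst : forall e, src e != dst e;
  ends_inj : forall e e', [set src e; dst e] = [set src e'; dst e'] -> e = e';
  wt_ge0 : forall e, 0 <= wt e }.

Definition weight (R : realType) (n m : nat) (G : wgraph R n m)
    (C : {set 'I_m}) : R :=
  \sum_(e in C) wt G e.

Definition crossing (R : realType) (n m : nat) (G : wgraph R n m)
    (S : {set 'I_n}) : {set 'I_m} :=
  [set e | (src G e \in S) != (dst G e \in S)].

Definition is_cut (R : realType) (n m : nat) (G : wgraph R n m)
    (C : {set 'I_m}) : bool :=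
  [exists S : {set 'I_n}, [&& S != set0, ~: S != set0 & C == crossing G S]].

Definition is_min_cut (R : realType) (n m : nat) (G : wgraph R n m)
    (C : {set 'I_m}) : bool :=
  is_cut G C && [forall D, is_cut G D ==> (weight G C <= weight G D)].

(* With the convention x / 0 = 0, the requirement 1 <= rho G p C used later
   forces weight G C > 0. *)
Definition eta (R : realType) (n m : nat) (G : wgraph R n m) (p : 'I_m -> R)
    (C : {set 'I_m}) : R :=
  (\sum_(e in C) (1 - p e) * wt G e) / weight G C.

Definition rho (R : realType) (n m : nat) (G : wgraph R n m) (p : 'I_m -> R)
    (C : {set 'I_m}) : R :=
  (\sum_(e in ~: C) p e * wt G e) / weight G C.

Section Subdistributions.
Variable R : realType.

Definition dnull (T : finType) : T -> R := fun=> 0.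

Definition dret (T : finType) (x : T) : T -> R := fun y => (x == y)%:R.

Definition dbind (S T : finType) (mu : S -> R) (k : S -> T -> R) : T -> R :=
  fun y => \sum_x mu x * k x y.

Definition dflip (T : finType) (q : R) (mu nu : T -> R) : T -> R :=
  fun y => q * mu y + (1 - q) * nu y.

Definition dpick (T : finType) (A : {set T}) (f : T -> R) : T -> R :=
  fun x => if x \in A then f x / \sum_(y in A) f y else 0.

End Subdistributions.

Section Algorithms.
Variables (R : realType) (n m : nat) (G : wgraph R n m) (p : 'I_m -> R).

(* A graph obtained from G by contractions is given by the map sending every
   original vertex to (a representative of) its metavertex.  Its edges are the
   edges of G that are not self-loops. *)
Definition labelling := {ffun 'I_n -> 'I_n}.

Definition live (f : labelling) : {set 'I_m} :=
  [set e | f (src G e) != f (dst G e)].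

Definition contract (f : labelling) (e : 'I_m) : labelling :=
  [ffun v => if f v == f (dst G e) then f (src G e) else f v].

Definition lighter (C D : {set 'I_m}) : {set 'I_m} :=
  if weight G C <= weight G D then C else D.

(* Both recursions call themselves on an unchanged graph, so they terminate
   only almost surely.  fpz s k f and bfpz s k f are the output laws restricted
   to the executions of recursion depth less than s, on the contraction f of G
   with k metavertices. *)
Fixpoint fpz (s k : nat) (f : labelling) : {set 'I_m} -> R :=
  if s is s'.+1 then
    if k == 2%N then dret R (live f) else
    dbind (dpick (live f) (wt G)) (fun e =>
    dbind (fpz s' k.-1 (contract f e)) (fun C1 =>
    dflip (1 - 2 / k%:R)
      (dret R C1)
      (dbind (fpz s' k f) (fun C2 => dret R (lighter C1 C2)))))
  else @dnull R _.

Variables (B et rh : R) (t : nat).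

Definition boosted_wt (e : 'I_m) : R := (1 + (B - 1) * (1 - p e)) * wt G e.

(* Used for k > t only. *)
Definition boosted_q (k : nat) : R :=
  1 - (1 + (B - 1) * et) / (B * k%:R / 2 - (B - 1) * (rh + (1 - et))).

Fixpoint bfpz (s k : nat) (f : labelling) : {set 'I_m} -> R :=
  if s is s'.+1 then
    if k == 2%N then dret R (live f) else
    if (k <= t)%N then fpz s' k f else
    dbind (dpick (live f) boosted_wt) (fun e =>
    dbind (bfpz s' k.-1 (contract f e)) (fun C1 =>
    dflip (boosted_q k)
      (dret R C1)
      (dbind (bfpz s' k f) (fun C2 => dret R (lighter C1 C2)))))
  else @dnull R _.

Definition boosted_fpz (C : {set 'I_m}) : R :=
  limn (fun s => bfpz s n [ffun v => v] C).

(* Boosting does not decrease weights, and the stopping rule is a probability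
   at every size where it is used. *)
Definition admissible : Prop :=
  1 <= B /\ forall k, (t < k <= n)%N -> 0 <= boosted_q k <= 1.

End Algorithms.

(* The cost model is a randomized real RAM.  Memory consists of arrays of
   naturals and arrays of reals, addressed indirectly (array name, index).
   Array names are literals of the program, so a program uses finitely many
   arrays.  The only integer operations are addition and truncated subtraction;
   reals are exact, with field operations and comparisons, and no rounding to
   an integer.  Randomness is a coin of computed bias.  Every command costs one
   step; expressions have a size fixed by the program, so this is unit cost up
   to a constant factor. *)

Inductive iexp :=
| INum of nat
| IGet of nat & iexp
| IAdd of iexp & iexp
| ISub of iexp & iexp.

Inductive rexp :=
| RNat of iexp
| RGet of nat & iexp
| RAdd of rexp & rexp
| RSub of rexp & rexp
| RMul of rexp & rexp
| RDiv of rexp & rexp.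

Inductive bexp :=
| ILe of iexp & iexp
| RLe of rexp & rexp
| BNot of bexp
| BAnd of bexp & bexp.

Inductive cmd :=
| Skip
| ISet of nat & iexp & iexp
| RSet of nat & iexp & rexp
| Flip of nat & iexp & rexp
| Seq of cmd & cmd
| If of bexp & cmd & cmd
| While of bexp & cmd.

Section Machine.
Variable R : realType.

Record state := State {
  int_mem : nat -> nat -> nat;
  real_mem : nat -> nat -> R }.

Definition upd (T : Type) (M : nat -> nat -> T) (a i : nat) (x : T) :=
  fun b j => if (b == a) && (j == i) then x else M b j.

Definition set_int (s : state) (a i x : nat) :=
  State (upd (int_mem s) a i x) (real_mem s).

Definition set_real (s : state) (a i : nat) (x : R) :=
  State (int_mem s) (upd (real_mem s) a i x).

Fixpoint ieval (s : state) (e : iexp) : nat :=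
  match e with
  | INum k => k
  | IGet a i => int_mem s a (ieval s i)
  | IAdd x y => (ieval s x + ieval s y)%N
  | ISub x y => (ieval s x - ieval s y)%N
  end.

Fixpoint reval (s : state) (e : rexp) : R :=
  match e with
  | RNat i => (ieval s i)%:R
  | RGet a i => real_mem s a (ieval s i)
  | RAdd x y => reval s x + reval s y
  | RSub x y => reval s x - reval s y
  | RMul x y => reval s x * reval s y
  | RDiv x y => reval s x / reval s y
  end.

Fixpoint beval (s : state) (b : bexp) : bool :=
  match b with
  | ILe x y => (ieval s x <= ieval s y)%N
  | RLe x y => reval s x <= reval s y
  | BNot b => ~~ beval s b
  | BAnd b c => beval s b && beval s c
  end.

Definition clamp (x : R) : R := Num.max 0 (Num.min 1 x).

(* run_prob Q k cs s is the probability that the execution of the commands cs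
   from s halts within k steps in a state satisfying Q. *)
Fixpoint run_prob (Q : pred state) (k : nat) (cs : seq cmd) (s : state) : R :=
  match cs, k with
  | [::], _ => (Q s)%:R
  | _ :: _, 0%N => 0
  | c :: cs', k'.+1 =>
    match c with
    | Skip => run_prob Q k' cs' s
    | ISet a i e =>
        run_prob Q k' cs' (set_int s a (ieval s i) (ieval s e))
    | RSet a i e =>
        run_prob Q k' cs' (set_real s a (ieval s i) (reval s e))
    | Flip a i e =>
        let x := clamp (reval s e) in
        x * run_prob Q k' cs' (set_int s a (ieval s i) 1)
        + (1 - x) * run_prob Q k' cs' (set_int s a (ieval s i) 0)
    | Seq c1 c2 => run_prob Q k' [:: c1, c2 & cs'] s
    | If b c1 c2 => run_prob Q k' ((if beval s b then c1 else c2) :: cs') s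
    | While b c1 =>
        run_prob Q k' (if beval s b then [:: c1, c & cs'] else cs') s
    end
  end.

Definition outcome_prob (prog : cmd) (s : state) (Q : pred state) : R :=
  limn (fun k => run_prob Q k [:: prog] s).

(* The expectation of the number T of steps, as the sum over k of P(T > k). *)
Definition expected_steps (prog : cmd) (s : state) : \bar R :=
  (\sum_(0 <= k <oo) (1 - run_prob xpredT k [:: prog] s)%:E)%E.

Definition array (T : Type) (k : nat) (x0 : T) (f : 'I_k -> T) (i : nat) : T :=
  if insub i is Some j then f j else x0.

(* Integer arrays 0, 1, 2 hold (n, m, t), the sources and the destinations of
   the edges; real arrays 0, 1, 2 hold (B, eta, rho), the weights and the
   predictions.  All other cells are 0. *)
Definition input (n m : nat) (G : wgraph R n m) (p : 'I_m -> R)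
    (B et rh : R) (t : nat) : state :=
  State
    (fun a => match a with
     | 0%N => nth 0%N [:: n; m; t]
     | 1%N => array 0%N (fun e => nat_of_ord (src G e))
     | 2%N => array 0%N (fun e => nat_of_ord (dst G e))
     | _ => fun=> 0%N
     end)
    (fun a => match a with
     | 0%N => nth 0 [:: B; et; rh]
     | 1%N => array 0 (wt G)
     | 2%N => array 0 p
     | _ => fun=> 0
     end).

(* The output edge set is given by its indicator in integer array 3. *)
Definition output (m : nat) (s : state) : {set 'I_m} :=
  [set e : 'I_m | int_mem s 3 e != 0%N].

End Machine.

Definition implements_boosted_fpz (R : realType) (prog : cmd) (n m : nat)
    (G : wgraph R n m) (p : 'I_m -> R) (B et rh : R) (t : nat) : Prop :=
  forall C : {set 'I_m},
    outcome_prob prog (input G p B et rh t) (fun s => output m s == C)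
    = boosted_fpz G p B et rh t C.

(* Main.v *)
From mathcomp Require Import boolp classical_sets.
From mathcomp Require Import all_boot all_order all_algebra.
From mathcomp Require Import reals ereal topology normedtype sequences exp.
From mathcomp Require Import ring lra zify.
Require Import Defs.

Set Implicit Arguments.
Unset Strict Implicit.
Unset Printing Implicit Defensive.

Import Order.TTheory GRing.Theory Num.Theory.
Import numFieldNormedType.Exports.

Local Open Scope ring_scope.

(* The program executes the recursion depth first.  While more than t
   metavertices remain, it draws the next edge from a segment tree and rejects
   edges inside a metavertex, which union-find detects; every rejected edge
   disappears from the tree, so a fresh tree pays in advance for all the trials
   until it is rebuilt, which happens only at reruns.  On at most t metavertices
   it works on an adjacency matrix and contracts an edge in time linear in the
   number of metavertices.  Since k * w(C) <= 2 * w(E) on k metavertices, for C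
   a minimum cut, the boosted weights give 1 - q_k <= (2 eta + 2/B) / (k - O(rho)).
   An expected cost therefore grows by a factor at most the product of the
   1 / q_k, which is O((n / t)^(2 eta)) for B = n, on the way from t up to n; the
   choice t = Theta(sqrt m + rho) balances the two phases.

   An edge of C is contracted with probability at most 1 - q_k, so the success
   probability P_k on k metavertices satisfies 1 / P_k <= 1 / P_(k-1) + 1 - q_k,
   and 1 - q_k = O(1 / k) makes 1 / P_n logarithmic. *)

(** * Supersolutions of the execution semantics *)

(** Both recursions call themselves on an unchanged graph, so the depth of a run is unbounded and
    offers nothing to induct on. Instead, a crude a priori bound on the value of a state is combined
    with the fact that, from any state, the execution ends without a further rerun with probability
    bounded below: feeding a bound into itself shrinks its error geometrically. All statements are
    one-sided bounds, and the output law is pinned down by bounding both an indicator and its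
    negative.

    Late costs (rejected draws, turning an identifier into a vertex set) are charged to their causes
    by potentials subtracted from the value.

    A tree of the first phase costs O(m log n) and a run of the second O(t^2 log n). Hence t >= sqrt
    m makes both O(t^2 log n), and t^2 (n/t)^(2 eta) = t^(2 (1 - eta)) n^(2 eta) gives the two cases
    of the bound. The requirement t >= 4 rho + 12 keeps the denominator of q_k comparable to B k and
    q_k at least 1/2. With B = n, the term 2/B in the exponent costs only a factor n^(2/n), at most
    e^2. *)

Section Semantics.
Variable R : realType.
Implicit Types (V : seq cmd -> state R -> R) (s : state R) (Q : pred (state R)).

(** Operator of a single execution step, with the value of the continuation left abstract:
    [run_prob] is its iteration and [win] a fixed point of it. *)
Definition after V (c : cmd) (cs : seq cmd) s : R :=
  match c with
  | Skip => V cs s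
  | ISet a i e => V cs (set_int s a (ieval s i) (ieval s e))
  | RSet a i e => V cs (set_real s a (ieval s i) (reval s e))
  | Flip a i e =>
      let x := clamp (reval s e) in
      x * V cs (set_int s a (ieval s i) 1)
      + (1 - x) * V cs (set_int s a (ieval s i) 0)
  | Seq c1 c2 => V [:: c1, c2 & cs] s
  | If b c1 c2 => V ((if beval s b then c1 else c2) :: cs) s
  | While b c1 => V (if beval s b then [:: c1, c & cs] else cs) s
  end.

(* A supersolution bounds from above an expected cost to go, kappa per step.
   Output laws (kappa = 0, with either sign) and truncated expected running
   times (kappa = 1) are instances, so that one analysis of a program yields
   both. *)
Definition supersolution (kappa D : R) V :=
  [/\ 0 <= kappa, forall cs s, V cs s <= D
    & forall c cs s, V (c :: cs) s <= kappa + after V c cs s].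

Lemma clamp_ge0 (x : R) : 0 <= clamp x.
Proof. by rewrite /clamp le_max lexx. Qed.

Lemma clamp_le1 (x : R) : clamp x <= 1.
Proof. by rewrite /clamp ge_max ler01 ge_min lexx. Qed.

Lemma clamp_id (x : R) : 0 <= x <= 1 -> clamp x = x.
Proof. by case/andP=> x0 x1; rewrite /clamp min_r // max_r. Qed.

Lemma run_probS Q k c cs s :
  run_prob Q k.+1 (c :: cs) s = after (run_prob Q k) c cs s.
Proof. by case: c. Qed.

Lemma convex_le (x a b c d : R) :
  0 <= x <= 1 -> a <= c -> b <= d -> x * a + (1 - x) * b <= x * c + (1 - x) * d.
Proof. by case/andP=> x0 x1 ac bd; apply: lerD; apply: ler_wpM2l => //; lra. Qed.

Lemma clampP (x : R) : 0 <= clamp x <= 1.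
Proof. by rewrite clamp_ge0 clamp_le1. Qed.

Lemma after_le V V' c cs s :
  (forall cs' s', V cs' s' <= V' cs' s') -> after V c cs s <= after V' c cs s.
Proof. by move=> VV'; case: c => * //=; apply: convex_le (clampP _) _ _. Qed.

Lemma run_prob_ge0 Q k cs s : 0 <= run_prob Q k cs s.
Proof.
elim: k cs s => [|k IH] [|c cs] s; rewrite ?run_probS //= ?ler0n //.
case: c => *; rewrite /= ?IH // addr_ge0 // mulr_ge0 ?clamp_ge0 //.
by rewrite subr_ge0 clamp_le1.
Qed.

Lemma run_prob_le1 Q k cs s : run_prob Q k cs s <= 1.
Proof.
elim: k cs s => [|k IH] [|c cs] s; rewrite ?run_probS //= ?lern1 ?leq_b1 //.
case: c => *; rewrite /= ?IH //.
by apply: le_trans (convex_le (clampP _) (IH _ _) (IH _ _)) _; lra.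
Qed.

Lemma run_prob_mono Q k cs s : run_prob Q k cs s <= run_prob Q k.+1 cs s.
Proof.
elim: k cs s => [|k IH] [|c cs] s //; first exact: run_prob_ge0.
by rewrite run_probS [leRHS]run_probS; apply: after_le.
Qed.

Definition win Q cs s : R := limn (fun k => run_prob Q k cs s).

Lemma run_prob_cvg Q cs s : (run_prob Q ^~ cs ^~ s @ \oo --> win Q cs s)%classic.
Proof.
apply/(@nondecreasing_is_cvgn R).
  by apply/nondecreasing_seqP => k; apply: run_prob_mono.
by exists 1 => _ [k _ <-]; apply: run_prob_le1.
Qed.

Lemma win_nil Q s : win Q [::] s = (Q s)%:R.
Proof. by rewrite /win (_ : (fun k => _) = fun=> (Q s)%:R) ?lim_cst //; apply/funext => -[]. Qed.

(** Shifting the budget does not change the limit, and [after] only forms finite convex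
    combinations, so it commutes with limits. *)
Lemma win_cons Q c cs s : win Q (c :: cs) s = after (win Q) c cs s.
Proof.
apply/cvg_lim => //; rewrite -cvg_shiftS /=.
case: c => *; rewrite /=; try exact: run_prob_cvg.
by apply: (@cvgD _ R); apply: (@cvgM R); try exact: run_prob_cvg; exact: cvg_cst.
Qed.

Lemma win_ge0 Q cs s : 0 <= win Q cs s.
Proof.
apply: limr_ge; first by apply/cvg_ex; eexists; exact: run_prob_cvg.
by near=> k; exact: run_prob_ge0.
Unshelve. all: by end_near. Qed.

Lemma win_le1 Q cs s : win Q cs s <= 1.
Proof.
apply: limr_le; first by apply/cvg_ex; eexists; exact: run_prob_cvg.
by near=> k; exact: run_prob_le1.
Unshelve. all: by end_near. Qed.

Lemma win_supersolution Q : supersolution 0 1 (win Q).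
Proof. by split=> // [|c cs s]; [exact: win_le1 | rewrite win_cons add0r]. Qed.

Lemma win_opp_supersolution Q : supersolution 0 0 (fun cs s => - win Q cs s).
Proof.
split=> // [cs s|c cs s]; first by rewrite oppr_le0 win_ge0.
by rewrite win_cons add0r; case: c => * //=; lra.
Qed.

(** Truncation at [N] keeps the expectation finite before anything is known about termination, so
    that an a priori bound [D] exists. *)
Definition steps_upto N cs s : R := \sum_(k < N) (1 - run_prob xpredT k cs s).

Lemma steps_upto_nil N s : steps_upto N [::] s = 0.
Proof. by rewrite /steps_upto big1 // => -[[|k] /= _] _; rewrite subrr. Qed.

Lemma steps_upto_supersolution N : supersolution 1 N%:R (steps_upto N).
Proof.
split=> // [cs s|c cs s].
  rewrite (_ : N%:R = \sum_(k < N) 1 :> R); last by rewrite sumr_const card_ord.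
  by apply: ler_sum => k _; rewrite gerBl run_prob_ge0.
(* One more summand is added so that [N] of them remain once the first is split off; the first is 1,
   as a nonempty list of commands has not halted with budget 0. *)
have: steps_upto N (c :: cs) s <= steps_upto N.+1 (c :: cs) s.
  by rewrite /steps_upto big_ord_recr /= lerDl subr_ge0 run_prob_le1.
move/le_trans; apply; rewrite /steps_upto big_ord_recl /= subr0 lerD2l.
rewrite le_eqVlt; apply/orP; left; apply/eqP.
case: c => * //=.
by rewrite !mulr_sumr -big_split /=; apply: eq_bigr => k _; rewrite add0n; ring.
Qed.

End Semantics.
(** * Cost triples *)

Notation IV x := (IGet x (INum 0)).
Notation RV x := (RGet x (INum 0)).
Notation iset x e := (ISet x (INum 0) e).
Notation rset x e := (RSet x (INum 0) e).
Notation "c1 ;;; c2" := (Seq c1 c2) (at level 90, right associativity).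

Definition ilt a b := ILe (IAdd a (INum 1)) b.
Definition ieq a b := BAnd (ILe a b) (ILe b a).

Definition For x lim body :=
  iset x (INum 0) ;;;
  While (ilt (IV x) lim) (body ;;; iset x (IAdd (IV x) (INum 1))).

Section Triples.
Variable R : realType.
Implicit Types (V : seq cmd -> state R -> R) (s : state R).

(* The postcondition holds with probability one after at most tau steps, the
   outcome of the coins being chosen adversarially. *)
Definition tri c s (tau : nat) (P : state R -> Prop) :=
  forall kappa D V rest X, supersolution kappa D V ->
  (forall s', P s' -> V rest s' <= X) -> V (c :: rest) s <= kappa * tau%:R + X.

Lemma beval_ilt s a b : beval s (ilt a b) = (ieval s a < ieval s b)%N.
Proof. by rewrite /= addn1. Qed.

Lemma tri_weaken c s t t' (P P' : state R -> Prop) :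
  tri c s t P -> (t <= t')%N -> (forall s', P s' -> P' s') -> tri c s t' P'.
Proof.
move=> H tt' PP' kappa D V rest X HV HX.
apply: le_trans (H _ _ _ _ X HV _) _; first by move=> s' /PP'; apply: HX.
by case: HV => k0 _ _; rewrite lerD2r ler_wpM2l // ler_nat.
Qed.

Lemma tri_le c s t t' (P : state R -> Prop) :
  tri c s t P -> (t <= t')%N -> tri c s t' P.
Proof. by move=> H tt'; apply: tri_weaken H tt' _. Qed.

Lemma tri_step c s t P :
  (forall kappa D V rest X, supersolution kappa D V ->
   (forall s', P s' -> V rest s' <= X) ->
   after V c rest s <= kappa * t%:R + X) -> tri c s t.+1 P.
Proof.
move=> H kappa D V rest X HV HX.
have [_ _ /(_ c rest s) /le_trans] := HV; apply.
by rewrite -natr1 mulrDr mulr1; have := H _ _ _ _ _ HV HX; lra.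
Qed.

Lemma tri_skip s (P : state R -> Prop) : P s -> tri Skip s 1 P.
Proof.
by move=> Ps; apply: tri_step => k D V rest X _ H /=; rewrite mulr0 add0r H.
Qed.

Lemma tri_iset a i e s (P : state R -> Prop) :
  P (set_int s a (ieval s i) (ieval s e)) -> tri (ISet a i e) s 1 P.
Proof.
by move=> Ps; apply: tri_step => k D V rest X _ H /=; rewrite mulr0 add0r H.
Qed.

Lemma tri_rset a i e s (P : state R -> Prop) :
  P (set_real s a (ieval s i) (reval s e)) -> tri (RSet a i e) s 1 P.
Proof.
by move=> Ps; apply: tri_step => k D V rest X _ H /=; rewrite mulr0 add0r H.
Qed.

Lemma tri_if b c1 c2 s t P :
  (beval s b -> tri c1 s t P) -> (~~ beval s b -> tri c2 s t P) ->
  tri (If b c1 c2) s t.+1 P.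
Proof.
move=> H1 H2; apply: tri_step => k D V rest X HV H /=.
by case: (boolP (beval s b)) => [/H1|/H2] /(_ _ _ _ _ _ HV H).
Qed.

Lemma tri_seq c1 c2 s t1 t2 P :
  tri c1 s t1 (fun s1 => tri c2 s1 t2 P) -> tri (c1 ;;; c2) s (t1 + t2).+1 P.
Proof.
move=> H1; apply: tri_step => k D V rest X HV H /=; rewrite natrD mulrDr -addrA.
by apply: H1 (HV) _ => s1 /(_ _ _ _ _ _ HV H).
Qed.

(** The index [i] is a variant: an upper bound for the number of iterations left, which may drop by
    more than one. Each unit of it pays for the guard and the body. *)
Lemma tri_while b c (I : nat -> state R -> Prop) P t :
  (forall i s, I i s -> if beval s b
     then exists2 j, (j < i)%N & tri c s t (I j) else P s) ->
  forall i s, I i s -> tri (While b c) s (i * t.+2).+1 P.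
Proof.
move=> HI i; have [k] := ubnP i; elim: k i => // k IH i lik s /HI.
case: ifP => [bs [j lji Hc]|bs Ps]; apply: tri_step => kap D V rest X HV H /=;
  rewrite bs; last first.
  by apply: le_trans (H _ Ps) _; rewrite lerDr mulr_ge0 //; case: HV.
apply: le_trans (Hc _ _ _ _ (kap * (j * t.+2).+1%:R + X) HV _) _.
  by move=> s' Is'; apply: (IH j _ s' Is' _ _ _ _ _ HV H); lia.
rewrite addrA -mulrDr -natrD lerD2r ler_wpM2l //; first by case: HV.
rewrite ler_nat; have := leq_mul2r t.+2 j.+1 i; rewrite lji orbT mulSn; lia.
Qed.

Lemma tri_for x lim body t N (I : nat -> state R -> Prop) s :
  I 0 (set_int s x 0 0) ->
  (forall k s, (k <= N)%N -> I k s -> ieval s lim = N /\ int_mem s x 0 = k) ->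
  (forall k s, (k < N)%N -> I k s ->
     tri body s t (fun s' => I k.+1 (set_int s' x 0 (int_mem s' x 0).+1))) ->
  tri (For x lim body) s (N * (t + 4) + 3) (I N).
Proof.
move=> I0 Ix Ib.
apply: (@tri_weaken _ _ (1 + (N * (t + 1).+3).+1).+1 _ (I N)) => //; last by lia.
apply: tri_seq; apply: tri_iset => /=.
pose J i s := (i <= N)%N /\ I (N - i)%N s.
apply: (@tri_while _ _ J) => [i s' [leiN Is']|]; last by split; rewrite ?subnn.
have [lN xN] := Ix _ _ (leq_subr i N) Is'.
rewrite beval_ilt /= lN xN.
case: i leiN lN xN Is' => [|i] leiN lN xN Is'; first by rewrite subn0 ltnn in Is' *.
rewrite ifT; last by lia.
exists i => //; apply/tri_seq; apply: tri_weaken (Ib _ _ _ Is') _ _ => //; first lia.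
move=> s1 H; apply: tri_iset => /=; rewrite addn1; split; first by lia.
by rewrite (_ : N - i = (N - i.+1).+1)%N //; lia.
Qed.

(** Tracks only which whole arrays may change. Array names are literals, so membership and inclusion
    of the lists are settled by computation. *)
Definition frame (Li Lr : seq nat) s s' :=
  (forall a, a \notin Li -> int_mem s' a = int_mem s a) /\
  (forall a, a \notin Lr -> real_mem s' a = real_mem s a).

Lemma frame_refl Li Lr s : frame Li Lr s s.
Proof. by split. Qed.

Lemma frame_trans Li Lr s1 s2 s3 :
  frame Li Lr s1 s2 -> frame Li Lr s2 s3 -> frame Li Lr s1 s3.
Proof. by move=> [i1 r1] [i2 r2]; split=> a aL; rewrite ?i2 ?i1 ?r2 ?r1. Qed.

Lemma frame_sub Li Lr Li' Lr' s s' : frame Li Lr s s' ->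
  all [in Li'] Li -> all [in Lr'] Lr -> frame Li' Lr' s s'.
Proof.
move=> [fi fr] /allP si /allP sr; split=> a aL.
  by apply: fi; apply: contra aL => /si.
by apply: fr; apply: contra aL => /sr.
Qed.

Lemma frame_set_int Li Lr s s' a i x :
  a \in Li -> frame Li Lr s s' -> frame Li Lr s (set_int s' a i x).
Proof.
move=> aL [fi fr]; split=> // b bL; rewrite /= /upd -fi //.
have /negbTE-> // : b != a; by apply: contraNneq bL => ->.
Qed.

Lemma frame_set_real Li Lr s s' a i x :
  a \in Lr -> frame Li Lr s s' -> frame Li Lr s (set_real s' a i x).
Proof.
move=> aL [fi fr]; split=> // b bL; rewrite /= /upd -fr //.
have /negbTE-> // : b != a; by apply: contraNneq bL => ->.
Qed.

End Triples.

Ltac framing :=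
  first [ exact: frame_refl | assumption
        | apply: frame_set_int; [by [] | framing]
        | apply: frame_set_real; [by [] | framing] ].
(** * Output laws of the recursions *)

Section Laws.
Variables (R : realType) (n m : nat) (G : wgraph R n m).
Local Notation lab := (labelling n).
Local Notation law := ({set 'I_m} -> R).
Implicit Types (f : lab) (C D : {set 'I_m}) (w : 'I_m -> R).

Definition mean (mu : law) (F : {set 'I_m} -> R) : R := \sum_C mu C * F C.

(** Nontermination loses mass, so at first the total is only known to be at most 1; equality is
    established in [branching_reliable]. *)
Definition subprob (mu : law) := (forall C, 0 <= mu C) /\ \sum_C mu C <= 1.

Lemma mean_1 mu : mean mu (fun=> 1) = \sum_C mu C.
Proof. by apply: eq_bigr => C _; rewrite mulr1. Qed.

Lemma mean_le mu F F' : subprob mu -> (forall C, F C <= F' C) ->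
  mean mu F <= mean mu F'.
Proof. by move=> [mu0 _] FF'; apply: ler_sum => C _; rewrite ler_wpM2l. Qed.

Lemma mean_addr_le mu F a : subprob mu -> 0 <= a ->
  mean mu (fun C => F C + a) <= mean mu F + a.
Proof.
move=> [mu0 mu1] a0; rewrite /mean.
under eq_bigr do rewrite mulrDr.
by rewrite big_split /= lerD2l -mulr_suml -[leRHS]mul1r ler_wpM2r.
Qed.

Lemma mean_ge mu F a : subprob mu -> 0 <= a -> (forall C, - a <= F C) ->
  - a <= mean mu F.
Proof.
move=> [mu0 mu1] a0 Fa; apply: (@le_trans _ _ (\sum_C mu C * - a)).
  by rewrite -mulr_suml mulrN lerN2 -[leRHS]mul1r ler_wpM2r.
by apply: ler_sum => C _; rewrite ler_wpM2l.
Qed.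

Lemma mean_dret C F : mean (dret R C) F = F C.
Proof.
rewrite /mean (bigD1 C) //= /dret eqxx mul1r big1 ?addr0 // => D.
by rewrite eq_sym => /negbTE->; rewrite mul0r.
Qed.

Lemma subprob_dret C : subprob (dret R C).
Proof.
split=> [D|]; first by rewrite ler0n.
by rewrite -mean_1 mean_dret.
Qed.

Lemma mean_dbind (T : finType) (nu : T -> R) (k : T -> law) F :
  mean (dbind nu k) F = \sum_x nu x * mean (k x) F.
Proof.
rewrite /mean /dbind; under eq_bigr do rewrite mulr_suml.
rewrite exchange_big; apply: eq_bigr => x _; rewrite mulr_sumr.
by apply: eq_bigr => C _; rewrite mulrA.
Qed.

Lemma mean_dflip q (mu nu : law) F :
  mean (dflip q mu nu) F = q * mean mu F + (1 - q) * mean nu F.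
Proof.
by rewrite /mean !mulr_sumr -big_split /=; apply: eq_bigr => C _; rewrite /dflip; ring.
Qed.

Lemma subprob_dbind (nu : law) (k : {set 'I_m} -> law) :
  subprob nu -> (forall x, subprob (k x)) -> subprob (dbind nu k).
Proof.
move=> [nu0 nu1] hk; split=> [C|].
  by apply: sumr_ge0 => x _; apply: mulr_ge0 => //; case: (hk x).
rewrite -mean_1 mean_dbind.
apply: le_trans nu1; apply: ler_sum => x _; rewrite -[leRHS]mulr1 ler_wpM2l //.
by rewrite mean_1; case: (hk x).
Qed.

Lemma subprob_dflip q (mu nu : law) : 0 <= q <= 1 ->
  subprob mu -> subprob nu -> subprob (dflip q mu nu).
Proof.
move=> q01 [mu0 mu1] [nu0 nu1]; split=> [C|].
  apply: le_trans (convex_le q01 (mu0 C) (nu0 C)); lra.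
rewrite big_split /= -!mulr_sumr; apply: le_trans (convex_le q01 mu1 nu1) _; lra.
Qed.

Lemma dpick_ge0 (A : {set 'I_m}) w x : (forall e, 0 <= w e) -> 0 <= dpick A w x.
Proof.
by move=> w0; rewrite /dpick; case: ifP => // _; rewrite divr_ge0 // sumr_ge0.
Qed.

Lemma sum_dpick (A : {set 'I_m}) w F :
  \sum_x dpick A w x * F x = (\sum_(x in A) w x * F x) / \sum_(x in A) w x.
Proof.
rewrite mulr_suml [RHS]big_mkcond; apply: eq_bigr => x _; rewrite /dpick.
by case: ifP => _; rewrite ?mul0r // mulrAC.
Qed.

Lemma sum_dpick_le1 (A : {set 'I_m}) w : \sum_x dpick A w x <= 1.
Proof.
under eq_bigr do rewrite -[dpick _ _ _]mulr1.
rewrite sum_dpick; under eq_bigr do rewrite mulr1.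
by have [->|?] := eqVneq (\sum_(x in A) w x) 0; rewrite ?mul0r ?divff.
Qed.

(** Permits a single register with the best cut so far in place of the nested comparisons of the
    recursion, with ties resolved in the same way. *)
Lemma lighterA C1 C2 C3 :
  lighter G (lighter G C1 C2) C3 = lighter G C1 (lighter G C2 C3).
Proof.
rewrite /lighter; case: (leP (weight G C1) (weight G C2)) => ?;
  case: (leP (weight G C2) (weight G C3)) => ?;
  repeat (case: ifPn; rewrite -?ltNge => ?) => //; exfalso; lra.
Qed.

(** One unfolding shared by both algorithms: [mu1] is the law of the run on the contracted graph and
    [mu2] that of the fresh run on the same graph. *)
Definition branch w (q : R) (mu1 : lab -> law) (mu2 : law) f : law :=
  dbind (dpick (live G f) w) (fun e =>
  dbind (mu1 (contract G f e)) (fun C1 =>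
  dflip q (dret R C1) (dbind mu2 (fun C2 => dret R (lighter G C1 C2))))).

Lemma mean_branch w q mu1 mu2 f F :
  mean (branch w q mu1 mu2 f) F =
  \sum_e dpick (live G f) w e * mean (mu1 (contract G f e)) (fun C1 =>
    q * F C1 + (1 - q) * mean mu2 (fun C2 => F (lighter G C1 C2))).
Proof.
rewrite mean_dbind; apply: eq_bigr => e _; congr (_ * _); rewrite mean_dbind.
apply: eq_bigr => C1 _; congr (_ * _); rewrite mean_dflip mean_dret mean_dbind.
by congr (_ + _ * _); apply: eq_bigr => C2 _; rewrite mean_dret.
Qed.

Lemma subprob_branch w q mu1 mu2 f :
  (forall e, 0 <= w e) -> 0 <= q <= 1 -> (forall g, subprob (mu1 g)) ->
  subprob mu2 -> subprob (branch w q mu1 mu2 f).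
Proof.
move=> w0 q01 h1 h2.
have hk e : subprob (dbind (mu1 (contract G f e)) (fun C1 =>
  dflip q (dret R C1) (dbind mu2 (fun C2 => dret R (lighter G C1 C2))))).
  apply: subprob_dbind => // C1; apply: subprob_dflip => //.
    exact: subprob_dret.
  by apply: subprob_dbind => // C2; apply: subprob_dret.
split=> [C|].
  by apply: sumr_ge0 => e _; apply: mulr_ge0; [exact: dpick_ge0|case: (hk e)].
rewrite exchange_big /=; apply: le_trans (sum_dpick_le1 (live G f) w).
apply: ler_sum => e _; rewrite -mulr_sumr -[leRHS]mulr1 ler_wpM2l //.
  exact: dpick_ge0.
by case: (hk e).
Qed.

Lemma branch_mono w q (mu1 nu1 : lab -> law) (mu2 nu2 : law) f C :
  (forall e, 0 <= w e) -> 0 <= q <= 1 ->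
  (forall g C, 0 <= mu1 g C <= nu1 g C) -> (forall C, 0 <= mu2 C <= nu2 C) ->
  branch w q mu1 mu2 f C <= branch w q nu1 nu2 f C.
Proof.
move=> w0 /andP[q0 q1] h1 h2; apply: ler_sum => e _; apply: ler_wpM2l; first exact: dpick_ge0.
have dr0 C1 C2 : 0 <= dret R C1 C2 :> R by rewrite ler0n.
have b0 C1 : 0 <= dbind mu2 (fun C2 => dret R (lighter G C1 C2)) C.
  by apply: sumr_ge0 => C2 _; rewrite mulr_ge0 //; case/andP: (h2 C2).
apply: ler_sum => C1 _; have /andP[m0 m1] := h1 (contract G f e) C1.
apply: ler_pM => //; first by rewrite addr_ge0 // mulr_ge0 // subr_ge0.
rewrite /dflip lerD2l ler_wpM2l ?subr_ge0 //; apply: ler_sum => C2 _.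
by rewrite ler_wpM2r //; case/andP: (h2 C2).
Qed.

Lemma cvg_sum_fin (T : finType) (u : nat -> T -> R) (l : T -> R) :
  (forall x, (u ^~ x @ \oo --> l x)%classic) ->
  ((fun s => \sum_x u s x) @ \oo --> \sum_x l x)%classic.
Proof.
move=> h; elim: (index_enum T) => [|x r IH].
  by rewrite big_nil; under eq_fun do rewrite big_nil; exact: cvg_cst.
rewrite big_cons; under eq_fun do rewrite big_cons.
by apply: (@cvgD _ R); [exact: h|exact: IH].
Qed.

Lemma branch_cvg w q (mu1 : nat -> lab -> law) (mu2 : nat -> law) l1 l2 f C :
  (forall g C, (mu1 ^~ g ^~ C @ \oo --> l1 g C)%classic) ->
  (forall C, (mu2 ^~ C @ \oo --> l2 C)%classic) ->
  ((fun s => branch w q (mu1 s) (mu2 s) f C) @ \oo --> branch w q l1 l2 f C)%classic.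
Proof.
move=> h1 h2; apply: cvg_sum_fin => e; apply: (@cvgM R); first exact: cvg_cst.
apply: cvg_sum_fin => C1; apply: (@cvgM R); first exact: h1.
apply: (@cvgD _ R); first exact: cvg_cst.
apply: (@cvgM R); first exact: cvg_cst.
by apply: cvg_sum_fin => C2; apply: (@cvgM R); [exact: h2|exact: cvg_cst].
Qed.

(** The fixed-point equation is all that the later analyses use about the limits of the
    depth-bounded recursions. *)
Definition branching_law w (q : nat -> R) (b N : nat) (base : lab -> law)
    (mu : nat -> lab -> law) :=
  [/\ forall k f, (b <= k <= N)%N -> subprob (mu k f),
      forall f, mu b f =1 base f
    & forall k f F, (b < k <= N)%N ->
      mean (mu k f) F = mean (branch w (q k) (mu k.-1) (mu k f) f) F].

Section Approximants.
Variables (w : 'I_m -> R) (q : nat -> R) (b N : nat).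
Variables (X : nat -> nat -> lab -> law) (Y : nat -> lab -> law).
Hypothesis w0 : forall e, 0 <= w e.
Hypothesis bN : (b <= N)%N.
Hypothesis q01 : forall k, (b < k <= N)%N -> 0 <= q k <= 1.
Hypothesis X0 : forall k f C, X 0 k f C = 0.
Hypothesis Y1 : forall s f, subprob (Y s f).
Hypothesis Ym : forall s f C, Y s f C <= Y s.+1 f C.
Hypothesis Xb : forall s f C, X s.+1 b f C = Y s f C.
Hypothesis XS : forall s k f C, (b < k <= N)%N ->
  X s.+1 k f C = branch w (q k) (X s k.-1) (X s k f) f C.

Lemma approx_subprob s k f : (b <= k <= N)%N -> subprob (X s k f).
Proof.
  elim: s k f => [|s IH] k f /andP[bk kN].
    split=> [C|]; first by rewrite X0.
    by rewrite big1.
  move: bk; rewrite leq_eqVlt => /orP[/eqP kb|bk].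
    case: (Y1 s f) => y0 y1; split=> [C|]; rewrite -kb ?Xb //.
    by under eq_bigr do rewrite Xb.
  have kbN : (b < k <= N)%N by rewrite bk.
  have [||g||z0 z1] := @subprob_branch w (q k) (X s k.-1) (X s k f) f => //.
  - exact: q01.
  - by apply: IH; lia.
  - by apply: IH; lia.
  split=> [C|]; first by rewrite XS.
  by under eq_bigr do rewrite XS //.
Qed.

Lemma approx_mono s k f C : (b <= k <= N)%N -> X s k f C <= X s.+1 k f C.
Proof.
have X1 := approx_subprob.
  elim: s k f C => [|s IH] k f C kbN; first by rewrite X0; case: (X1 1%N k f kbN).
  move: (kbN) => /andP[]; rewrite leq_eqVlt => /orP[/eqP kb _|bk kN].
    by rewrite -kb !Xb.
  have kbN' : (b < k <= N)%N by rewrite bk.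
  rewrite !XS //; apply: branch_mono => // [|g C'|C']; first exact: q01.
    have [|x0 _] := X1 s k.-1 g; first by lia.
    by rewrite x0 IH //; lia.
  have [|x0 _] := X1 s k f; first by lia.
  by rewrite x0 IH //; lia.
Qed.

(** The depth-bounded laws increase with the depth and have mass at most 1, hence converge
    pointwise; sums over edges and cuts are finite, so the recursive equation survives the limit. *)
Lemma branching_law_lim :
  branching_law w q b N (fun f C => limn (fun s => Y s f C))
    (fun k f C => limn (fun s => X s k f C)).
Proof.
have X1 := approx_subprob; have Xm := approx_mono.
have Xc k f C : (b <= k <= N)%N ->
    ((fun s => X s k f C) @ \oo --> limn (fun s => X s k f C))%classic.
  move=> kbN; apply/(@nondecreasing_is_cvgn R).
    by apply/nondecreasing_seqP => s; apply: Xm.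
  exists 1 => _ [s _ <-]; have [x0 x1] := X1 s k f kbN; apply: le_trans x1.
  by rewrite (bigD1 C) //= lerDl sumr_ge0.
split=> [k f kbN|f C|k f F kbN].
- split=> [C|].
    apply: limr_ge; first by apply/cvg_ex; eexists; exact: Xc.
    by near=> s; case: (X1 s k f kbN).
  have h : ((fun s => \sum_C X s k f C) @ \oo --> \sum_C limn (fun s => X s k f C))%classic.
    by apply: cvg_sum_fin => C; exact: Xc.
  rewrite -(cvg_lim _ h) //; apply: limr_le; first by apply/cvg_ex; eexists; exact: h.
  by near=> s; case: (X1 s k f kbN).
- have bbN : (b <= b <= N)%N by rewrite leqnn.
  have := Xc b f C bbN; rewrite -cvg_shiftS /= => /cvg_lim <- //=.
  by congr (limn _); apply/funext => s; rewrite Xb.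
rewrite /mean; apply: eq_bigr => C _; congr (_ * _).
apply/cvg_lim => //; rewrite -cvg_shiftS /=.
rewrite (_ : (fun s => X s.+1 k f C) =
  (fun s => branch w (q k) (X s k.-1) (X s k f) f C)); last first.
  by apply/funext => s; rewrite XS.
by apply: branch_cvg => [g C'|C']; apply: Xc; lia.
Unshelve. all: by end_near. Qed.

End Approximants.

Definition fpz_law k f : law := fun C => limn (fun s => fpz G s k f C).

Lemma fpz_q01 k : (2 < k)%N -> 0 <= (1 - 2 / k%:R : R) <= 1.
Proof.
move=> k2; rewrite subr_ge0 gerBl divr_ge0 ?ler0n // andbT.
by rewrite ler_pdivrMr ?ltr0n ?mul1r ?ler_nat; lia.
Qed.

Lemma fpz_law_branching N : (1 < N)%N ->
  branching_law (wt G) (fun k => 1 - 2 / k%:R) 2 N (fun f => dret R (live G f)) fpz_law.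
Proof.
move=> N1.
have := @branching_law_lim (wt G) (fun k => 1 - 2 / k%:R) 2 N (fpz G)
  (fun _ f => dret R (live G f)); rewrite /=.
under [X in branching_law _ _ _ _ X]eq_fun do under eq_fun do rewrite lim_cst //.
apply=> //.
- by move=> e; apply: wt_ge0.
- by move=> k /andP[k2 _]; apply: fpz_q01.
- by move=> s f; apply: subprob_dret.
- by move=> s [|[|[|k]]].
Qed.

Section Boosted.
Variables (p : 'I_m -> R) (B et rh : R) (t : nat).
Hypothesis p01 : forall e, 0 <= p e <= 1.
Hypothesis adm : admissible n B et rh t.

Lemma boosted_wt_ge e : wt G e <= boosted_wt G p B e.
Proof.
have [B1 _] := adm; rewrite /boosted_wt -[leLHS]mul1r ler_wpM2r ?wt_ge0 //.
by rewrite lerDl mulr_ge0 ?subr_ge0 //; case/andP: (p01 e).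
Qed.

Definition bfpz_law k f : law := fun C => limn (fun s => bfpz G p B et rh t s k f C).

(** If [n <= t], the boosted phase is empty and the recursion starts at its base; [minn n t] covers
    both cases. *)
Lemma bfpz_law_branching b : b = minn n t -> (1 < b)%N ->
  branching_law (boosted_wt G p B) (boosted_q B et rh) b n (fpz_law b) bfpz_law.
Proof.
move=> bE b1.
(* [bfpz] tests for two metavertices before it compares with [t], so at [b = 2] it does not enter
   [fpz]. The two bases differ at depth 0 and agree in the limit. *)
have := @branching_law_lim (boosted_wt G p B) (boosted_q B et rh) b n
  (bfpz G p B et rh t) (fun s f => if b == 2 then dret R (live G f) else fpz G s b f).
rewrite (_ : (fun f C => limn _) = fpz_law b); last first.
  apply/funext => f; apply/funext => C; have [b2|//] := eqVneq b 2.
  rewrite lim_cst // b2; have [_ -> // _] := @fpz_law_branching 2 isT.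
have [h1 _ h2] := @fpz_law_branching b b1.
have [B1 adm'] := adm.
have fs s f : subprob (fpz G s b f) /\ (forall C, fpz G s b f C <= fpz G s.+1 b f C).
  have bb : (2 <= b <= b)%N by rewrite b1 leqnn.
  have q1 k : (2 < k <= b)%N -> 0 <= (1 - 2 / k%:R : R) <= 1.
    by case/andP=> k2 _; apply: fpz_q01.
  split=> [|C].
    apply: (@approx_subprob (wt G) (fun k => 1 - 2 / k%:R) 2 b (fpz G)
      (fun _ f => dret R (live G f))) => // [e|_ g|u [|[|[|k]]]] //.
      exact: wt_ge0.
    exact: subprob_dret.
  apply: (@approx_mono (wt G) (fun k => 1 - 2 / k%:R) 2 b (fpz G)
      (fun _ f => dret R (live G f))) => // [e|_ g|u [|[|[|k]]]] //.
    exact: wt_ge0.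
  exact: subprob_dret.
apply=> //.
- by move=> e; apply: le_trans (boosted_wt_ge e); apply: wt_ge0.
- by lia.
- by move=> k /andP[k1 k2]; apply: adm'; lia.
- by move=> s f; case: ifP => _; [exact: subprob_dret|case: (fs s f)].
- by move=> s f C; case: ifP => // _; case: (fs s f).
- move=> s f C /=; rewrite (_ : (b <= t)%N); last by lia.
  by case: ifP.
- move=> s k f C /andP[bk kn] /=; rewrite ifN; last by apply/eqP; lia.
  by rewrite ifN //; lia.
Qed.

End Boosted.

End Laws.
(** * Depth-first execution of a branching recursion *)

(** Stands in for an induction on the depth of the recursion, which is unbounded. *)
Lemma le_geometric (R : realType) (x a d D : R) : 0 < d <= 1 ->
  (forall i, x <= a + (1 - d) ^+ i * D) -> x <= a.
Proof.
move=> /andP[d0 d1] h.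
have c : ((fun i => a + D * (1 - d) ^+ i) @ \oo --> a + 0)%classic.
  apply: (@cvgD _ R); first exact: cvg_cst.
  by apply: cvg_geometric; rewrite ger0_norm; lra.
rewrite -[a]addr0 -(cvg_lim _ c) //; apply: limr_ge.
  by apply/cvg_ex; eexists; exact: c.
by near=> i; rewrite [D * _]mulrC.
Unshelve. all: by end_near. Qed.

Section Levels.
Variables (T : Type) (b top : nat).
Implicit Types (f : T) (fs : seq T).

(** The stack holds the current graph and all its callers, one per level from [top] down, so its
    length determines the current level. *)
Definition level fs := (top.+1 - size fs)%N.

Definition in_range fs := (size fs <= top - b)%N.

Lemma level_cons f fs : level (f :: fs) = (top - size fs)%N.
Proof. by rewrite /level /= subSS. Qed.

Lemma level_gt f fs : in_range (f :: fs) -> (b < level (f :: fs) <= top)%N.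
Proof. by rewrite /in_range level_cons /=; lia. Qed.

Lemma level_ge f fs : (b <= top)%N -> in_range fs -> (b <= level (f :: fs) <= top)%N.
Proof. by rewrite /in_range level_cons /=; lia. Qed.

Lemma in_range_cons f fs : (b < level (f :: fs))%N -> in_range (f :: fs).
Proof. by rewrite level_cons /in_range /=; lia. Qed.

Lemma level_push f g fs : (b < level (f :: fs))%N ->
  level [:: g, f & fs] = (level (f :: fs)).-1.
Proof. by rewrite !level_cons /=; lia. Qed.

End Levels.

Section Control.
Variables (R : realType) (n m : nat) (G : wgraph R n m).
Local Notation lab := (labelling n).
Local Notation cut := {set 'I_m}.

Definition acc_join (acc : option cut) C : option cut :=
  Some (if acc is Some D then lighter G D C else C).

Lemma acc_joinA acc C1 C2 :
  acc_join (acc_join acc C1) C2 = acc_join acc (lighter G C1 C2).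
Proof. by case: acc => [D|] //=; rewrite /acc_join lighterA. Qed.

Variables (w : 'I_m -> R) (q : nat -> R) (b top : nat) (base : lab -> cut -> R).
Variable mu : nat -> lab -> cut -> R.
Local Notation level := (level top).
Local Notation in_range := (in_range b top).
Hypothesis w0 : forall e, 0 <= w e.
Hypothesis muP : branching_law G w q b top base mu.
Hypothesis b_top : (b <= top)%N.
Variable q0 : R.
Hypothesis q0P : 0 < q0 <= 1.
Hypothesis qP : forall k, (b < k <= top)%N -> q0 <= q k <= 1.

Variables (ST : Type) (v : ST -> R) (down up : seq lab -> option cut -> ST -> Prop).
Variables (kappa : R) (c1 : nat -> R) (cb c2 d : R) (F : option cut -> R).
Hypotheses (k0 : 0 <= kappa) (c20 : 0 <= c2) (d0 : 0 <= d).

(* The stack st = f :: fs lists the graph at the current level and the graphs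
   from which it was contracted: down st is the state before a run on f, and
   up fs the state after a run whose callers are fs. *)
Hypothesis contract_step : forall f fs acc s X, (b < level (f :: fs))%N ->
  down (f :: fs) acc s ->
  (forall e s', e \in live G f -> down [:: contract G f e, f & fs] acc s' -> v s' <= X e) ->
  v s <= kappa * c1 (level (f :: fs)) + \sum_e dpick (live G f) w e * X e.
Hypothesis leaf_step : forall f fs acc s X, level (f :: fs) = b ->
  down (f :: fs) acc s ->
  (forall C s', up fs (acc_join acc C) s' -> v s' <= X C) ->
  v s <= kappa * cb + mean (base f) X.
Hypothesis up_step : forall f fs acc s X Y, (b < level (f :: fs) <= top)%N ->
  up (f :: fs) acc s ->
  (forall s', up fs acc s' -> v s' <= X) ->
  (forall s', down (f :: fs) acc s' -> v s' <= Y) ->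
  v s <= kappa * c2 + (q (level (f :: fs)) * X +
                       (1 - q (level (f :: fs))) * (kappa * d + Y)).
Hypothesis exit_step : forall acc s, up [::] acc s -> v s <= F acc.

Variable D : R.
Hypothesis v_le : forall s, v s <= D.

Variable tD : nat -> R.
Hypothesis tD_ge0 : forall k, 0 <= tD k.
Hypothesis tD_base : cb <= tD b.
Hypothesis tD_step : forall k, (b < k <= top)%N ->
  c1 k + tD k.-1 + c2 + (1 - q k) * (d + tD k) <= tD k.

(** Expected value of [F] when a run has just returned to the callers [fs]: each caller either stops
    or joins in a fresh run, whose law is [mu] at that level. *)
Fixpoint payoff (fs : seq lab) (acc : option cut) : R :=
  if fs is f :: fs' then
    q (level fs) * payoff fs' acc +
    (1 - q (level fs)) * mean (mu (level fs) f) (fun C => payoff fs' (acc_join acc C))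
  else F acc.

(** Expected cost of unwinding the callers [fs], where a rerun is priced at its preparation [d] plus
    the full expected cost [tD] of a run. *)
Fixpoint tU (fs : seq lab) : R :=
  if fs is f :: fs' then
    c2 + tU fs' + (1 - q (level fs)) * (d + tD (level fs))
  else 0.

Definition bound_down f fs acc :=
  kappa * (tD (level (f :: fs)) + tU fs) +
  mean (mu (level (f :: fs)) f) (fun C => payoff fs (acc_join acc C)).

Lemma tU_ge0 fs : in_range fs -> 0 <= tU fs.
Proof.
elim: fs => //= f fs IH r; have := level_gt r => /qP /andP[_ q1].
apply: addr_ge0; first by apply: addr_ge0 => //; apply: IH; apply: ltnW.
by apply: mulr_ge0; [rewrite subr_ge0|apply: addr_ge0].
Qed.

Lemma payoff_ge fs acc (a : R) : in_range fs -> 0 <= a -> (forall acc, - a <= F acc) ->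
  - a <= payoff fs acc.
Proof.
move=> r a0 Fa; elim: fs r acc => [|f fs IH] r acc //=.
have lr := level_gt r; have /andP[q0' q1] := qP lr.
have {}IH := IH (ltnW r).
have M : subprob (mu (level (f :: fs)) f) by case: muP => + _ _; apply; apply: level_ge (ltnW r).
have q01 : 0 <= q (level (f :: fs)) <= 1 by case/andP: q0P; lra.
apply: le_trans (convex_le q01 (IH acc)
  (mean_ge M a0 (fun C => IH (acc_join acc C)))); lra.
Qed.

(** Each caller stops with probability at least [q0], so with probability at least [q0 ^+ size fs]
    the exit is reached directly, without appeal to the hypothesis and hence without its error
    [e]. *)
Lemma up_pass e fs acc s : 0 <= e -> in_range fs ->
  (forall f fs acc s, in_range fs -> down (f :: fs) acc s ->
     v s <= bound_down f fs acc + e) ->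
  up fs acc s ->
  v s <= kappa * tU fs + payoff fs acc + (1 - q0 ^+ size fs) * e.
Proof.
move=> e0 r H; elim: fs r acc s => [|f fs IH] r acc s us.
  by rewrite /= expr0 subrr mul0r mulr0 addr0 add0r exit_step.
have lr := level_gt r; have /andP[q0' q1] := qP lr.
have {}IH := IH (ltnW r).
apply: le_trans (up_step lr us (IH acc) (fun s' => H _ _ _ _ (ltnW r))) _.
rewrite /bound_down /= exprS; set Q := q _; set u := tU fs; set td := tD _.
set pa := payoff fs acc; set M := mean _ _; set z := q0 ^+ size fs.
have z0 : 0 <= z by rewrite exprn_ge0 //; case/andP: q0P; lra.
(* The error has the coefficient [Q * (1 - z) + (1 - Q) = 1 - Q * z]; this inequality replaces [Q]
   by [q0] there. *)
have : 0 <= (Q - q0) * (z * e) by rewrite !mulr_ge0 // subr_ge0.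
lra.
Qed.

(** A bound valid up to [e] improves to one valid up to a fixed fraction of [e]. Contractions lower
    the level, which is the induction; at level [b] the factor is gained from [up_pass], uniformly
    since [size fs <= top]. *)
Lemma down_pass e : 0 <= e ->
  (forall f fs acc s, in_range fs -> down (f :: fs) acc s ->
     v s <= bound_down f fs acc + e) ->
  (forall f fs acc s, in_range fs -> down (f :: fs) acc s ->
     v s <= bound_down f fs acc + (1 - q0 ^+ top) * e).
Proof.
move=> e0 H f fs acc s; have [z0 z1] : 0 < q0 ^+ top /\ q0 ^+ top <= 1.
  by case/andP: q0P => ? ?; rewrite exprn_gt0 // exprn_ile1 // ltW.
have e1 : 0 <= (1 - q0 ^+ top) * e by rewrite mulr_ge0 // subr_ge0.
have [mu1 mub mus] := muP.
have [k] := ubnP (level (f :: fs)); elim: k f fs s => // k IH f fs s lk r ds.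
have := level_ge f b_top r; case/andP; rewrite leq_eqVlt => /orP[/eqP lb _|lb lt].
  pose X C := payoff fs (acc_join acc C) + (kappa * tU fs + (1 - q0 ^+ top) * e).
  apply: le_trans (leaf_step (esym lb) ds (X := X) _) _ => [C s' us|].
    apply: le_trans (up_pass e0 r H us) _; rewrite /X [_ + payoff _ _]addrC -addrA.
    rewrite !lerD2l ler_wpM2r // lerD2l lerN2 ler_wiXn2l //.
    - by case/andP: q0P => /ltW.
    - by case/andP: q0P.
    - exact: leq_trans r (leq_subr _ _).
  have -> : mean (base f) X = mean (mu (level (f :: fs)) f) X.
    by rewrite -lb; apply: eq_bigr => C _; rewrite mub.
  apply: le_trans (lerD (lexx _) (mean_addr_le _ (mu1 _ _ _) _)) _.
  - by rewrite -lb leqnn.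
  - by rewrite addr_ge0 // mulr_ge0 // tU_ge0.
  have := ler_wpM2l k0 tD_base; rewrite /bound_down -lb; lra.
have lbt : (b < level (f :: fs) <= top)%N by rewrite lb.
have r' := in_range_cons lb.
have l' g : level [:: g, f & fs] = (level (f :: fs)).-1 by apply: level_push lb.
have lt1 : ((level (f :: fs)).-1 < level (f :: fs))%N by rewrite prednK //; apply: leq_ltn_trans lb.
pose X e' := bound_down (contract G f e') (f :: fs) acc + (1 - q0 ^+ top) * e.
apply: le_trans (contract_step lb ds (X := X) _) _ => [e' s' _ ds'|].
  by apply: IH ds' => //; rewrite l' -ltnS; apply: leq_trans lk; rewrite ltnS.
have -> : \sum_e' dpick (live G f) w e' * X e' =
  \sum_e' dpick (live G f) w e' *
    mean (mu (level (f :: fs)).-1 (contract G f e'))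
      (fun C => payoff (f :: fs) (acc_join acc C)) +
  (\sum_e' dpick (live G f) w e') *
    (kappa * (tD (level (f :: fs)).-1 + tU (f :: fs)) + (1 - q0 ^+ top) * e).
  rewrite mulr_suml -big_split /=; apply: eq_bigr => e' _.
  by rewrite /X /bound_down l' /=; ring.
(* One layer of [payoff] is matched with the fixed-point equation of [mu]; [acc_joinA] turns the
   comparison inside the recursion into two successive updates of the register. *)
have -> : \sum_e' dpick (live G f) w e' *
    mean (mu (level (f :: fs)).-1 (contract G f e'))
      (fun C => payoff (f :: fs) (acc_join acc C)) =
    mean (mu (level (f :: fs)) f) (fun C => payoff fs (acc_join acc C)).
  rewrite mus // mean_branch; apply: eq_bigr => e' _; congr (_ * _).
  apply: eq_bigr => C1 _; congr (_ * _) => /=; congr (_ + _ * _).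
  by apply: eq_bigr => C2 _; rewrite acc_joinA.
have t0 : 0 <= kappa * (tD (level (f :: fs)).-1 + tU (f :: fs)) + (1 - q0 ^+ top) * e.
  by rewrite addr_ge0 // mulr_ge0 // addr_ge0 // tU_ge0.
have := ler_wpM2r t0 (sum_dpick_le1 (live G f) w); rewrite mul1r.
have := ler_wpM2l k0 (tD_step lbt); rewrite /bound_down /=; lra.
Qed.

Lemma control_bound f acc s a : 0 <= a -> (forall acc, - a <= F acc) ->
  down [:: f] acc s ->
  v s <= kappa * tD top + mean (mu top f) (fun C => F (acc_join acc C)).
Proof.
move=> a0 Fa ds.
(* The iteration starts from the trivial facts that [v] is at most [D] and the claimed bound at
   least [- a]. *)
have H i : forall f fs acc s, in_range fs -> down (f :: fs) acc s ->
    v s <= bound_down f fs acc + (1 - q0 ^+ top) ^+ i * (`|D| + a).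
  elim: i => [|i IH].
    move=> g fs acc' s' r _; rewrite expr0 mul1r.
    apply: le_trans (v_le s') _; apply: le_trans (ler_norm D) _.
    have lr := level_ge g b_top r.
    have : - a <= mean (mu (level (g :: fs)) g) (fun C => payoff fs (acc_join acc' C)).
      apply: mean_ge => // [|C]; first by case: muP => + _ _; apply.
      exact: payoff_ge.
    have : 0 <= kappa * (tD (level (g :: fs)) + tU fs).
      by rewrite mulr_ge0 // addr_ge0 // tU_ge0.
    by rewrite /bound_down; lra.
  rewrite exprS -mulrA => g fs acc' s'; apply: down_pass => //.
  have /andP[q00 q01] := q0P.
  apply: mulr_ge0; last exact: addr_ge0.
  by apply: exprn_ge0; rewrite subr_ge0; apply: exprn_ile1 => //; apply: ltW.
have -> : kappa * tD top + mean (mu top f) (fun C => F (acc_join acc C)) = bound_down f [::] acc.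
  by rewrite /bound_down /= level_cons subn0 addr0.
apply: (@le_geometric _ _ _ (q0 ^+ top) (`|D| + a)) => [|i]; last exact: H.
by case/andP: q0P => ? ?; rewrite exprn_gt0 // exprn_ile1 // ltW.
Qed.

End Control.
(** * Random steps *)

Section Stepping.
Variables (R : realType) (kappa D : R) (V : seq cmd -> state R -> R).
Hypothesis HV : supersolution kappa D V.
Implicit Types (s : state R) (cs : seq cmd) (X : R).

Let k0 : 0 <= kappa. Proof. by case: HV. Qed.

Lemma V_weaken t t' cs s X : V cs s <= kappa * t%:R + X -> (t <= t')%N ->
  V cs s <= kappa * t'%:R + X.
Proof. by move=> H tt'; apply: le_trans H _; rewrite lerD2r ler_wpM2l // ler_nat. Qed.

Lemma V_done t cs s X : V cs s <= X -> V cs s <= kappa * t%:R + X.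
Proof. by move=> H; apply: le_trans H _; rewrite lerDr mulr_ge0. Qed.

Let step c cs s t X : after V c cs s <= kappa * t%:R + X ->
  V (c :: cs) s <= kappa * t.+1%:R + X.
Proof.
by have [_ _ /(_ c cs s)] := HV; rewrite -[t.+1%:R]natr1 mulrDr mulr1; lra.
Qed.

Lemma V_seq c1 c2 cs s t X : V [:: c1, c2 & cs] s <= kappa * t%:R + X ->
  V ((c1 ;;; c2) :: cs) s <= kappa * t.+1%:R + X.
Proof. by move=> H; apply: step. Qed.

Lemma V_skip cs s t X : V cs s <= kappa * t%:R + X ->
  V (Skip :: cs) s <= kappa * t.+1%:R + X.
Proof. by move=> H; apply: step. Qed.

Lemma V_iset a i e cs s t X :
  V cs (set_int s a (ieval s i) (ieval s e)) <= kappa * t%:R + X ->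
  V (ISet a i e :: cs) s <= kappa * t.+1%:R + X.
Proof. by move=> H; apply: step. Qed.

Lemma V_rset a i e cs s t X :
  V cs (set_real s a (ieval s i) (reval s e)) <= kappa * t%:R + X ->
  V (RSet a i e :: cs) s <= kappa * t.+1%:R + X.
Proof. by move=> H; apply: step. Qed.

Lemma V_if b c1 c2 cs s t X :
  (beval s b -> V (c1 :: cs) s <= kappa * t%:R + X) ->
  (~~ beval s b -> V (c2 :: cs) s <= kappa * t%:R + X) ->
  V (If b c1 c2 :: cs) s <= kappa * t.+1%:R + X.
Proof. by move=> h1 h2; apply: step => /=; case: ifPn. Qed.

Lemma V_loop b c cs s t X : beval s b ->
  V [:: c, While b c & cs] s <= kappa * t%:R + X ->
  V (While b c :: cs) s <= kappa * t.+1%:R + X.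
Proof. by move=> bs H; apply: step => /=; rewrite bs. Qed.

Lemma V_exit b c cs s t X : ~~ beval s b ->
  V cs s <= kappa * t%:R + X ->
  V (While b c :: cs) s <= kappa * t.+1%:R + X.
Proof. by move=> bs H; apply: step => /=; rewrite (negbTE bs). Qed.

Lemma V_tri c cs s t1 t2 P X : tri c s t1 P ->
  (forall s', P s' -> V cs s' <= kappa * t2%:R + X) ->
  V (c :: cs) s <= kappa * (t1 + t2)%:R + X.
Proof. by move=> H H'; rewrite natrD mulrDr -addrA; apply: H HV H'. Qed.

(* Branches of probability zero need no bound. *)
Lemma V_flip a i e cs s t p X1 X0 : reval s e = p -> 0 <= p <= 1 ->
  (p != 0 -> V cs (set_int s a (ieval s i) 1) <= kappa * t%:R + X1) ->
  (p != 1 -> V cs (set_int s a (ieval s i) 0) <= kappa * t%:R + X0) ->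
  V (Flip a i e :: cs) s <= kappa * t.+1%:R + (p * X1 + (1 - p) * X0).
Proof.
move=> ep p01 h1 h0; apply: step; rewrite /= ep clamp_id //.
set V1 := V _ _; set V0 := V _ _.
have {}h1 : p * V1 <= p * (kappa * t%:R + X1).
  have [->|pn] := eqVneq p 0; first by rewrite !mul0r.
  by rewrite ler_wpM2l ?h1 //; case/andP: p01.
have {}h0 : (1 - p) * V0 <= (1 - p) * (kappa * t%:R + X0).
  have [->|pn] := eqVneq p 1; first by rewrite subrr !mul0r.
  by rewrite ler_wpM2l ?h0 // subr_ge0; case/andP: p01.
lra.
Qed.

Definition reservoir (I : nat) (lim : iexp) (w : rexp) : cmd :=
  rset 6 (RNat (INum 0)) ;;; iset I (INum 0) ;;; iset 19 (INum 0) ;;;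
  While (ilt (IV 19) lim)
    (rset 6 (RAdd (RV 6) w) ;;;
     Flip 15 (INum 0) (RDiv w (RV 6)) ;;;
     If (ILe (INum 1) (IV 15)) (iset I (IV 19)) Skip ;;;
     iset 19 (IAdd (IV 19) (INum 1))).

(* Keeping index k with probability Z k / (Z 0 + ... + Z k) at step k samples
   an index with probability proportional to Z in one pass. *)
Lemma reservoir_spec I lim w s j (Z F : nat -> R) rest :
  I \notin [:: 15; 19] ->
  (forall s', frame [:: 15; 19; I] [:: 6] s s' -> ieval s' lim = j) ->
  (forall s' k, (k < j)%N -> frame [:: 15; 19; I] [:: 6] s s' ->
     int_mem s' 19 0 = k -> reval s' w = Z k) ->
  (forall k, (k < j)%N -> 0 <= Z k) -> 0 < \sum_(k < j) Z k ->
  (forall k s', (k < j)%N -> 0 < Z k -> frame [:: 15; 19; I] [:: 6] s s' ->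
     int_mem s' I 0 = k -> V rest s' <= F k) ->
  V (reservoir I lim w :: rest) s <=
    kappa * (j * 9 + 7)%:R + (\sum_(k < j) Z k * F k) / \sum_(k < j) Z k.
Proof.
rewrite !inE !negb_or => /andP[I15 I19] hlim hw Z0 Zpos hF.
have I19' : 19 != I by rewrite eq_sym.
pose S x := \sum_(k < x) Z k.
have S0 x : (x <= j)%N -> 0 <= S x.
  by move=> xj; apply: sumr_ge0 => k _; apply: Z0; apply: leq_trans xj.
have SS x : S x.+1 = S x + Z x by rewrite /S big_ord_recr.
(* Invariant after [x] indices: the one kept carries the weight [S x] and each later [k] its own
   [Z k], out of [S j]. As long as [S x = 0] no index has been chosen, hence the guard on the last
   clause. *)
have main r : forall x s', (x + r)%N = j -> frame [:: 15; 19; I] [:: 6] s s' ->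
    int_mem s' 19 0 = x -> real_mem s' 6 0 = S x ->
    (0 < S x -> (int_mem s' I 0 < j)%N /\ 0 < Z (int_mem s' I 0)) ->
    forall Wh, Wh = (While (ilt (IV 19) lim)
    (rset 6 (RAdd (RV 6) w) ;;;
     Flip 15 (INum 0) (RDiv w (RV 6)) ;;;
     If (ILe (INum 1) (IV 15)) (iset I (IV 19)) Skip ;;;
     iset 19 (IAdd (IV 19) (INum 1)))) ->
    V (Wh :: rest) s' <= kappa * (r * 9 + 1)%:R +
      (S x * F (int_mem s' I 0) + \sum_(x <= k < j) Z k * F k) / S j.
  elim: r => [|r IH] x s' xr fr xs rs Is Wh WhE; rewrite WhE.
    rewrite addn0 in xr; rewrite xr big_geq // addr0 mulrAC divff ?mul1r.
      apply: V_exit; first by rewrite beval_ilt (hlim _ fr) /= xs xr ltnn.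
      apply: V_done; have [] := Is _; first by rewrite xr.
      by move=> ? ?; apply: hF fr _.
    by rewrite gt_eqF.
  have xj : (x < j)%N by lia.
  have wz s1 : frame [:: 15; 19; I] [:: 6] s s1 -> int_mem s1 19 0 = x ->
     reval s1 w = Z x by apply: hw.
  rewrite (_ : r.+1 * 9 + 1 = (r * 9 + 1).+4.+4.+1)%N; last by lia.
  apply: V_loop; first by rewrite beval_ilt (hlim _ fr) /= xs.
  apply: V_seq; apply: V_rset; apply: V_seq.
  rewrite /= wz // rs -SS.
  set s1 := set_real _ _ _ _.
  have fr1 : frame [:: 15; 19; I] [:: 6] s s1 by framing.
  set p := Z x / S x.+1.
  have zx := Z0 _ xj; have sx := S0 _ (ltnW xj).
  have p01 : 0 <= p <= 1.
    rewrite /p divr_ge0 ?S0 //=; have [->|sn] := eqVneq (S x.+1) 0; first by rewrite invr0 mulr0.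
    by rewrite ler_pdivrMr ?mul1r ?SS ?lerDr // lt_neqAle eq_sym -SS sn S0.
  (* Also true when the partial sum vanishes, because then [Z x] does. *)
  have pS : p * S x.+1 = Z x.
    rewrite /p; have [z|sn] := eqVneq (S x.+1) 0; last by rewrite divfK.
    by rewrite z mulr0; move: z; rewrite SS; lra.
  have Sj : 0 < S j by [].
  rewrite (_ : (S x * F (int_mem s' I 0) + \sum_(x <= k < j) Z k * F k) / S j =
    p * ((S x.+1 * F x + \sum_(x.+1 <= k < j) Z k * F k) / S j) +
    (1 - p) * ((S x.+1 * F (int_mem s' I 0) + \sum_(x.+1 <= k < j) Z k * F k) / S j)); last first.
    rewrite big_ltn // (_ : S x = S x.+1 - p * S x.+1); last by rewrite pS SS; ring.
    by rewrite -pS; field; rewrite gt_eqF.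
  apply: V_flip p01 _ _.
  - by rewrite /= wz //= ?SS.
  - move=> pn0; apply: V_seq; apply: V_if => //= _.
    apply: V_iset; apply: V_iset => /=.
    apply: le_trans (IH x.+1 _ _ _ _ _ _ _ erefl) _ => //.
    - by rewrite addSnnS.
    - by do 2!(apply: frame_set_int; rewrite ?inE ?eqxx ?orbT //); framing.
    - by rewrite /= /upd (negbTE I19') addn1 /= xs.
    - rewrite /= /upd !eqxx (negbTE I19) /= xs => _; split=> //.
      by rewrite lt_neqAle zx andbT; apply: contra pn0 => /eqP z; rewrite /p -z mul0r.
    - by rewrite /= /upd !eqxx (negbTE I19) /= xs.
  - move=> pn1; apply: V_seq; apply: V_if => //= _.
    apply: V_skip; apply: V_iset => /=.
    apply: le_trans (IH x.+1 _ _ _ _ _ _ _ erefl) _ => //.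
    - by rewrite addSnnS.
    - by framing.
    - by rewrite /= /upd addn1 /= xs.
    - rewrite /= /upd (negbTE I19) (negbTE I15) /= => sx1; apply: Is.
      rewrite lt_neqAle sx andbT; apply: contra pn1 => /eqP z.
      by rewrite /p SS -z add0r divff // gt_eqF //; move: sx1; rewrite SS -z add0r.
    - by rewrite /= /upd (negbTE I19) (negbTE I15) /=.
apply: (@V_weaken (j * 9 + 1).+4.+2); last by lia.
do 2!(apply: V_seq; try apply: V_rset; try apply: V_iset).
apply: V_seq; apply: V_iset => /=.
apply: le_trans (main j 0%N _ _ _ _ _ _ _ erefl) _ => //.
- by do 2!(apply: frame_set_int; rewrite ?inE ?eqxx ?orbT //); framing.
- by rewrite /= /upd /= /S big_ord0.
- by rewrite /S big_ord0 ltxx.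
- by rewrite {1}/S big_ord0 mul0r add0r big_mkord.
Qed.

End Stepping.
(** * Contractions and cuts *)

Section Graph.
Variables (R : realType) (n m : nat) (G : wgraph R n m).
Implicit Types (f : labelling n) (X Y Z : {set 'I_n}) (pos : 'I_n -> nat).

Lemma contractE f e u v :
  (contract G f e u == contract G f e v) =
  (f u == f v) || ((f u \in [:: f (src G e); f (dst G e)]) &&
                   (f v \in [:: f (src G e); f (dst G e)])).
Proof.
rewrite !ffunE !inE; set a := f (src G e); set b := f (dst G e).
have [ub|ub] := eqVneq (f u) b; have [vb|vb] := eqVneq (f v) b;
  rewrite ?ub ?vb ?eqxx ?orbT ?andbT //=.
- by rewrite orbF eq_sym [b == _]eq_sym (negbTE vb).
- by rewrite orbF (negbTE ub).
- rewrite !orbF; case: (eqVneq (f u) (f v)) => //= uv.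
  by apply/esym/negbTE; apply: contra uv => /andP[/eqP-> /eqP->].
Qed.

(* The metavertices of f are numbered from 0 to k - 1 by pos. *)
Definition numbering f k pos :=
  [/\ forall u, (pos u < k)%N, forall x, (x < k)%N -> exists u, pos u = x
    & forall u v, (f u == f v) = (pos u == pos v)].

Lemma numbering_id : numbering [ffun v => v] n (fun v => v).
Proof.
split=> [u|x xn|u v]; [exact: ltn_ord|by exists (Ordinal xn)|by rewrite !ffunE].
Qed.

Lemma numbering_le f k k' pos pos' :
  numbering f k pos -> numbering f k' pos' -> (k <= k')%N.
Proof.
move=> [_ s e] [b' _ e'].
have {s}s (x : 'I_k) : {u | pos u = x} by apply/cid/s/ltn_ord.
pose h (x : 'I_k) := Ordinal (b' (sval (s x))).
suff /leq_card : injective h by rewrite !card_ord.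
move=> x y [] /eqP; rewrite -e' e => /eqP.
by rewrite (svalP (s x)) (svalP (s y)) => /val_inj.
Qed.

Lemma numbering_size f k k' pos pos' :
  numbering f k pos -> numbering f k' pos' -> k = k'.
Proof.
by move=> h h'; apply/eqP; rewrite eqn_leq (numbering_le h h') (numbering_le h' h).
Qed.

(* The numbering after merging the metavertices P and Q of k: the last
   metavertex takes over the number left free. *)
Definition merged (P Q k x : nat) : nat :=
  if (x == P) || (x == Q) then (if P == k.-1 then Q else P)
  else if x == k.-1 then Q else x.

Lemma numbering_contract f k pos e P Q : numbering f k pos -> P != Q ->
  (pos (src G e) = P /\ pos (dst G e) = Q) \/
  (pos (src G e) = Q /\ pos (dst G e) = P) ->
  numbering (contract G f e) k.-1 (fun u => merged P Q k (pos u)).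
Proof.
move=> [b s eqf] PQ PQe.
have [Pk Qk] : (P < k /\ Q < k)%N.
  by case: PQe => -[<- <-]; rewrite !b.
split=> [u|x xk|u v].
- have := b u; rewrite /merged; move: PQ.
  case: (eqVneq P k.-1) => ?; case: (eqVneq (pos u) P) => ?;
  case: (eqVneq (pos u) Q) => ?; case: (eqVneq (pos u) k.-1) => ? /=; lia.
- have [xP|xP] := eqVneq x (if P == k.-1 then Q else P).
    by have [u uP] := s P Pk; exists u; rewrite xP /merged uP eqxx.
  have [xQ|xQ] := eqVneq x Q.
    have [u uk] := s k.-1 ltac:(lia); exists u; rewrite /merged uk eqxx.
    move: xP; rewrite xQ; case: (eqVneq P k.-1) => [_|Pk1]; first by rewrite eqxx.
    by move=> _; rewrite (_ : (k.-1 == Q) = false) //; lia.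
  have [u ux'] := s x ltac:(lia); exists u; rewrite /merged ux'.
  have ux : (x == k.-1) = false by lia.
  rewrite ux (negbTE xQ) orbF; case: (eqVneq x P) xP => //= <- {ux'}.
  by rewrite ux eqxx.
rewrite contractE !inE !eqf.
have ends w : (pos w == pos (src G e)) || (pos w == pos (dst G e)) =
            (pos w == P) || (pos w == Q).
  by case: PQe => -[-> ->] //; rewrite orbC.
have pk w : (pos w <= k.-1)%N by have := b w; lia.
rewrite !{}ends /merged; have := pk u; have := pk v; move: PQ Pk Qk.
move: (pos u) (pos v) => x y; clear=> *.
case: (eqVneq P k.-1) => ?; case: (eqVneq x P) => ?; case: (eqVneq x Q) => ?;
case: (eqVneq y P) => ?; case: (eqVneq y Q) => ?; case: (eqVneq x k.-1) => ?;
case: (eqVneq y k.-1) => ? /=; lia.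
Qed.

Lemma live_numbering f k pos : numbering f k pos ->
  live G f = [set e | pos (src G e) != pos (dst G e)].
Proof. by move=> [_ _ e]; apply/setP => x; rewrite !inE e. Qed.

Lemma live_crossing f pos : numbering f 2 pos ->
  live G f = crossing G [set u | pos u == 0%N].
Proof.
move=> h; rewrite (live_numbering h); apply/setP => e; rewrite !inE.
by have [b _ _] := h; have := b (src G e); have := b (dst G e);
  case: (pos _) => [|[]] //; case: (pos _) => [|[]].
Qed.

Lemma live_cut f pos : numbering f 2 pos -> is_cut G (live G f).
Proof.
move=> h; rewrite (live_crossing h); apply/existsP.
exists [set u | pos u == 0%N]; rewrite eqxx andbT; have [_ s _] := h.
apply/andP; split; apply/set0Pn.
  by have [u u0] := s 0%N isT; exists u; rewrite inE u0.
by have [u u1] := s 1%N isT; exists u; rewrite !inE u1.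
Qed.

(** Guarantees that every contraction with at least two metavertices has an edge of positive weight
    to draw. It will follow from the minimum cut having positive weight. *)
Definition connected_weights :=
  forall S, S != set0 -> ~: S != set0 -> 0 < weight G (crossing G S).

Lemma weight_live_gt0 f k pos : connected_weights -> numbering f k pos ->
  (1 < k)%N -> 0 < weight G (live G f).
Proof.
move=> conn h k1; have [_ s _] := h; pose S := [set u | pos u == 0%N].
have [u u0] := s 0%N (ltnW k1); have [v v1] := s 1%N k1.
have S0 : S != set0 by apply/set0Pn; exists u; rewrite inE u0.
have S1 : ~: S != set0 by apply/set0Pn; exists v; rewrite !inE v1.
apply: lt_le_trans (conn S S0 S1) _.
rewrite (live_numbering h) /weight [leRHS](big_setID (crossing G S)) /=.
rewrite (setIidPr _); first by rewrite lerDl sumr_ge0 // => e _; exact: wt_ge0.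
by apply/subsetP => e; rewrite !inE; apply: contraNneq => ->.
Qed.

(** Taken for two arbitrary vertex sets, so that it is additive over disjoint unions in each
    argument; this is what adding matrix rows amounts to. *)
Definition vcut X Y : R :=
  \sum_e wt G e * (((src G e \in X) && (dst G e \in Y))%:R +
                   ((dst G e \in X) && (src G e \in Y))%:R).

Lemma vcutC X Y : vcut X Y = vcut Y X.
Proof.
by apply: eq_bigr => e _; rewrite [(src G e \in X) && _]andbC
  [(dst G e \in X) && _]andbC addrC.
Qed.

Lemma vcut_ge0 X Y : 0 <= vcut X Y.
Proof. by apply: sumr_ge0 => e _; rewrite mulr_ge0 ?wt_ge0 // addr_ge0 ?ler0n. Qed.

Lemma vcutUl X Y Z : [disjoint X & Y] -> vcut (X :|: Y) Z = vcut X Z + vcut Y Z.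
Proof.
move=> dXY; rewrite -big_split; apply: eq_bigr => e _ /=; rewrite -mulrDr !inE.
have h u : ~~ ((u \in X) && (u \in Y)).
  apply/negP => /andP[uX]; apply/negP.
  by move: dXY; rewrite disjoints_subset => /subsetP /(_ u uX); rewrite inE.
have := h (src G e); have := h (dst G e).
by case: (_ \in X); case: (_ \in Y); case: (_ \in X); case: (_ \in Y);
  case: (_ \in Z); case: (_ \in Z) => //= _ _; congr (_ * _); ring.
Qed.

Lemma vcutUr X Y Z : [disjoint X & Y] -> vcut Z (X :|: Y) = vcut Z X + vcut Z Y.
Proof. by move=> h; rewrite vcutC vcutUl // vcutC [vcut Y Z]vcutC. Qed.

Lemma weight_crossing S : weight G (crossing G S) = vcut S (~: S).
Proof.
rewrite /weight big_mkcond; apply: eq_bigr => e _; rewrite !inE.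
by case: (src G e \in S); case: (dst G e \in S) => /=; ring.
Qed.

End Graph.
(** * The unboosted phase on an adjacency matrix *)

(* Row i of a two-dimensional array starts at cell i * N, where N = 2 n; these
   offsets are tabulated in array 9 as programs cannot multiply integers.  A
   graph with j metavertices occupies row j of array 25, which lists the slots
   of its metavertices.  Slots index rows and columns of the weight matrix (real
   array 4), weighted degrees (real array 5) and identifiers (array 26).  The
   metavertex created from a graph with j metavertices gets slot 2 K - j, so
   that contractions never overwrite the graphs they start from and a rerun needs
   no restoration.  Identifiers are never reused; arrays 27 and 28 hold the
   identifiers of the two parts of a merged metavertex, so that a cut is stored
   as the single identifier of one of its sides. *)
Notation cell a i j := (IGet a (IAdd (IGet 9 i) j)).
Notation rcell a i j := (RGet a (IAdd (IGet 9 i) j)).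
Notation iset2 a i j e := (ISet a (IAdd (IGet 9 i) j) e).
Notation rset2 a i j e := (RSet a (IAdd (IGet 9 i) j) e).
Notation slot x := (cell 25 (IV 32) x).

Definition merge_rows : cmd :=
  For 19 (IV 32)
    (rset 9 (RAdd (rcell 4 (IV 37) (slot (IV 19))) (rcell 4 (IV 38) (slot (IV 19)))) ;;;
     rset2 4 (IV 39) (slot (IV 19)) (RV 9) ;;;
     rset2 4 (slot (IV 19)) (IV 39) (RV 9)).

Definition copy_slots : cmd :=
  For 19 (ISub (IV 32) (INum 1))
    (iset2 25 (ISub (IV 32) (INum 1)) (IV 19) (slot (IV 19))).

Definition merge_slots : cmd :=
  iset 38 (slot (IV 36)) ;;;
  iset 39 (ISub (IAdd (IV 42) (IV 42)) (IV 32)) ;;;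
  RSet 5 (IV 39) (RSub (RAdd (RGet 5 (IV 37)) (RGet 5 (IV 38)))
    (RAdd (rcell 4 (IV 37) (IV 38)) (rcell 4 (IV 37) (IV 38)))) ;;;
  merge_rows ;;;
  rset2 4 (IV 39) (IV 39) (RNat (INum 0)) ;;;
  ISet 26 (IV 39) (IV 29) ;;;
  ISet 27 (IV 29) (IGet 26 (IV 37)) ;;;
  ISet 28 (IV 29) (IGet 26 (IV 38)) ;;;
  iset 29 (IAdd (IV 29) (INum 1)) ;;;
  copy_slots ;;;
  iset2 25 (ISub (IV 32) (INum 1)) (IV 36) (slot (ISub (IV 32) (INum 1))) ;;;
  If (ieq (IV 35) (ISub (IV 32) (INum 1)))
    (iset2 25 (ISub (IV 32) (INum 1)) (IV 36) (IV 39))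
    (iset2 25 (ISub (IV 32) (INum 1)) (IV 35) (IV 39)) ;;;
  iset 32 (ISub (IV 32) (INum 1)).

Definition inner_contract : cmd :=
  reservoir 35 (IV 32) (RGet 5 (slot (IV 19))) ;;;
  iset 37 (slot (IV 35)) ;;;
  reservoir 36 (IV 32) (rcell 4 (IV 37) (slot (IV 19))) ;;;
  merge_slots.

Definition inner_leaf : cmd :=
  iset 37 (slot (INum 0)) ;;;
  iset 38 (slot (INum 1)) ;;;
  rset 9 (rcell 4 (IV 37) (IV 38)) ;;;
  If (BAnd (ILe (INum 1) (IV 30)) (RLe (RV 7) (RV 9))) Skip
    (rset 7 (RV 9) ;;; iset 31 (IGet 26 (IV 37)) ;;; iset 30 (INum 1)) ;;;
  iset 33 (INum 0).

Definition inner_up : cmd :=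
  If (ILe (IV 42) (IV 32)) (iset 34 (INum 0))
    (iset 32 (IAdd (IV 32) (INum 1)) ;;;
     Flip 15 (INum 0) (RSub (RNat (INum 1)) (RDiv (RNat (INum 2)) (RNat (IV 32)))) ;;;
     If (ILe (INum 1) (IV 15)) Skip (iset 33 (INum 1))).

(* Cells 32, 33 and 34: number of metavertices, direction (1 before a run, 0
   after it) and whether to go on.  Cells 29, 30, 31 and real cell 7: next
   identifier, whether a cut is known, and the identifier and weight of its side. *)
Definition inner_loop : cmd :=
  While (ILe (INum 1) (IV 34))
    (If (ILe (INum 1) (IV 33))
       (If (ilt (INum 2) (IV 32)) inner_contract inner_leaf)
       inner_up).

Section Inner.
Variables (R : realType) (n m : nat) (G : wgraph R n m).
Implicit Types (s : state R) (f : labelling n).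
Let N := (n + n)%N.

Definition rows_ok s := forall i, (i <= N)%N -> int_mem s 9 i = (i * N)%N.

Definition Mx s x y := real_mem s 4 (x * N + y).
Definition Act s j x := int_mem s 25 (j * N + x).

Lemma cell_eq x y x' y' : (y < N)%N -> (y' < N)%N ->
  ((x * N + y == x' * N + y') = (x == x') && (y == y'))%N.
Proof.
move=> yN yN'; apply/eqP/andP => [h|[/eqP-> /eqP->]//].
have N0 : (0 < N)%N by apply: leq_ltn_trans yN.
have := congr1 (divn^~ N) h; rewrite !divnMDl // !divn_small // !addn0 => ->.
by have := congr1 (modn^~ N) h; rewrite !modnMDl !modn_small // => ->.
Qed.

Lemma merge_rows_tri s j A B C : rows_ok s -> (C < N)%N -> (A < C)%N -> (B < C)%N ->
  int_mem s 32 0 = j -> (j <= n)%N ->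
  int_mem s 37 0 = A -> int_mem s 38 0 = B -> int_mem s 39 0 = C ->
  (forall x, (x < j)%N -> (Act s j x < C)%N) ->
  tri merge_rows s (j * 9 + 3) (fun s' =>
    [/\ frame [:: 19] [:: 4; 9] s s',
        forall x y, (x < C)%N -> (y < C)%N -> Mx s' x y = Mx s x y
      & forall k, (k < j)%N -> let y := Act s j k in
          Mx s' C y = Mx s A y + Mx s B y /\ Mx s' y C = Mx s A y + Mx s B y]).
Proof.
move=> rw CN AC BC js jn As Bs Cs slo.
pose I k s' := int_mem s' 19 0 = k /\
    [/\ frame [:: 19] [:: 4; 9] s s',
        forall x y, (x < C)%N -> (y < C)%N -> Mx s' x y = Mx s x y
      & forall k', (k' < k)%N -> (k' < j)%N -> let y := Act s j k' in
          Mx s' C y = Mx s A y + Mx s B y /\ Mx s' y C = Mx s A y + Mx s B y].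
apply: (@tri_weaken _ _ _ (j * (5 + 4) + 3) _ (I j)) => //; last first.
  by move=> s' [_ [h1 h2 h3]]; split=> // k kj; apply: h3.
apply: tri_for => [|k s' _ [xk [fr _ _]]|k s' kj [xk [fr h2 h3]]].
- by split=> //; split=> //; framing.
- by split=> //=; rewrite (proj1 fr 32 isT).
have [fi _] := fr.
have E a : a \notin [:: 19] -> int_mem s' a = int_mem s a by apply: fi.
eapply tri_le; [do 2!(apply: tri_seq; apply: tri_rset); apply: tri_rset|by []].
rewrite /= /upd /= xk !E // js As Bs Cs; set y := int_mem s 25 _.
have yE : y = Act s j k by rewrite /y rw //; rewrite /N; lia.
have yC : (y < C)%N by rewrite yE; apply: slo.
rewrite !rw; try (rewrite /N; lia).
have AN := ltn_trans AC CN; have BN := ltn_trans BC CN; have yN := ltn_trans yC CN.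
rewrite -!/(Mx _ _ _) !h2 //.
split=> //; split=> [|a b aC bC|k' kk k'j]; first by framing.
  have <- := h2 a b aC bC; rewrite /Mx /= /upd /= !cell_eq //; try exact: ltn_trans CN.
  by rewrite (ltn_eqF aC) (ltn_eqF bC) !andbF.
have := slo _ k'j; set y' := Act s j k' => y'C.
have y'N := ltn_trans y'C CN.
rewrite /Mx /= /upd /= !cell_eq // !eqxx !andbT /= (ltn_eqF y'C) [C == y]gtn_eqF //=.
have [->|yy] := eqVneq y' y; first by [].
have k'k : (k' < k)%N.
  by move: kk; rewrite ltnS leq_eqVlt => /orP[/eqP kk|//]; rewrite /y' kk -yE eqxx in yy.
by have [] := h3 k' k'k k'j.
Qed.

Lemma copy_slots_tri s j : rows_ok s -> (1 < j <= n)%N -> int_mem s 32 0 = j ->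
  tri copy_slots s (j * 5 + 3) (fun s' =>
    [/\ frame [:: 19; 25] [::] s s',
        forall i x, i != j.-1 -> (x < N)%N -> Act s' i x = Act s i x
      & forall x, (x < j.-1)%N -> Act s' j.-1 x = Act s j x]).
Proof.
move=> rw jn js.
pose I k s' := int_mem s' 19 0 = k /\
    [/\ frame [:: 19; 25] [::] s s',
        forall i x, i != j.-1 -> (x < N)%N -> Act s' i x = Act s i x
      & forall x, (x < k)%N -> (x < j.-1)%N -> Act s' j.-1 x = Act s j x].
apply: (@tri_weaken _ _ _ (j.-1 * (1 + 4) + 3) _ (I j.-1)); last 2 first.
- by lia.
- by move=> s' [_ [h1 h2 h3]]; split=> // x xj; apply: h3.
apply: tri_for => [|k s' _ [xk [fr _ _]]|k s' kj [xk [fr h2 h3]]].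
- by split=> //; split=> //; framing.
- by split=> //=; rewrite (proj1 fr 32 isT) js subn1.
have [fi _] := fr.
apply: tri_iset.
rewrite /= /upd /= xk !(fi 9) // (fi 32) // js !rw; try (rewrite /N; lia).
rewrite !subn1 -/(Act _ _ _) h2 //; try (rewrite /N; lia).
split=> //; split=> [|i x ij xN|x xk' xj]; first by framing.
  have <- := h2 i x ij xN.
  by rewrite [LHS]/Act /= /upd /= cell_eq // ?(negbTE ij) //; rewrite /N; lia.
rewrite [LHS]/Act /= /upd /= cell_eq ?eqxx; try (rewrite /N; lia).
case: eqVneq => [->|xk1] //=; apply: h3 => //; lia.
Qed.

(** The slots in use lie below [C] and the identifiers given out below [nid]; the clauses that leave
    these entries unchanged keep all suspended callers valid. *)
Record merged_state s s' (j P Q A B C nid : nat) : Prop := MergedState {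
  ms_frame : frame [:: 19; 25; 26; 27; 28; 29; 32; 38; 39] [:: 4; 5; 9] s s';
  ms_nid : int_mem s' 29 0 = nid.+1;
  ms_level : int_mem s' 32 0 = j.-1;
  ms_deg : forall x, (x < C)%N -> real_mem s' 5 x = real_mem s 5 x;
  ms_degC : real_mem s' 5 C =
    real_mem s 5 A + real_mem s 5 B - (Mx s A B + Mx s A B);
  ms_node : forall x, (x < C)%N -> int_mem s' 26 x = int_mem s 26 x;
  ms_nodeC : int_mem s' 26 C = nid;
  ms_left : forall x, (x < nid)%N -> int_mem s' 27 x = int_mem s 27 x;
  ms_right : forall x, (x < nid)%N -> int_mem s' 28 x = int_mem s 28 x;
  ms_leftC : int_mem s' 27 nid = int_mem s 26 A;
  ms_rightC : int_mem s' 28 nid = int_mem s 26 B;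
  ms_mx : forall x y, (x < C)%N -> (y < C)%N -> Mx s' x y = Mx s x y;
  ms_mxC : Mx s' C C = 0;
  ms_mxl : forall k, (k < j)%N ->
    Mx s' C (Act s j k) = Mx s A (Act s j k) + Mx s B (Act s j k);
  ms_mxr : forall k, (k < j)%N ->
    Mx s' (Act s j k) C = Mx s A (Act s j k) + Mx s B (Act s j k);
  ms_act : forall i x, i != j.-1 -> (x < N)%N -> Act s' i x = Act s i x;
  ms_actC : forall x, (x < j.-1)%N -> Act s' j.-1 x =
    if x == (if P == j.-1 then Q else P) then C
    else if x == Q then Act s j j.-1 else Act s j x }.

Lemma merge_slots_tri s j K P Q nid : rows_ok s -> (2 < j <= K)%N -> (K <= n)%N ->
  int_mem s 32 0 = j -> int_mem s 42 0 = K -> int_mem s 29 0 = nid ->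
  int_mem s 35 0 = P -> int_mem s 36 0 = Q -> int_mem s 37 0 = Act s j P ->
  (P < j)%N -> (Q < j)%N -> 
  (forall x, (x < j)%N -> (Act s j x < K + K - j)%N) ->
  tri merge_slots s (j * 14 + 30)
    (fun s' => merged_state s s' j P Q (Act s j P) (Act s j Q) (K + K - j) nid).
Proof.
move=> rw jK Kn js Ks ns Ps Qs As Pj Qj slo.
set A := Act s j P; set B := Act s j Q; set C := (K + K - j)%N.
have CN : (C < N)%N by rewrite /C /N; lia.
have AC : (A < C)%N by apply: slo.
have BC : (B < C)%N by apply: slo.
have jN : (j <= N)%N by rewrite /N; lia.
eapply tri_le.
do 3!(apply: tri_seq; try apply: tri_iset; try apply: tri_rset).
rewrite /= /upd /= js Ks Qs As rw // -/C -/(Act s j Q) -/A -/B.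
rewrite !rw -?/(Mx s A B); try (rewrite /N in CN *; lia).
apply: tri_seq; apply: tri_weaken; [apply: (merge_rows_tri (j := j) (A := A) (B := B) (C := C)) => //=; rewrite ?/upd //= | exact: leqnn |].
  by lia.
move=> s1 [fr1 mx1 mxC1] /=.
have [fi1 fr1'] := fr1.
apply: tri_seq; apply: tri_rset.
do 4!(apply: tri_seq; apply: tri_iset).
rewrite /= /upd /= !(fi1 39) // !(fi1 29) // !(fi1 9) // !(fi1 37) // !(fi1 38) //.
rewrite !(fi1 26) //= /upd /= ns As -/A (ltn_eqF AC) (ltn_eqF BC) /= addn1 rw ?(ltnW CN) //.
set s2 := set_int _ 29 _ _.
have i2 a : a \notin [:: 19; 26; 27; 28; 29; 38; 39] -> int_mem s2 a = int_mem s a.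
  rewrite !inE !negb_or => /and5P[a1 a2 a3 a4 /and3P[a5 a6 a7]].
  rewrite /s2 /= /upd (negbTE a2) (negbTE a3) (negbTE a4) (negbTE a5) /=.
  by rewrite fi1 ?inE //= /upd (negbTE a6) (negbTE a7).
apply: tri_seq; apply: tri_weaken; [apply: (copy_slots_tri (j := j)) | exact: leqnn |].
- by move=> i iN; rewrite i2 // rw.
- by lia.
- by rewrite i2.
move=> s3 [[fi3 fr3] act3 actC3].
apply: tri_seq; apply: tri_iset; apply: tri_seq.
have rN3 : int_mem s3 9 j.-1 = (j.-1 * N)%N by rewrite fi3 // i2 // rw; lia.
have v3 a : a \notin [:: 19; 25; 26; 27; 28; 29; 38; 39] -> int_mem s3 a = int_mem s a.
  rewrite !inE !negb_or => /and3P[a1 a2 aa]; rewrite fi3 ?inE ?negb_or ?a1 //.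
  by rewrite i2 // !inE !negb_or a1.
have C3 : int_mem s3 39 0 = C by rewrite fi3 //= /upd /= fi1.
have act2 i x : Act s2 i x = Act s i x by rewrite /Act i2.
(* [T] is the place of the merged metavertex in the new row, so that both outcomes of the final test
   are treated at once. The last position disappears, so [Q] is taken when [P] is the last. *)
have H T : T = (if P == j.-1 then Q else P) -> merged_state s
    (set_int (set_int (set_int s3 25 (j.-1 * N + Q) (Act s j j.-1))
      25 (j.-1 * N + T) C) 32 0 j.-1) j P Q A B C nid.
  move=> TE; have TN : (T < N)%N by rewrite TE /N; case: ifP => _; lia.
  have QN : (Q < N)%N by lia.
  split=> //.
  - split=> a; rewrite !inE !negb_or.
      move=> /and5P[a1 a2 a3 a4 /and5P[a5 a6 a7 a8 a9]].
      rewrite /= /upd (negbTE a2) (negbTE a7) /= v3 // !inE !negb_or.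
      by rewrite a1 a2 a3 a4 a5 a6 a8 a9.
    move=> /and3P[a1 a2 a3]; rewrite fr3 //= /upd (negbTE a1) /=.
    by rewrite fr1' ?inE ?negb_or ?a1 //= /upd (negbTE a2).
  - by rewrite /= /upd /= fi3 //.
  - move=> x xC; rewrite /= /upd /= fr3 //= /upd /= fr1' //= /upd /=.
    by rewrite (ltn_eqF xC).
  - by rewrite /= /upd /= fr3 //= /upd /= fr1' //= /upd /= eqxx.
  - by move=> x xC; rewrite /= /upd /= fi3 //= /upd /= (ltn_eqF xC) fi1.
  - by rewrite /= /upd /= fi3 //= /upd /= eqxx.
  - by move=> x xC; rewrite /= /upd /= fi3 //= /upd /= (ltn_eqF xC) fi1.
  - by move=> x xC; rewrite /= /upd /= fi3 //= /upd /= (ltn_eqF xC) fi1.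
  - by rewrite /= /upd /= fi3 //= /upd /= eqxx.
  - by rewrite /= /upd /= fi3 //= /upd /= eqxx.
  - move=> x y xC yC; have := mx1 x y xC yC; rewrite /Mx /= /upd /= fr3 //= => <-.
    by rewrite /upd /= cell_eq ?(ltn_eqF xC) //; apply: ltn_trans CN.
  - by rewrite /Mx /= /upd /= fr3 //= /upd /= eqxx.
  - move=> k kj; have [+ _] := mxC1 k kj; rewrite /Mx /Act /= /upd /= => <-.
    rewrite fr3 //= /upd /= cell_eq // ?(ltn_eqF (slo _ kj)) ?andbF //.
    exact: ltn_trans (slo _ kj) CN.
  - move=> k kj; have [_ +] := mxC1 k kj; rewrite /Mx /Act /= /upd /= => <-.
    rewrite fr3 //= /upd /= cell_eq // ?(ltn_eqF (slo _ kj)) ?andbF //.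
  - move=> i x ij xN; have := act3 i x ij xN; rewrite act2 => <-.
    by rewrite [LHS]/Act /= /upd /= !cell_eq // (negbTE ij).
  - move=> x xj; have := actC3 x xj; rewrite act2 => <-.
    rewrite [LHS]/Act /= /upd /= !cell_eq // ?eqxx /= ?TE //; first by lia.
    by rewrite /N; lia.
rewrite /= !(v3 32) // !(v3 36) // js Qs !subn1 rN3.
rewrite (v3 9) // rw // -/(Act s3 j j.-1) act3 ?act2; try lia.
apply: tri_if => /=; rewrite /upd /= !(v3 32) // !(v3 35) // js Ps !subn1 => PQ;
  apply: tri_iset; apply: tri_iset => /=; rewrite /upd /=.
- rewrite !(v3 32) // !(v3 36) // js Qs !subn1 rN3 C3.
  by apply: H; rewrite ifT //; lia.
- rewrite !(v3 32) // !(v3 35) // js Ps !subn1 rN3 C3.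
  by apply: H; rewrite ifF //; lia.
by lia.
Qed.

Definition block (pos : 'I_n -> nat) x := [set u | pos u == x].

Lemma block_disjoint pos x y : x != y -> [disjoint block pos x & block pos y].
Proof.
move=> xy; rewrite disjoints_subset; apply/subsetP => u; rewrite !inE => /eqP ->.
by [].
Qed.

Lemma row_sum pos x k (h : nat -> R) : (forall u, (pos u < k)%N) ->
  \sum_(y < k) (if x == y :> nat then 0 else vcut G (block pos x) (block pos y)) * h y =
  \sum_(e in [set e | pos (src G e) != pos (dst G e)])
     wt G e * ((pos (src G e) == x)%:R * h (pos (dst G e)) +
               (pos (dst G e) == x)%:R * h (pos (src G e))).
Proof.
move=> posk.
transitivity (\sum_e \sum_(y < k) (if x == y :> nat then 0 else
   wt G e * (((src G e \in block pos x) && (dst G e \in block pos y))%:R +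
     ((dst G e \in block pos x) && (src G e \in block pos y))%:R)) * h y).
  rewrite exchange_big; apply: eq_bigr => y _ /=; case: eqVneq => _.
    by rewrite mul0r big1 // => e _; rewrite mul0r.
  by rewrite mulr_suml.
rewrite [RHS]big_mkcond; apply: eq_bigr => e _; rewrite !inE.
have one (a b : nat) : (b < k)%N ->
    \sum_(y < k) (if x == y :> nat then 0 else ((a == x) && (b == y))%:R * h y) =
    if x == b then 0 else (a == x)%:R * h b :> R.
  move=> bk; rewrite (bigD1 (Ordinal bk)) //= eqxx andbT big1 ?addr0 //.
  move=> y; rewrite -val_eqE /= eq_sym => /negbTE->; rewrite andbF mul0r.
  by case: ifP.
transitivity (wt G e *
  (\sum_(y < k) (if x == y :> nat then 0 else
      ((pos (src G e) == x) && (pos (dst G e) == y))%:R * h y) +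
   \sum_(y < k) (if x == y :> nat then 0 else
      ((pos (dst G e) == x) && (pos (src G e) == y))%:R * h y))).
  rewrite -big_split mulr_sumr; apply: eq_bigr => y _ /=; rewrite !inE.
  by case: ifP => _; ring.
rewrite !one //; case: (eqVneq (pos (src G e)) (pos (dst G e))) => [->|sd] /=.
  by case: (eqVneq x (pos (dst G e))) => [_|/negbTE xd];
    rewrite ?[pos _ == x]eq_sym ?xd /=; ring.
rewrite [pos (dst G e) == x]eq_sym [pos (src G e) == x]eq_sym.
case: (eqVneq x (pos (dst G e))) => [xd|_]; case: (eqVneq x (pos (src G e))) => [xs|_] /=;
  try ring.
by rewrite -xs -xd eqxx in sd.
Qed.

Lemma vcut_compl pos x k : (forall u, (pos u < k)%N) ->
  \sum_(y < k) (if x == y :> nat then 0 else vcut G (block pos x) (block pos y)) =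
  vcut G (block pos x) (~: block pos x).
Proof.
move=> posk; have := row_sum x (fun=> 1) posk.
under eq_bigr do rewrite mulr1; move=> ->; rewrite [LHS]big_mkcond.
apply: eq_bigr => e _; rewrite !inE !mulr1.
case: (eqVneq (pos (src G e)) (pos (dst G e))) => [->|sd] /=.
  by case: eqVneq => _ /=; ring.
case: (eqVneq (pos (src G e)) x) => [<-|xs] /=; last by rewrite andbT.
by rewrite eq_sym (negbTE sd) /=; ring.
Qed.

(** Each live edge is met once from either end. Hence drawing a row by degree and then an entry of
    that row amounts to drawing an edge by weight. *)
Lemma pair_sum pos k (H : nat -> nat -> R) : (forall u, (pos u < k)%N) ->
  \sum_(x < k) \sum_(y < k)
    (if x == y :> nat then 0 else vcut G (block pos x) (block pos y)) * H x y =
  \sum_(e in [set e | pos (src G e) != pos (dst G e)])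
     wt G e * (H (pos (src G e)) (pos (dst G e)) + H (pos (dst G e)) (pos (src G e))).
Proof.
move=> posk; under eq_bigr do rewrite row_sum //.
rewrite exchange_big; apply: eq_bigr => e _ /=; rewrite -mulr_sumr big_split /=.
have one a (h : nat -> R) : (a < k)%N -> \sum_(x < k) (a == x :> nat)%:R * h x = h a.
  move=> ak; rewrite (bigD1 (Ordinal ak)) //= eqxx mul1r big1 ?addr0 // => y.
  by rewrite -val_eqE /= eq_sym => /negbTE ->; rewrite mul0r.
by rewrite (one _ (fun x => H x _)) // (one _ (fun x => H x _)).
Qed.

(** The weight between the two parts leaves both of their degrees; this justifies the update of real
    array 5 in a merge. *)
Lemma vcut_merge (X Y : {set 'I_n}) : [disjoint X & Y] ->
  vcut G (X :|: Y) (~: (X :|: Y)) =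
  vcut G X (~: X) + vcut G Y (~: Y) - (vcut G X Y + vcut G X Y).
Proof.
move=> dXY.
have hX : ~: X = Y :|: ~: (X :|: Y).
  apply/setP => u; rewrite !inE negb_or.
  move: dXY; rewrite disjoint_sym disjoints_subset => /subsetP /(_ u); rewrite inE.
  by case: (u \in Y) => [/(_ isT) ->|_] //=; rewrite andbT.
have hY : ~: Y = X :|: ~: (X :|: Y).
  apply/setP => u; rewrite !inE negb_or.
  move: dXY; rewrite disjoints_subset => /subsetP /(_ u); rewrite inE.
  by case: (u \in X) => [/(_ isT) ->|_] //=.
have dX : [disjoint X & ~: (X :|: Y)] by rewrite disjoints_subset setCK subsetUl.
have dY : [disjoint Y & ~: (X :|: Y)] by rewrite disjoints_subset setCK subsetUr.
rewrite vcutUl // hX hY !vcutUr // [vcut G Y X]vcutC; ring.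
Qed.

Variable K : nat.
Hypothesis K2 : (1 < K <= n)%N.

(** [S] is a ghost map from identifiers to vertex sets; the machine stores only identifiers. The
    slots of this graph lie below [K + K - j], the slot that a contraction from level [j]
    creates. *)
Definition level_ok (S : nat -> {set 'I_n}) s j f := exists pos,
  [/\ numbering f j pos, forall x, (x < j)%N -> (Act s j x < K + K - j)%N,
      forall x, (x < j)%N -> (int_mem s 26 (Act s j x) < int_mem s 29 0)%N /\
        S (int_mem s 26 (Act s j x)) = block pos x,
      forall x, (x < j)%N ->
        real_mem s 5 (Act s j x) = vcut G (block pos x) (~: block pos x)
    & forall x y, (x < j)%N -> (y < j)%N -> Mx s (Act s j x) (Act s j y) =
        if x == y then 0 else vcut G (block pos x) (block pos y)].

(** A graph at level [i >= j] uses slots below [K + K - i], hence below the new slot, and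
    identifiers already given out; a contraction from level [j] touches neither. *)
Lemma level_ok_above S S' s s' j P Q A B i f :
  merged_state s s' j P Q A B (K + K - j) (int_mem s 29 0) -> (j <= i <= K)%N ->
  (0 < j)%N ->
  (forall x, (x < int_mem s 29 0)%N -> S' x = S x) ->
  level_ok S s i f -> level_ok S' s' i f.
Proof.
move=> ms /andP[ji iK] j0 SS [pos [h1 h2 h3 h4 h5]].
have E x : (x < i)%N -> Act s' i x = Act s i x.
  by move=> xi; rewrite (ms_act ms) // /N; lia.
have lt x : (x < i)%N -> (Act s i x < K + K - j)%N.
  by move=> xi; apply: leq_trans (h2 x xi) _; lia.
exists pos; split=> // [x xi|x xi|x xi|x y xi yi].
- by rewrite E // h2.
- rewrite E // (ms_node ms) ?lt // (ms_nid ms); have [lx <-] := h3 x xi.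
  by split; [exact: leqW|rewrite SS].
- by rewrite E // (ms_deg ms) ?lt // h4.
- by rewrite !E // (ms_mx ms) ?lt // h5.
Qed.

Lemma level_ok_merged S S' s s' j P Q f pos e :
  let A := Act s j P in let B := Act s j Q in
  merged_state s s' j P Q A B (K + K - j) (int_mem s 29 0) ->
  (2 < j <= K)%N -> (P < j)%N -> (Q < j)%N -> P != Q ->
  numbering f j pos -> (forall x, (x < j)%N -> (Act s j x < K + K - j)%N) ->
  (forall x, (x < j)%N -> (int_mem s 26 (Act s j x) < int_mem s 29 0)%N /\
        S (int_mem s 26 (Act s j x)) = block pos x) ->
  (forall x, (x < j)%N ->
        real_mem s 5 (Act s j x) = vcut G (block pos x) (~: block pos x)) ->
  (forall x y, (x < j)%N -> (y < j)%N -> Mx s (Act s j x) (Act s j y) =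
        if x == y then 0 else vcut G (block pos x) (block pos y)) ->
  (forall x, (x < int_mem s 29 0)%N -> S' x = S x) ->
  S' (int_mem s 29 0) = S (int_mem s 26 A) :|: S (int_mem s 26 B) ->
  (pos (src G e) = P /\ pos (dst G e) = Q) \/
  (pos (src G e) = Q /\ pos (dst G e) = P) ->
  level_ok S' s' j.-1 (contract G f e).
Proof.
move=> A B ms jK Pj Qj PQ h1 h2 h3 h4 h5 SS Sn PQe.
have h1' := numbering_contract h1 PQ PQe.
set C := (K + K - j)%N in ms *; set nid := int_mem s 29 0 in ms SS Sn h3 *.
(* [p0] is the place of the merged metavertex in the new row; for any other place [x], [tau x] is
   where its slot stood in the old row. *)
set p0 := if P == j.-1 then Q else P.
pose tau x := if x == Q then j.-1 else x.
pose pos' u := merged P Q j (pos u).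
have actE x : (x < j.-1)%N -> Act s' j.-1 x = if x == p0 then C else Act s j (tau x).
  by move=> xj; rewrite (ms_actC ms) // -/p0 /tau; case: ifP => // _; case: ifP.
have tauP x : (x < j.-1)%N -> x != p0 ->
    [/\ (tau x < j)%N, tau x != P, tau x != Q & block pos' x = block pos (tau x)].
  move=> xj xp; rewrite /tau; split.
  - by case: ifP; lia.
  - move: xp; rewrite /p0; case: (eqVneq x Q) => [->|xQ].
      by case: (eqVneq P j.-1) => [_|]; rewrite ?eqxx // eq_sym.
    by case: (eqVneq P j.-1) => //; lia.
  - move: xp; rewrite /p0; case: (eqVneq x Q) => [xQ|//].
    by move: xj; rewrite xQ; lia.
  - apply/setP => u; rewrite !inE /pos' /merged -/p0.
    have := (let: And3 b _ _ := h1 in b) u; move: (pos u) => y yj.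
    move: xp; rewrite /p0.
    case: (eqVneq P j.-1) => ?; case: (eqVneq y P) => ?; case: (eqVneq y Q) => ?;
    case: (eqVneq x Q) => ?; case: (eqVneq y j.-1) => ? /=; lia.
have blockC : block pos' p0 = block pos P :|: block pos Q.
  apply/setP => u; rewrite !inE /pos' /merged -/p0.
  have := (let: And3 b _ _ := h1 in b) u; move: (pos u) => y yj; rewrite /p0.
  case: (eqVneq P j.-1) => ?; case: (eqVneq y P) => ?; case: (eqVneq y Q) => ?;
    case: (eqVneq y j.-1) => ? /=; lia.
have tau_inj x y : (x < j.-1)%N -> (y < j.-1)%N -> (tau x == tau y) = (x == y).
  by move=> xj yj; rewrite /tau; case: (eqVneq x Q) => ?; case: (eqVneq y Q) => ?; lia.
have dPQ : [disjoint block pos P & block pos Q] by apply: block_disjoint.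
exists pos'; split=> //.
- move=> x xj; rewrite actE //; case: ifPn => [_|xp]; first by rewrite /C; lia.
  by have [tj _ _ _] := tauP x xj xp; apply: leq_trans (h2 _ tj) _; rewrite /C; lia.
- move=> x xj; rewrite actE // (ms_nid ms); case: ifPn => [/eqP->|xp].
    by rewrite (ms_nodeC ms) Sn blockC (proj2 (h3 P Pj)) (proj2 (h3 Q Qj)).
  have [tj _ _ ->] := tauP x xj xp; have [l1 <-] := h3 _ tj.
  by rewrite (ms_node ms) ?h2 // SS //; split=> //; apply: leqW.
- move=> x xj; rewrite actE //; case: ifPn => [/eqP->|xp].
    rewrite (ms_degC ms) blockC vcut_merge // h4 // h4 // h5 // (negbTE PQ); ring.
  by have [tj _ _ ->] := tauP x xj xp; rewrite (ms_deg ms) ?h2 // h4.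
- move=> x y xj yj; rewrite !actE //.
  have [xp|xp] := eqVneq x p0; have [yp|yp] := eqVneq y p0.
  + by rewrite xp yp eqxx (ms_mxC ms).
  + have [tj tP tQ ->] := tauP y yj yp; rewrite (ms_mxl ms) // !h5 // xp blockC.
    by rewrite eq_sym [p0 == y]eq_sym (negbTE yp) (negbTE tP) eq_sym (negbTE tQ) vcutUl.
  + have [tj tP tQ ->] := tauP x xj xp; rewrite (ms_mxr ms) // !h5 // yp blockC.
    by rewrite eq_sym (negbTE tP) [Q == _]eq_sym (negbTE tQ) (negbTE xp) [RHS]vcutC vcutUl.
  + have [tx _ _ ->] := tauP x xj xp; have [ty _ _ ->] := tauP y yj yp.
    by rewrite (ms_mx ms) ?h2 // h5 // tau_inj.
Qed.

(** The degree that normalises a row cancels against the probability of that row. A row of degree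
    zero is harmless because all its entries vanish. *)
Lemma pair_mean j (M Z : nat -> nat -> R) (deg : nat -> R) (a : R) :
  (forall x y, 0 <= M x y) -> (forall x, deg x = \sum_(y < j) M x y) ->
  0 < \sum_(x < j) deg x ->
  (\sum_(x < j) deg x * (a + (\sum_(y < j) M x y * Z x y) / deg x)) /
    \sum_(x < j) deg x =
  a + (\sum_(x < j) \sum_(y < j) M x y * Z x y) / \sum_(x < j) deg x.
Proof.
move=> M0 degE deg0.
have -> : \sum_(x < j) deg x * (a + (\sum_(y < j) M x y * Z x y) / deg x) =
    \sum_(x < j) (deg x * a + \sum_(y < j) M x y * Z x y).
  apply: eq_bigr => x _; rewrite mulrDr; congr (_ + _).
  have [d0|d0] := eqVneq (deg x) 0; last by rewrite mulrC divfK.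
  rewrite d0 mul0r big1 // => y _.
  move: d0; rewrite degE => /eqP; rewrite psumr_eq0 // => /allP /(_ y).
  by rewrite mem_index_enum => /(_ isT) /= /eqP ->; rewrite mul0r.
by rewrite big_split /= -mulr_suml; field; rewrite gt_eqF.
Qed.

Variable s0 : state R.
Hypothesis rows0 : rows_ok s0.
Hypothesis size0 : int_mem s0 42 0 = K.

(** Identifiers below [K] are the initial metavertices, and every later one is the union of two
    smaller ones, so a decreasing sweep can expand any of them into vertices. *)
Definition dag_ok (S : nat -> {set 'I_n}) s :=
  [/\ forall id, (id < K)%N -> S id = [set u : 'I_n | int_mem s0 23 u == id],
      forall id, (K <= id < int_mem s 29 0)%N ->
        [/\ (int_mem s 27 id < id)%N, (int_mem s 28 id < id)%N
          & S id = S (int_mem s 27 id) :|: S (int_mem s 28 id)]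
    & (K <= int_mem s 29 0)%N].

Definition inner_acc (S : nat -> {set 'I_n}) s (acc : option {set 'I_m}) :=
  if acc is Some C then
    [/\ int_mem s 30 0 = 1%N, (int_mem s 31 0 < int_mem s 29 0)%N,
        real_mem s 7 0 = weight G C & C = crossing G (S (int_mem s 31 0))]
  else int_mem s 30 0 = 0%N.

Fixpoint levels_ok S s st := if st is f :: fs then
  level_ok S s (K - size fs) f /\ levels_ok S s fs else True.

Definition inner_inv_at S st acc s :=
  [/\ frame [:: 15; 19; 25; 26; 27; 28; 29; 30; 31; 32; 33; 34; 35; 36; 37; 38; 39]
            [:: 4; 5; 6; 7; 9] s0 s,
      int_mem s 34 0 = 1%N, dag_ok S s, levels_ok S s st & inner_acc S s acc].

Definition inner_inv st acc s := exists S, inner_inv_at S st acc s.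

Definition at_inner_down st acc s :=
  [/\ inner_inv st acc s, int_mem s 33 0 = 1%N & int_mem s 32 0 = level K st].

Definition at_inner_up fs acc s :=
  [/\ inner_inv fs acc s, int_mem s 33 0 = 0%N & int_mem s 32 0 = (K - size fs)%N].

Lemma inner_inv_frame S st acc s s' :
  frame [:: 15; 19; 32; 33; 35; 36; 37; 38] [:: 6; 9] s s' ->
  inner_inv_at S st acc s -> inner_inv_at S st acc s'.
Proof.
move=> fr [h1 h2 [d1 d2 d3] h4 h5]; have [fi fre] := fr; split.
- by apply: frame_trans h1 _; apply: frame_sub fr _ _.
- by rewrite fi.
- by split=> // [id|]; rewrite !fi //; apply: d2.
- elim: st h4 {h5} => //= f fs IH [[pos [g1 g2 g3 g4 g5]] /IH g6]; split=> //.
  by exists pos; split=> // [x xj|x xj|x xj|x y xj yj];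
    rewrite /Mx /Act ?fi ?fre //; [exact: g2|exact: g3|exact: g4|exact: g5].
- by case: acc h5 => [C|] /=; rewrite ?fi ?fre.
Qed.

Hypothesis Gconn : connected_weights G.

Variables (kappa D : R) (V : seq cmd -> state R -> R) (rest : seq cmd) (cN : nat).
Hypothesis HV : supersolution kappa D V.

Let k0 : 0 <= kappa. Proof. by case: HV. Qed.
Let VD cs s : V cs s <= D. Proof. by case: HV. Qed.

(** Potential: the phase ends with a sweep over all identifiers at cost [cN] each, and each
    contraction creates one identifier. Subtracting [cN] per identifier charges the sweep to the
    contractions. *)
Definition inner_v s := V (inner_loop :: rest) s - kappa * (cN * int_mem s 29 0)%:R.

Lemma merge_down f fs acc s s' P Q pos e S :
  let j := (K - size fs)%N in
  (2 < j)%N -> (P < j)%N -> (Q < j)%N -> P != Q ->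
  merged_state s s' j P Q (Act s j P) (Act s j Q) (K + K - j) (int_mem s 29 0) ->
  frame [:: 15; 19; 25; 26; 27; 28; 29; 30; 31; 32; 33; 34; 35; 36; 37; 38; 39]
            [:: 4; 5; 6; 7; 9] s0 s ->
  int_mem s 34 0 = 1%N -> int_mem s 33 0 = 1%N ->
  dag_ok S s -> levels_ok S s fs -> inner_acc S s acc ->
  numbering f j pos ->
  (forall x, (x < j)%N -> (Act s j x < K + K - j)%N) ->
  (forall x, (x < j)%N -> (int_mem s 26 (Act s j x) < int_mem s 29 0)%N /\
        S (int_mem s 26 (Act s j x)) = block pos x) ->
  (forall x, (x < j)%N ->
        real_mem s 5 (Act s j x) = vcut G (block pos x) (~: block pos x)) ->
  (forall x y, (x < j)%N -> (y < j)%N -> Mx s (Act s j x) (Act s j y) =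
        if x == y then 0 else vcut G (block pos x) (block pos y)) ->
  (pos (src G e) = P /\ pos (dst G e) = Q) \/
  (pos (src G e) = Q /\ pos (dst G e) = P) ->
  at_inner_down [:: contract G f e, f & fs] acc s'.
Proof.
move=> j j2 Pj Qj PQ ms fr i34 i33 [d1 d2 d3] lv ac h1 h2 h3 h4 h5 PQe.
have jK : (2 < j <= K)%N by rewrite /j in j2 *; lia.
have [fi fre] := ms_frame ms.
pose nid := int_mem s 29 0.
pose S' id := if id == nid then S (int_mem s 26 (Act s j P)) :|: S (int_mem s 26 (Act s j Q)) else S id.
have SS x : (x < nid)%N -> S' x = S x by move=> xn; rewrite /S' ltn_eqF.
have Sn : S' nid = S (int_mem s 26 (Act s j P)) :|: S (int_mem s 26 (Act s j Q)).
  by rewrite /S' eqxx.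
have above i g : (j <= i <= K)%N -> level_ok S s i g -> level_ok S' s' i g.
  by move=> ji; apply: level_ok_above ms ji _ SS; lia.
split; last 2 first.
- by rewrite fi.
- by rewrite (ms_level ms) level_cons /j /=; lia.
exists S'; split.
- apply: frame_trans fr _; exact: frame_sub (ms_frame ms) _ _.
- by rewrite fi.
- split=> [id iK|id|].
  + by rewrite SS ?d1 //; apply: leq_trans iK d3.
  + rewrite (ms_nid ms) ltnS => /andP[Kid]; rewrite leq_eqVlt => /orP[/eqP ->|idn].
      rewrite (ms_leftC ms) (ms_rightC ms).
      have [lP _] := h3 P Pj; have [lQ _] := h3 Q Qj.
      by rewrite lP lQ Sn !SS.
    have [|l1 l2 l3] := d2 id; first by rewrite Kid.
    rewrite (ms_left ms) // (ms_right ms) // l1 l2 !SS //; first exact: ltn_trans idn.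
    exact: ltn_trans idn.
  + by rewrite (ms_nid ms); apply: leqW.
- have e1 : (K - (size fs).+1 = j.-1)%N by rewrite /j; lia.
  rewrite /= e1; split; last split.
  + exact: (level_ok_merged ms jK Pj Qj PQ h1 h2 h3 h4 h5 SS Sn PQe).
  + by apply: above; [rewrite /j; lia | exists pos].
  + have lvs gs : (size gs <= size fs)%N -> levels_ok S s gs -> levels_ok S' s' gs.
      elim: gs => //= g gs IH sg [lg /IH H]; split; last by apply: H; lia.
      by apply: above lg; rewrite /j; lia.
    exact: lvs.
- case: acc ac => [C|] /=; last by rewrite fi.
  rewrite !(fi 30) // !(fi 31) // fre // (ms_nid ms) => -[-> a2 -> a4].
  by split=> //; [exact: leqW|rewrite SS].
Qed.

Lemma inner_vD s : inner_v s <= D.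
Proof. by rewrite /inner_v lerBlDr (le_trans (VD _ _)) // lerDl mulr_ge0. Qed.

Lemma inner_v_le s t X : inner_v s <= X ->
  int_mem s 29 0 = t -> V (inner_loop :: rest) s <= kappa * (cN * t)%:R + X.
Proof. by rewrite /inner_v => + <-; lra. Qed.

Lemma inner_contract_step f fs acc s X : (2 < level K (f :: fs))%N ->
  at_inner_down (f :: fs) acc s ->
  (forall e s', e \in live G f ->
     at_inner_down [:: contract G f e, f & fs] acc s' -> inner_v s' <= X e) ->
  inner_v s <= kappa * (level K (f :: fs) * 32 + (70 + cN))%:R +
    \sum_e dpick (live G f) (wt G) e * X e.
Proof.
set j := level K (f :: fs) => j2 ds hX.
have jE : j = (K - size fs)%N by rewrite /j level_cons.
have [iv i33 i32] := ds.
have [S iva] := iv; have [fr i34 dg [lv lvs] ac] := iva.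
rewrite -jE in lv; have [pos [h1 h2 h3 h4 h5]] := lv.
have [pb ps pe] := h1.
have jN : (j <= N)%N by rewrite jE /N; lia.
pose M x y := if x == y then 0 else vcut G (block pos x) (block pos y).
pose deg x := vcut G (block pos x) (~: block pos x).
have M0 x y : 0 <= M x y by rewrite /M; case: eqP => // _; apply: vcut_ge0.
have degE x : deg x = \sum_(y < j) M x y.
  by rewrite /deg -(vcut_compl x pb); apply: eq_bigr.
have W0 := weight_live_gt0 Gconn h1 (ltnW j2).
have degW : \sum_(x < j) deg x = weight G (live G f) *+ 2.
  under eq_bigr do rewrite degE.
  transitivity (\sum_(x < j) \sum_(y < j) M x y * 1).
    by apply: eq_bigr => x _; apply: eq_bigr => y _; rewrite mulr1.
  rewrite (pair_sum (fun _ _ => 1) pb) (live_numbering G h1) /weight mulr2n -big_split /=.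
  by apply: eq_bigr => e _; ring.
pose btw x y e := ((pos (src G e) == x) && (pos (dst G e) == y)) ||
                  ((pos (src G e) == y) && (pos (dst G e) == x)).
(* The machine draws a pair of metavertices and does not know which of the parallel edges between
   them was meant, so it has to satisfy the least of their bounds. [D] can serve as the unit of the
   minimum because [inner_v] never exceeds it. *)
pose Z x y := \big[Num.min/D]_(e | btw x y e) X e.
set nid := int_mem s 29 0.
pose T9 := kappa * (j * 9 + 12)%:R.
suff main : V (inner_loop :: rest) s <= T9 +
   (\sum_(x < j) deg x * (T9 + (\sum_(y < j) M x y *
      (kappa * (j * 14 + 31 + cN * nid.+1)%:R + Z x y)) / deg x)) / \sum_(x < j) deg x.
  rewrite /inner_v lerBlDr; apply: le_trans main _.
  have dgt0 : 0 < \sum_(x < j) deg x by rewrite degW pmulrn_rgt0.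
  rewrite (@pair_mean j M (fun x y => kappa * (j * 14 + 31 + cN * nid.+1)%:R + Z x y)
    deg T9 M0 degE dgt0) degW.
  rewrite (pair_sum (fun x y => kappa * (j * 14 + 31 + cN * nid.+1)%:R + Z x y)) //.
  rewrite sum_dpick -(live_numbering G h1) -/(weight G (live G f)).
  set W := weight G _ in W0 *.
  rewrite -/nid (_ : kappa * (j * 32 + (70 + cN))%:R = kappa * (j * 18 + 39)%:R +
     kappa * (j * 14 + 31 + cN)%:R); last first.
    by rewrite -mulrDr -natrD; congr (_ * _%:R); lia.
  have -> : kappa * (j * 14 + 31 + cN * nid.+1)%:R =
     kappa * (j * 14 + 31 + cN)%:R + kappa * (cN * nid)%:R.
    by rewrite -mulrDr -natrD; congr (_ * _%:R); lia.
  set T := kappa * (j * 14 + 31 + cN)%:R; set U := kappa * (cN * nid)%:R.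
  have : T9 + T9 <= kappa * (j * 18 + 39)%:R.
    by rewrite -mulrDr -natrD ler_wpM2l // ler_nat; lia.
  suff : (\sum_(e in live G f) wt G e *
      (T + U + Z (pos (src G e)) (pos (dst G e)) +
       (T + U + Z (pos (dst G e)) (pos (src G e))))) / (W *+ 2) <=
      T + U + (\sum_(e in live G f) wt G e * X e) / W by lra.
  have -> : T + U + (\sum_(e in live G f) wt G e * X e) / W =
     (\sum_(e in live G f) wt G e * (T + U + X e + (T + U + X e))) / (W *+ 2).
    have -> : \sum_(e in live G f) wt G e * (T + U + X e + (T + U + X e)) =
       ((T + U) * W + \sum_(e in live G f) wt G e * X e) *+ 2.
      rewrite mulrnDl /W /weight mulr_sumr -!sumrMnl -big_split /=.
      by apply: eq_bigr => e _; ring.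
    by rewrite -mulr_natr -[W *+ 2]mulr_natr; field; rewrite gt_eqF.
  rewrite ler_pM2r ?invr_gt0 ?pmulrn_rgt0 //; apply: ler_sum => e _.
  rewrite ler_wpM2l ?wt_ge0 //; apply: lerD; rewrite lerD2l.
    by apply: bigmin_le_cond; rewrite /btw !eqxx.
  by apply: bigmin_le_cond; rewrite /btw !eqxx orbT.
have [fi fre] := fr.
have rw : rows_ok s by move=> i iN; rewrite fi // rows0.
have Ks : int_mem s 42 0 = K by rewrite fi.
apply: (@V_weaken _ _ _ _ HV (j * 9 + 7).+4); last by lia.
apply: (V_loop HV); first by rewrite /= i34.
apply: (V_if HV); last by rewrite /= i33.
move=> _; apply: (V_if HV); last by rewrite beval_ilt /= i32 j2.
move=> _; apply: (V_seq HV).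
pose Y x := T9 + (\sum_(y < j) M x y *
  (kappa * (j * 14 + 31 + cN * nid.+1)%:R + Z x y)) / deg x.
apply: (reservoir_spec HV (j := j) (Z := deg) (F := Y)) => //.
- by move=> s' fr1; rewrite /= (proj1 fr1 32).
- move=> s' k kj fr1 x19; rewrite /= (proj1 fr1 25) // (proj1 fr1 9) // (proj1 fr1 32) //.
  by rewrite (proj2 fr1 5) // i32 x19 rw // -/(Act s j k) h4.
- by move=> k _; apply: vcut_ge0.
- by rewrite degW pmulrn_rgt0.
move=> P s1 Pj degP fr1 s1P; rewrite /Y.
apply: (@V_weaken _ _ _ _ HV (j * 9 + 7).+3); last by lia.
apply: (V_seq HV); apply: (V_iset HV); apply: (V_seq HV).
rewrite /= (proj1 fr1 25) // (proj1 fr1 9) // (proj1 fr1 32) // s1P i32 rw // -/(Act s j P).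
set s2 := set_int _ _ _ _.
have fr2 : frame [:: 15; 19; 32; 33; 35; 36; 37; 38] [:: 6; 9] s s2.
  by apply: frame_set_int => //; apply: frame_sub fr1 _ _.
pose Y' y := kappa * (j * 14 + 31 + cN * nid.+1)%:R + Z P y.
rewrite degE.
apply: (reservoir_spec HV (j := j) (Z := M P) (F := Y')) => //.
- by move=> s' fr3; rewrite /= (proj1 fr3 32) //= /upd /= (proj1 fr1 32).
- move=> s' k kj fr3 x19.
  rewrite /= !(proj1 fr3 25) // !(proj1 fr3 9) // !(proj1 fr3 32) // (proj2 fr3 4) //=.
  rewrite (proj1 fr3 37) //= /upd /= !(proj1 fr1 25) // !(proj1 fr1 9) // !(proj1 fr1 32) //.
  rewrite (proj2 fr1 4) // i32 x19 (rw j) // -/(Act s j k).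
  have := h2 P Pj; have := h2 k kj => ? ?.
  by rewrite rw; [rewrite -/(Mx _ _ _) h5|rewrite /N; lia].
- by rewrite -degE.
move=> Q s3 Qj MPQ fr3 s3Q.
have PQ : P != Q by apply: contraTneq MPQ => ->; rewrite /M eqxx ltxx.
have fr13 : frame [:: 15; 19; 32; 33; 35; 36; 37; 38] [:: 6; 9] s s3.
  by apply: frame_trans fr2 _; apply: frame_sub fr3 _ _.
have E a : a \notin [:: 15; 19; 35; 36; 37] -> int_mem s3 a = int_mem s a.
  move=> al; rewrite (proj1 fr3); last first.
    by apply: contra al; rewrite !inE => /or3P[] -> //; rewrite ?orbT.
  rewrite /= /upd; have /negbTE-> /= : a != 37.
    by apply: contra al; rewrite !inE => ->; rewrite !orbT.
  by rewrite (proj1 fr1) //; apply: contra al; rewrite !inE => /or3P[] -> //; rewrite ?orbT.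
have Er a : a \notin [:: 6] -> real_mem s3 a = real_mem s a.
  by move=> al; rewrite (proj2 fr3) //= (proj2 fr1).
have ActE i x : Act s3 i x = Act s i x by rewrite /Act E.
have MxE x y : Mx s3 x y = Mx s x y by rewrite /Mx Er.
have s3P : int_mem s3 35 0 = P by rewrite (proj1 fr3).
have s3A : int_mem s3 37 0 = Act s j P by rewrite (proj1 fr3) //= /upd /=.
have tm : tri merge_slots s3 (j * 14 + 30)
    (fun s' => merged_state s3 s' j P Q (Act s3 j P) (Act s3 j Q) (K + K - j) nid).
  apply: merge_slots_tri => //.
  - by move=> i iN; rewrite E // rw.
  - by rewrite j2 jE leq_subr.
  - by case/andP: K2.
  - by rewrite E.
  - by rewrite E.
  - by rewrite E.
  - by rewrite ActE.
  - by move=> x xj; rewrite ActE; apply: h2.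
rewrite /Y'; apply: (@V_weaken _ _ _ _ HV ((j * 14 + 30) + cN * nid.+1)); last by lia.
apply: (V_tri HV tm) => s4 ms.
have nid3 : int_mem s3 29 0 = nid by rewrite E.
have nid4 : int_mem s4 29 0 = nid.+1 by rewrite (ms_nid ms).
apply: inner_v_le nid4; rewrite /Z.
apply/bigmin_geP; split=> [|e be]; first exact: inner_vD.
have elive : e \in live G f.
  rewrite (live_numbering G h1) inE.
  by case/orP: be => /andP[/eqP -> /eqP ->] //; rewrite eq_sym.
apply: hX elive _.
have [g1 g2 g3 [_ g4] g5] := inner_inv_frame fr13 iva.
have h2' x : (x < j)%N -> (Act s3 j x < K + K - j)%N by rewrite ActE; apply: h2.
have h3' x : (x < j)%N -> (int_mem s3 26 (Act s3 j x) < int_mem s3 29 0)%N /\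
    S (int_mem s3 26 (Act s3 j x)) = block pos x.
  by rewrite ActE !E //; apply: h3.
have h4' x : (x < j)%N ->
    real_mem s3 5 (Act s3 j x) = vcut G (block pos x) (~: block pos x).
  by rewrite ActE Er //; apply: h4.
have h5' x y : (x < j)%N -> (y < j)%N -> Mx s3 (Act s3 j x) (Act s3 j y) =
    if x == y then 0 else vcut G (block pos x) (block pos y).
  by rewrite !ActE MxE; apply: h5.
have s333 : int_mem s3 33 0 = 1%N by rewrite E.
move: j2 Pj Qj ms h1 h2' h3' h4' h5'; rewrite jE -nid3 => j2 Pj Qj ms h1 h2' h3' h4' h5'.
apply: (merge_down j2 Pj Qj PQ ms g1 g2 s333 g3 g4 g5 h1 h2' h3' h4' h5').
by case/orP: be => /andP[/eqP -> /eqP ->]; [left|right].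
Qed.

Lemma inner_leaf_step f fs acc s X : level K (f :: fs) = 2 ->
  at_inner_down (f :: fs) acc s ->
  (forall C s', at_inner_up fs (acc_join G acc C) s' -> inner_v s' <= X C) ->
  inner_v s <= kappa * 20%:R + mean (dret R (live G f)) X.
Proof.
move=> j2 [[S iva] i33 i32] hX; have [fr i34 dg lv ac] := iva.
have j2' : (K - size fs = 2)%N by rewrite -(level_cons K f fs).
have [lvf lvs] : level_ok S s 2 f /\ levels_ok S s fs by case: lv; rewrite j2'.
have [pos [h1 h2 h3 h4 h5]] := lvf.
have [fi fre] := fr.
have rw : rows_ok s by move=> i iN; rewrite fi // rows0.
have N2 : (2 <= N)%N by rewrite /N; lia.
pose A := Act s 2 0; pose B := Act s 2 1.
have wl : weight G (live G f) = Mx s A B.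
  rewrite (live_crossing G h1) weight_crossing /A /B h5 //=; congr vcut.
  apply/setP => u; rewrite !inE; have [b _ _] := h1; have := b u.
  by case: (pos u) => [|[|]].
have [nA SA] := h3 0%N isT.
rewrite mean_dret /inner_v lerBlDr.
have tl : tri inner_leaf s 14 (fun s' =>
    at_inner_up fs (acc_join G acc (live G f)) s' /\ int_mem s' 29 0 = int_mem s 29 0).
  eapply tri_le.
  do 2!(apply: tri_seq; apply: tri_iset).
  rewrite /= /upd /= i32 j2 (rw 2%N) // -/(Act s 2 0) -/(Act s 2 1) -/A -/B.
  apply: tri_seq; apply: tri_rset; apply: tri_seq => /=; rewrite /upd /=.
  set s1 := set_real _ _ _ _.
  have fr1 : frame [:: 15; 19; 32; 33; 35; 36; 37; 38] [:: 6; 9] s s1 by framing.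
  have xE : real_mem s 4 (int_mem s 9 A + B) = weight G (live G f).
    rewrite wl rw //; have := h2 0%N isT; rewrite -/A /N; lia.
  (* A tie keeps the recorded cut, in agreement with [lighter]. *)
  apply: (@tri_if _ _ _ _ _ 5) => cnd.
    apply: (@tri_le _ _ _ 1) => //; apply: tri_skip; apply: tri_iset.
    set s2 := set_int s1 _ _ _.
    have fr2 : frame [:: 15; 19; 32; 33; 35; 36; 37; 38] [:: 6; 9] s s2 by framing.
    split; last by rewrite (proj1 fr2).
    split=> //.
    exists S; have [g1 g2 g3 [_ g4] g5] := inner_inv_frame fr2 iva; split=> //.
    move: cnd; rewrite /s1 /= /upd /= xE.
    case: acc ac {iva hX g5} => [C|/= -> //] /= [a1 a2 a3 a4].
    by rewrite a1 a3 /= /lighter => ->.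
  apply: (@tri_le _ _ _ (1 + (1 + 1).+1).+1) => //.
  apply: tri_seq; apply: tri_rset; apply: tri_seq; do 3!apply: tri_iset.
  rewrite /= /upd /=.
  set s2 := set_int _ 33 _ _.
  have fr2 : frame [:: 15; 19; 30; 31; 32; 33; 35; 36; 37; 38] [:: 6; 7; 9] s s2 by framing.
  have acE : acc_join G acc (live G f) = Some (live G f).
    move: cnd; rewrite /s1 /= /upd /= xE.
    case: acc ac {iva hX} => [C|//] /= [-> _ -> _] /= nle.
    by rewrite /acc_join /lighter (negbTE nle).
  split; last by [].
  split=> //.
  exists S; split=> //.
  + by apply: frame_trans fr _; apply: frame_sub fr2 _ _.
  + suff : forall gs, levels_ok S s gs -> levels_ok S s2 gs by apply.
    by elim=> //= g gs IH [[p [g1 g2 g3 g4 g5]] /IH ?]; split=> //; exists p; split.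
  + rewrite acE /=; split=> //.
    by rewrite SA (live_crossing G h1).
  by [].
apply: (@le_trans _ _ (kappa * 17%:R + (kappa * (cN * int_mem s 29 0)%:R + X (live G f)))); last first.
  rewrite -subr_ge0 (_ : _ - _ = kappa * 3%:R); first by rewrite mulr_ge0.
  by ring.
apply: (@V_weaken _ _ _ _ HV (14 + 0).+3); last by [].
apply: (V_loop HV); first by rewrite /= i34.
apply: (V_if HV); last by rewrite /= i33.
move=> _; apply: (V_if HV); first by rewrite beval_ilt /= i32 j2.
move=> _; apply: (V_tri HV tl) => s' [us' nid'].
by rewrite mulr0 add0r; apply: inner_v_le nid'; apply: hX us'.
Qed.

Lemma inner_up_step f fs acc s X Y : (2 < level K (f :: fs) <= K)%N ->
  at_inner_up (f :: fs) acc s ->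
  (forall s', at_inner_up fs acc s' -> inner_v s' <= X) ->
  (forall s', at_inner_down (f :: fs) acc s' -> inner_v s' <= Y) ->
  inner_v s <= kappa * 12%:R + ((1 - 2 / (level K (f :: fs))%:R) * X +
    (1 - (1 - 2 / (level K (f :: fs))%:R)) * (kappa * 0 + Y)).
Proof.
move=> lv [[S iva] i33 i32] hX hY; have [fr i34 dg [_ lvs] ac] := iva.
set j := level K _ in lv *; have [fi fre] := fr.
have jE : j = (K - size fs)%N by rewrite /j level_cons.
have jE' : (int_mem s 32 0).+1 = j by rewrite i32 jE /=; lia.
have Ks : int_mem s 42 0 = K by rewrite fi.
rewrite mulr0 add0r /inner_v lerBlDr.
set q := 1 - 2 / j%:R; set U := kappa * (cN * _)%:R.
have -> : kappa * 12%:R + (q * X + (1 - q) * Y) + U =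
    kappa * 12%:R + (q * (U + X) + (1 - q) * (U + Y)) by ring.
apply: (@V_weaken _ _ _ _ HV 9); last by [].
apply: (V_loop HV); first by rewrite /= i34.
apply: (V_if HV); first by rewrite /= i33.
move=> _; apply: (V_if HV); first by rewrite /= Ks; lia.
move=> _; apply: (V_seq HV); apply: (V_iset HV); apply: (V_seq HV).
rewrite /= addn1 jE'.
set s1 := set_int s 32 0 j.
apply: (V_flip HV); first by rewrite /= /upd /=.
- by apply: fpz_q01; lia.
- move=> _; apply: (V_if HV) => //= _; apply: (V_skip HV); apply: (V_done HV).
  apply: inner_v_le; last by rewrite /= /upd.
  apply: hX; split; rewrite ?i33 //=.
  set s2 := set_int s1 15 0 1.
  have fr2 : frame [:: 15; 19; 32; 33; 35; 36; 37; 38] [:: 6; 9] s s2 by framing.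
  by exists S; have [g1 g2 g3 [_ g4] g5] := inner_inv_frame fr2 iva.
- move=> _; apply: (V_if HV) => //= _; apply: (V_iset HV); apply: (V_done HV).
  apply: inner_v_le; last by rewrite /= /upd.
  apply: hY; split; rewrite ?i33 //=.
  set s2 := set_int _ 33 _ _.
  have fr2 : frame [:: 15; 19; 32; 33; 35; 36; 37; 38] [:: 6; 9] s s2 by framing.
  by exists S; exact: (inner_inv_frame fr2 iva).
Qed.

Definition inner_done acc s := exists S,
  [/\ frame [:: 15; 19; 25; 26; 27; 28; 29; 30; 31; 32; 33; 34; 35; 36; 37; 38; 39]
            [:: 4; 5; 6; 7; 9] s0 s, dag_ok S s & inner_acc S s acc].

Variable X : {set 'I_m} -> R.
Hypothesis doneX : forall C s', inner_done (Some C) s' ->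
  V rest s' <= kappa * (cN * int_mem s' 29 0)%:R + X C.

Lemma inner_exit_step acc s : at_inner_up [::] acc s ->
  inner_v s <= kappa * 6%:R + if acc is Some C then X C else D.
Proof.
move=> [[S iva] i33 i32]; have [fr i34 dg _ ac] := iva; have [fi fre] := fr.
have Ks : int_mem s 42 0 = K by rewrite fi.
rewrite /inner_v lerBlDr -addrA.
apply: (@V_weaken _ _ _ _ HV 5); last by [].
apply: (V_loop HV); first by rewrite /= i34.
apply: (V_if HV); first by rewrite /= i33.
move=> _; apply: (V_if HV); last by rewrite /= Ks i32 subn0 leqnn.
move=> _; apply: (V_iset HV); apply: (V_exit HV) => //=; apply: (V_done HV).
set s1 := set_int s 34 _ _.
have H : inner_done acc s1.
  by exists S; split=> //; framing.
rewrite addrC; case: acc H {ac iva} => [C|] H; first exact: (doneX H).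
by apply: le_trans (VD _ _) _; rewrite lerDr mulr_ge0.
Qed.

Variable tD : nat -> R.
Hypothesis tD_ge0 : forall k, 0 <= tD k.
Hypothesis tD_base : 20%:R <= tD 2.
Hypothesis tD_step : forall k, (2 < k <= K)%N ->
  (k * 32 + (70 + cN))%:R + tD k.-1 + 12%:R + (1 - (1 - 2 / k%:R)) * (0 + tD k) <= tD k.

Lemma inner_loop_spec f s : at_inner_down [:: f] None s ->
  V (inner_loop :: rest) s <= kappa * (cN * int_mem s 29 0)%:R +
    (kappa * (tD K + 6%:R) + mean (fpz_law G K f) X).
Proof.
move=> ds.
pose F acc : R := kappa * 6%:R + if acc is Some C then X C else D.
have K1 : (1 < K)%N by case/andP: K2.
have [mu1 _ _] := fpz_law_branching G K1.
have sp : subprob (fpz_law G K f) by apply: mu1; rewrite K1 leqnn.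
apply: inner_v_le => //.
(* The smallest stopping probability of this phase is the one at [k = 3]. *)
have q0 : 0 < (3^-1 : R) <= 1 by lra.
have qP k : (2 < k <= K)%N -> 3^-1 <= (1 - 2 / k%:R : R) <= 1.
  move=> /andP[k2 _]; have /andP[_ ->] := @fpz_q01 R k k2; rewrite andbT.
  have : 2 / k%:R <= (2 / 3 : R).
    by rewrite ler_pM2l // lef_pV2 ?posrE ?ltr0n ?ler_nat //; lia.
  lra.
have := @control_bound R n m G (wt G) (fun k => 1 - 2 / k%:R) 2 K
  (fun f => dret R (live G f)) (fpz_law G) (fpz_law_branching G K1) K1
  3^-1 q0 qP _ inner_v at_inner_down at_inner_up kappa (fun k => (k * 32 + (70 + cN))%:R)
  20%:R 12%:R 0 F k0 _ _ inner_contract_step inner_leaf_step inner_up_step inner_exit_step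
  D inner_vD tD tD_ge0 tD_base tD_step f None s
  (`|D| + \sum_C `|X C|) _ _ ds.
have aX C : `|X C| <= \sum_C `|X C| by rewrite (bigD1 C) //= lerDl sumr_ge0.
have aF acc : - (`|D| + \sum_C `|X C|) <= F acc.
  have k6 : 0 <= kappa * 6%:R by rewrite mulr_ge0.
  rewrite /F; case: acc => [C|].
    by have := aX C; have := lerNnormlW (lexx `|X C|); have := normr_ge0 D; lra.
  have := aX set0; have := normr_ge0 (X set0).
  by have := lerNnormlW (lexx `|D|); lra.
move=> /(_ (ler0n _ _) (lexx _) _ aF) H.
apply: le_trans (H _) _; first by rewrite addr_ge0 ?sumr_ge0.
rewrite mulrDr -addrA lerD2l.
rewrite /F /= (_ : mean _ (fun C => kappa * 6%:R + X C) =
  mean (fpz_law G K f) (fun C => X C + kappa * 6%:R)); last first.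
  by apply: eq_bigr => C _; rewrite addrC.
rewrite [leRHS]addrC; apply: mean_addr_le => //.
by rewrite mulr_ge0.
Qed.

End Inner.
(** * Union-find *)

Definition find_root (x : nat) (v : iexp) : cmd :=
  iset x v ;;;
  While (BNot (ieq (IGet 10 (IV x)) (IV x))) (iset x (IGet 10 (IV x))).

Definition link : cmd :=
  If (ilt (IGet 11 (IV 16)) (IGet 11 (IV 17))) (ISet 10 (IV 16) (IV 17))
    (ISet 10 (IV 17) (IV 16) ;;;
     If (ieq (IGet 11 (IV 16)) (IGet 11 (IV 17)))
       (ISet 11 (IV 16) (IAdd (IGet 11 (IV 16)) (INum 1))) Skip).

Definition reset_sets : cmd :=
  For 19 (IGet 0 (INum 0))
    (ISet 10 (IV 19) (IV 19) ;;; ISet 11 (IV 19) (INum 0)).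

Section UnionFind.
Variables (R : realType) (n m : nat) (G : wgraph R n m).
Implicit Types (s : state R) (f : labelling n) (u v : 'I_n).

Definition is_root s u := int_mem s 10 u == u.

(* Array 10 holds parents and array 11 ranks of a forest whose trees are the
   classes of f. *)
Record sets_ok f s : Prop := SetsOk {
  so_parent : forall u, exists u',
    [/\ int_mem s 10 u = u' :> nat, f u' = f u
      & u' != u -> (int_mem s 11 u < int_mem s 11 u')%N];
  so_root : forall u v, is_root s u -> is_root s v -> f u = f v -> u = v;
  so_rank : forall u, (2 ^ int_mem s 11 u <= n)%N;
  so_size : forall u, is_root s u -> (2 ^ int_mem s 11 u <= #|[set v | f v == f u]|)%N }.

Lemma sets_ok_frame f s s' : int_mem s' 10 = int_mem s 10 ->
  int_mem s' 11 = int_mem s 11 -> sets_ok f s -> sets_ok f s'.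
Proof. by move=> e1 e2 []; rewrite /is_root => *; split; rewrite /is_root ?e1 ?e2. Qed.

Definition depth := trunc_log 2 n.

Lemma rank_le f s u : sets_ok f s -> (int_mem s 11 u <= depth)%N.
Proof. by move=> so; apply: trunc_log_max => //; apply: so_rank so u. Qed.

(** Ranks grow strictly towards the root and are at most [depth n], so no path is longer than that.
    Paths are not compressed, so the structure stays as it was. *)
Lemma find_root_tri f s x (e : iexp) v : sets_ok f s -> x \notin [:: 10; 11] ->
  ieval s e = v ->
  tri (find_root x e) s (depth * 3 + 3) (fun s' => frame [:: x] [::] s s' /\
    exists r : 'I_n, [/\ int_mem s' x 0 = r, is_root s r & f r = f v]).
Proof.
rewrite !inE negb_or => so /andP[x10 x11] ev.
have x10' : 10 != x by rewrite eq_sym.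
apply: (@tri_le _ _ _ (1 + (depth * 1.+2).+1).+1); last by lia.
apply: tri_seq; apply: tri_iset.
pose I i s' := frame [:: x] [::] s s' /\
  exists u : 'I_n, [/\ int_mem s' x 0 = u, f u = f v & (depth <= int_mem s 11 u + i)%N].
apply: (@tri_while _ _ _ I) => [i s' [fr [u [xu fu du]]]|]; last first.
  split; first by apply: frame_set_int; rewrite ?inE //; exact: frame_refl.
  by exists v; rewrite /= /upd !eqxx ev leq_addl.
have p10 : int_mem s' 10 = int_mem s 10 by rewrite (proj1 fr) ?inE.
rewrite /= -eqn_leq p10 xu; case: ifPn => h; last first.
  by split=> //; exists u; split=> //; rewrite negbK in h.
have [u' [pu fu' ru]] := so_parent so u.
have uu : u' != u by apply: contraNneq h => e'; rewrite pu e'.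
have {ru}ru := ru uu; have r' := rank_le u' so.
exists i.-1; first by lia.
apply: tri_iset; rewrite /= p10 xu pu; split.
  by apply: frame_set_int; rewrite ?inE.
by exists u'; rewrite /= /upd !eqxx fu' /=; split=> //; lia.
Qed.

(** Union by rank: a rank increases only for the winner of a tie, whose class has then doubled its
    guaranteed size. A vertex that stops being a root keeps its rank, so the bound by [n] persists
    for all vertices. *)
Lemma link_tri f s e (a b : 'I_n) : sets_ok f s -> e \in live G f ->
  int_mem s 16 0 = a -> int_mem s 17 0 = b -> is_root s a -> is_root s b ->
  f a = f (src G e) -> f b = f (dst G e) ->
  tri link s 6 (fun s' => frame [:: 10; 11] [::] s s' /\ sets_ok (contract G f e) s').
Proof.
move=> so el As Bs ra rb fa fb; set f' := contract G f e.
have ab : f a != f b by move: el; rewrite inE fa fb.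
have nab : a != b by apply: contraNneq ab => ->.
have f'E u v : (f' u == f' v) = (f u == f v) ||
    ((f u \in [:: f a; f b]) && (f v \in [:: f a; f b])).
  by rewrite contractE fa fb.
have ff u v : f u = f v -> f' u = f' v by move=> h; apply/eqP; rewrite f'E h eqxx.
have fab : f' a = f' b by apply/eqP; rewrite f'E !inE !eqxx !orbT.
have clsS u : [set v | f v == f u] \subset [set v | f' v == f' u].
  by apply/subsetP => v; rewrite !inE => /eqP /ff ->.
(* c is the root that is linked below d. *)
have main (c d : 'I_n) s' : is_root s c -> is_root s d -> c != d -> f' c = f' d ->
    (forall u, is_root s u -> f u \in [:: f a; f b] -> u = c \/ u = d) ->
    (int_mem s 11 c < int_mem s' 11 d)%N ->
    int_mem s' 10 =1 (fun x => if x == c :> nat then d : nat else int_mem s 10 x) ->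
    int_mem s' 11 =1 (fun x => if x == d :> nat then int_mem s' 11 d else int_mem s 11 x) ->
    (int_mem s 11 d <= int_mem s' 11 d)%N ->
    (2 ^ int_mem s' 11 d <= #|[set v | f' v == f' d]|)%N -> sets_ok f' s'.
  move=> rc rd cd fcd cls lt p10 p11 le sz.
  have rs u : is_root s' u -> is_root s u /\ u != c.
    rewrite /is_root p10; case: (eqVneq (u : nat) c) => [/val_inj ->|uc] ru.
      by rewrite eq_sym (inj_eq val_inj) (negbTE cd) in ru.
    by split=> //; apply: contra_neq uc => ->.
  have ge u : (int_mem s 11 u <= int_mem s' 11 u)%N.
    by rewrite p11; case: eqP => // ->.
  split=> [u|u v|u|u].
  - rewrite p10; case: (eqVneq (u : nat) c) => [/val_inj ->|uc].
      exists d; split=> // _; rewrite [X in (X < _)%N]p11.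
      by rewrite (inj_eq val_inj) (negbTE cd).
    have [u' [h1 h2 h3]] := so_parent so u; exists u'; split=> //; first exact: ff.
    move=> uu; have := h3 uu; have := ge u'; rewrite [int_mem s' 11 u]p11.
    case: (eqVneq (u : nat) d) => [/val_inj ud|_ g1 g2]; last exact: leq_trans g2 g1.
    by move: uu h1; rewrite ud (eqP rd) => /negP h /val_inj /eqP; rewrite eq_sym => /h.
  - move=> /rs[ru uc] /rs[rv vc] /eqP; rewrite f'E => /orP[/eqP|/andP[fu fv]].
      exact: so_root so _ _ ru rv.
    have [|->] := cls u ru fu; first by move/eqP: uc.
    by have [|->] := cls v rv fv; first by move/eqP: vc.
  - rewrite p11; case: eqP => // _; last exact: so_rank so u.
    by apply: leq_trans sz _; apply: leq_trans (max_card _) _; rewrite card_ord.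
  - move=> /rs[ru uc]; rewrite p11; case: (eqVneq (u : nat) d) => [/val_inj ->//|_].
    by apply: leq_trans (so_size so ru) _; apply: subset_leq_card.
have cls u : is_root s u -> f u \in [:: f a; f b] -> u = a \/ u = b.
  by move=> ru; rewrite !inE => /orP[] /eqP h; [left|right]; apply: so_root so _ _ ru _ h.
(* The two classes are disjoint, so their guaranteed sizes add up; for equal ranks [r] the sum is
   [2 ^ r.+1], as the incremented rank requires. *)
have szab c : f' c = f' a -> (2 ^ int_mem s 11 a + 2 ^ int_mem s 11 b <=
    #|[set v | f' v == f' c]|)%N.
  move=> ->; apply: leq_trans (leq_add (so_size so ra) (so_size so rb)) _.
  rewrite -cardsUI [X in (_ + X)%N]eq_card0 ?addn0; last first.
    by move=> v; rewrite !inE; apply: contraNF ab => /andP[/eqP<- /eqP<-].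
  apply: subset_leq_card; apply/subsetP => v; rewrite !inE f'E !inE eqxx /=.
  by case/orP=> ->; rewrite ?orbT.
apply: (@tri_if _ _ _ _ _ 5) => /=; rewrite As Bs ?addn1 => lt.
  apply: (@tri_le _ _ _ 1) => //; apply: tri_iset => /=; rewrite As Bs; split.
    by apply: frame_set_int => //; exact: frame_refl.
  apply: (main a b) => //=; rewrite /upd /=.
  - by move=> u; case: eqP => // ->.
  - by apply: leq_trans (szab b (esym fab)); rewrite leq_addl.
apply: (@tri_le _ _ _ (1 + 2).+1) => //; apply: tri_seq; apply: tri_iset.
rewrite /= As Bs.
set s1 := set_int _ _ _ _.
have fr1 : frame [:: 10; 11] [::] s s1 by apply: frame_set_int => //; exact: frame_refl.
have cls' u : is_root s u -> f u \in [:: f a; f b] -> u = b \/ u = a.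
  by move=> ru fu; case: (cls u ru fu); [right|left].
have ba : b != a by rewrite eq_sym.
apply: (@tri_if _ _ _ _ _ 1) => /=; rewrite /upd /= As Bs ?addn1 -?eqn_leq => eqr.
  apply: tri_iset => /=; rewrite /upd /= As addn1; split.
    by apply: frame_set_int.
  apply: (main b a) => //=; rewrite /upd /= ?eqxx //=.
  - by rewrite (eqP eqr).
  - by rewrite expnS mul2n -addnn; have := szab a erefl; rewrite -(eqP eqr).
apply: tri_skip; split=> //.
apply: (main b a) => //=; rewrite /upd /=.
- by move: lt eqr; lia.
- by move=> u; case: eqP => // ->.
- by apply: leq_trans (szab a erefl); rewrite leq_addr.
Qed.

Lemma reset_sets_tri s : int_mem s 0 0 = n ->
  tri reset_sets s (n * 7 + 3) (fun s' => frame [:: 10; 11; 19] [::] s s' /\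
    sets_ok [ffun v => v] s').
Proof.
move=> ns.
pose I k s' := [/\ int_mem s' 19 0 = k, frame [:: 10; 11; 19] [::] s s' &
  forall x, (x < k)%N -> int_mem s' 10 x = x /\ int_mem s' 11 x = 0%N].
apply: (@tri_weaken _ _ _ (n * (3 + 4) + 3) _ (I n)) => //; last first.
  move=> s' [_ fr H]; split=> //.
  have p u : int_mem s' 10 (u : 'I_n) = u by case: (H u (ltn_ord u)).
  have r u : int_mem s' 11 (u : 'I_n) = 0%N by case: (H u (ltn_ord u)).
  split=> [u|u v|u|u] //.
  - by exists u; rewrite p eqxx.
  - by rewrite !ffunE.
  - by rewrite r expn0; apply: leq_ltn_trans (ltn_ord u).
  - by move=> _; rewrite r expn0 card_gt0; apply/set0Pn; exists u; rewrite inE.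
apply: tri_for => [|k s' _ [xk fr _]|k s' kn [xk fr H]].
- by split=> //; framing.
- by rewrite /= (proj1 fr 0) // ns.
apply: (@tri_le _ _ _ (1 + 1).+1) => //; apply: tri_seq; apply: tri_iset; apply: tri_iset.
rewrite /= /upd /= xk; split=> //=; first by framing.
move=> x; rewrite ltnS leq_eqVlt /upd /=; case: eqP => //= _ xk'.
by have [-> ->] := H x xk'.
Qed.

End UnionFind.
(** * Sampling from a segment tree *)

(* Node i of the tree has children 2 i and 2 i + 1; real array 3 holds the
   weights, cell 7 the number 2 ^ h of leaves, array 8 the parents, and cell 14
   the current node. *)
Definition kids (i : iexp) : rexp :=
  RAdd (RGet 3 (IAdd i i)) (RGet 3 (IAdd (IAdd i i) (INum 1))).

Definition descend : cmd :=
  iset 14 (INum 1) ;;;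
  While (ilt (IV 14) (IV 7))
    (Flip 15 (INum 0) (RDiv (RGet 3 (IAdd (IV 14) (IV 14))) (RGet 3 (IV 14))) ;;;
     iset 14 (ISub (IAdd (IAdd (IV 14) (IV 14)) (INum 1)) (IV 15))).

Definition clear_leaf : cmd :=
  RSet 3 (IV 14) (RNat (INum 0)) ;;;
  While (ilt (INum 1) (IV 14))
    (iset 14 (IGet 8 (IV 14)) ;;; RSet 3 (IV 14) (kids (IV 14))).

Definition build_tree (w : rexp) : cmd :=
  For 19 (IGet 0 (INum 1)) (RSet 3 (IAdd (IV 7) (IV 19)) w) ;;;
  iset 14 (IV 7) ;;;
  While (ilt (INum 1) (IV 14))
    (iset 14 (ISub (IV 14) (INum 1)) ;;; RSet 3 (IV 14) (kids (IV 14))).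

Definition size_tree : cmd :=
  iset 7 (INum 1) ;;;
  While (ilt (IV 7) (IGet 0 (INum 1))) (iset 7 (IAdd (IV 7) (IV 7))) ;;;
  For 19 (IV 7)
    (ISet 8 (IAdd (IV 19) (IV 19)) (IV 19) ;;;
     ISet 8 (IAdd (IAdd (IV 19) (IV 19)) (INum 1)) (IV 19)).

Section SegmentTree.
Variable R : realType.
Implicit Types (s : state R).
Variable h : nat.
Local Notation M := (2 ^ h)%N.

Definition sums s := forall i, (0 < i < M)%N ->
  real_mem s 3 i = real_mem s 3 (i + i)%N + real_mem s 3 (i + i).+1.

Definition tree_ok s := [/\ int_mem s 7 0 = M, sums s
  & forall l, (l < M)%N -> 0 <= real_mem s 3 (M + l)%N].

(** Says that node [i] is exactly [d] levels above the leaves, which are numbered from [M] to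
    [M + M - 1]; the leaves below it are the [2 ^ d] numbers starting at [i * 2 ^ d]. *)
Definition above d i := ((M <= i * 2 ^ d) && (i.+1 * 2 ^ d <= 2 ^ h.+1))%N.

Lemma aboveS d i : above d.+1 i ->
  [/\ (0 < i < M)%N, above d (i + i) & above d (i + i).+1].
Proof.
rewrite /above !expnS => /andP[h1 h2].
have M0 : (0 < M)%N by rewrite expn_gt0.
have d0 : (0 < 2 ^ d)%N by rewrite expn_gt0.
split; last 2 first.
- by apply/andP; split; nia.
- by apply/andP; split; nia.
apply/andP; split; first by case: (i) h1 => //; lia.
have : (i.+1 * 2 <= i.+1 * (2 * 2 ^ d))%N by rewrite leq_mul2l /=; lia.
lia.
Qed.

Lemma node_left d i : ((i + i) * 2 ^ d = i * (2 ^ d + 2 ^ d))%N.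
Proof. by lia. Qed.

Lemma node_right d i : ((i + i).+1 * 2 ^ d = i * (2 ^ d + 2 ^ d) + 2 ^ d)%N.
Proof. by lia. Qed.

Lemma leaf_sum s d i : sums s -> above d i ->
  real_mem s 3 i = \sum_(l < 2 ^ d) real_mem s 3 (i * 2 ^ d + l)%N.
Proof.
move=> hs; elim: d i => [|d IH] i ai.
  by rewrite expn0 big_ord1 muln1 addn0.
have [i0 a1 a2] := aboveS ai; rewrite hs // (IH _ a1) (IH _ a2).
rewrite (_ : 2 ^ d.+1 = 2 ^ d + 2 ^ d)%N; last by rewrite expnS mul2n addnn.
rewrite big_split_ord /=; congr (_ + _); apply: eq_bigr => l _.
  by rewrite node_left.
by rewrite node_right addnA.
Qed.

Lemma above_leaf i : above 0 i -> (M <= i < M + M)%N.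
Proof. by rewrite /above expnS expn0 !muln1 mul2n -addnn => /andP[-> ?]; lia. Qed.

Lemma above_leaves d i l : above d i -> (l < 2 ^ d)%N ->
  (M <= i * 2 ^ d + l < M + M)%N.
Proof. by rewrite /above expnS mulSn => /andP[h1 h2] ld; lia. Qed.

Lemma above_root : above h 1.
Proof. by rewrite /above mul1n leqnn expnS leqnn. Qed.

Lemma node_ge0 s d i : tree_ok s -> above d i -> 0 <= real_mem s 3 i.
Proof.
move=> [_ hs h0] ai; rewrite (leaf_sum hs ai); apply: sumr_ge0 => l _.
have /andP[l1 l2] := above_leaves ai (ltn_ord l).
by rewrite -(subnKC l1) h0 //; lia.
Qed.

Lemma tree_total s : tree_ok s -> real_mem s 3 1 = \sum_(l < M) real_mem s 3 (M + l)%N.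
Proof. by case=> _ hs _; rewrite (leaf_sum hs above_root) mul1n. Qed.

Section Descent.
Variables (kappa D : R) (V : seq cmd -> state R -> R) (rest : seq cmd).
Hypothesis HV : supersolution kappa D V.

(** The coin at a node has the bias left child over node, so the probabilities along a path
    telescope to leaf over root. *)
Lemma descend_spec s (F : nat -> R) : tree_ok s -> 0 < real_mem s 3 1 ->
  (forall l s', (l < M)%N -> 0 < real_mem s 3 (M + l)%N ->
     frame [:: 14; 15] [::] s s' -> int_mem s' 14 0 = (M + l)%N -> V rest s' <= F l) ->
  V (descend :: rest) s <= kappa * (h * 4 + 3)%:R +
    (\sum_(l < M) real_mem s 3 (M + l)%N * F l) / \sum_(l < M) real_mem s 3 (M + l)%N.
Proof.
move=> tok t1 hF; have [Ms hs hl] := tok.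
pose T i := real_mem s 3 i.
have main d : forall i s', above d i -> frame [:: 14; 15] [::] s s' ->
    int_mem s' 14 0 = i -> 0 < T i ->
    forall Wh, Wh = (While (ilt (IV 14) (IV 7))
    (Flip 15 (INum 0) (RDiv (RGet 3 (IAdd (IV 14) (IV 14))) (RGet 3 (IV 14))) ;;;
     iset 14 (ISub (IAdd (IAdd (IV 14) (IV 14)) (INum 1)) (IV 15)))) ->
    V (Wh :: rest) s' <= kappa * (d * 4 + 1)%:R +
      (\sum_(l < 2 ^ d) T (i * 2 ^ d + l)%N * F (i * 2 ^ d + l - M)%N) / T i.
  elim: d => [|d IH] i s' ai fr si ti Wh WhE; rewrite WhE.
    have /andP[i1 i2] := above_leaf ai.
    apply: (V_exit HV); first by rewrite beval_ilt /= (proj1 fr 7) // Ms si -leqNgt.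
    rewrite expn0 muln1 big_ord1 addn0 mulrAC divff ?gt_eqF // mul1r.
    apply: (V_done HV); apply: hF fr _; rewrite ?subnKC //; lia.
  have [/andP[i0 iM] a1 a2] := aboveS ai.
  have Ti : T i = T (i + i)%N + T (i + i).+1 by rewrite /T hs // i0.
  have T1 : 0 <= T (i + i)%N := node_ge0 tok a1.
  have T2 : 0 <= T (i + i).+1 := node_ge0 tok a2.
  rewrite (_ : d.+1 * 4 + 1 = (d * 4 + 1).+4)%N; last by lia.
  apply: (V_loop HV); first by rewrite beval_ilt /= (proj1 fr 7) // Ms si.
  apply: (V_seq HV).
  set p := T (i + i)%N / T i.
  have p01 : 0 <= p <= 1.
    rewrite /p divr_ge0 //=; last exact: ltW.
    by rewrite ler_pdivrMr // mul1r Ti lerDl.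
  have -> : (\sum_(l < 2 ^ d.+1) T (i * 2 ^ d.+1 + l)%N * F (i * 2 ^ d.+1 + l - M)%N) / T i =
    p * ((\sum_(l < 2 ^ d) T ((i + i) * 2 ^ d + l)%N * F ((i + i) * 2 ^ d + l - M)%N) / T (i + i)%N) +
    (1 - p) * ((\sum_(l < 2 ^ d) T ((i + i).+1 * 2 ^ d + l)%N * F ((i + i).+1 * 2 ^ d + l - M)%N) / T (i + i).+1).
    (* A child of weight zero is entered with probability zero, and its sum vanishes since its
       nonnegative leaves are all zero. This settles the quotients with denominator zero. *)
    have zero (j : nat) : above d j -> T j = 0 ->
        \sum_(l < 2 ^ d) T (j * 2 ^ d + l)%N * F (j * 2 ^ d + l - M)%N = 0.
      move=> aj; rewrite /T (leaf_sum hs aj) => /eqP; rewrite psumr_eq0; last first.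
        move=> l _; have /andP[l1 l2] := above_leaves aj (ltn_ord l).
        by rewrite -(subnKC l1) hl // ltn_subLR.
      move=> /allP H; rewrite big1 // => l _.
      by have /eqP -> := H l (mem_index_enum l); rewrite mul0r.
    have half (j : nat) (r : R) : above d j ->
        T j * ((\sum_(l < 2 ^ d) T (j * 2 ^ d + l)%N * F (j * 2 ^ d + l - M)%N) / T j) =
        \sum_(l < 2 ^ d) T (j * 2 ^ d + l)%N * F (j * 2 ^ d + l - M)%N.
      move=> aj; have [tj|tj] := eqVneq (T j) 0; last by rewrite mulrC divfK.
      by rewrite tj mul0r zero.
    have -> : 1 - p = T (i + i).+1 / T i by rewrite /p Ti; field; rewrite -Ti gt_eqF.
    rewrite /p ![_ / T i * _]mulrAC -mulrDl !half //; congr (_ / _).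
    rewrite (_ : 2 ^ d.+1 = 2 ^ d + 2 ^ d)%N; last by rewrite expnS mul2n addnn.
    rewrite big_split_ord /=; congr (_ + _); apply: eq_bigr => l _.
      by rewrite node_left.
    by rewrite node_right addnA.
  apply: (V_flip HV) p01 _ _.
  - by rewrite /= (proj2 fr) // si.
  - move=> pn0; apply: (V_iset HV); rewrite /= /upd /= si.
    apply: (IH (i + i)%N _ a1 _ _ _ _ erefl).
    + by framing.
    + by rewrite /= /upd /= addn1 subn1.
    + by rewrite lt_neqAle T1 andbT; apply: contra pn0 => /eqP e; rewrite /p -e mul0r.
  - move=> pn1; apply: (V_iset HV); rewrite /= /upd /= si.
    apply: (IH (i + i).+1 _ a2 _ _ _ _ erefl).
    + by framing.
    + by rewrite /= /upd /= addn1 subn0.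
    + rewrite lt_neqAle T2 andbT; apply: contra pn1 => /eqP e.
      by rewrite /p Ti -e addr0 divff //; move: ti; rewrite Ti -e addr0 => /gt_eqF ->.
apply: (@V_weaken _ _ _ _ HV (h * 4 + 1).+2); last by lia.
apply: (V_seq HV); apply: (V_iset HV).
have frs : frame [:: 14; 15] [::] s (set_int s 14 (ieval s (INum 0)) (ieval s (INum 1))) by framing.
apply: le_trans (main h 1%N _ above_root frs _ t1 _ erefl) _ => //.
rewrite lerD2l /T tree_total // mul1n le_eqVlt; apply/orP; left; apply/eqP.
by congr (_ / _); apply: eq_bigr => l _; congr (_ * F _); lia.
Qed.

End Descent.

Lemma clear_leaf_tri s l : tree_ok s -> (l < M)%N -> int_mem s 14 0 = (M + l)%N ->
  (forall k, (k < M + M)%N -> int_mem s 8 k = k./2) ->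
  tri clear_leaf s (h * 5 + 3) (fun s' => [/\ frame [:: 14] [:: 3] s s', tree_ok s'
    & forall l', (l' < M)%N ->
        real_mem s' 3 (M + l')%N = if l' == l then 0 else real_mem s 3 (M + l')%N]).
Proof.
move=> [Ms hs hl] lM si par.
have M0 : (0 < M)%N by rewrite expn_gt0.
apply: (@tri_le _ _ _ (1 + (h * 3.+2).+1).+1); last by lia.
apply: tri_seq; apply: tri_rset; rewrite /= si.
(* On the way up, the sum rule can fail only at the parent of the current node, and the next
   assignment repairs it. *)
pose I d s' := exists i, [/\ int_mem s' 14 0 = i, (0 < i < 2 ^ d.+1)%N,
  frame [:: 14] [:: 3] s s' /\ (i < M + M)%N,
  forall k, (0 < k < M)%N -> k != i./2 ->
    real_mem s' 3 k = real_mem s' 3 (k + k)%N + real_mem s' 3 (k + k).+1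
  & forall l', (l' < M)%N ->
        real_mem s' 3 (M + l')%N = if l' == l then 0 else real_mem s 3 (M + l')%N].
apply: (@tri_while _ _ _ I) => [d s' [i [s'i id [fr iM] sm lv]]|]; last first.
  exists (M + l)%N; split=> //=.
  - by rewrite expnS; lia.
  - by split; [framing|lia].
  - move=> k kM kl; rewrite /upd /= !ifF; [exact: hs| | |]; move: kl; lia.
  - by move=> l' l'M; rewrite /upd /= eqn_add2l.
rewrite beval_ilt /= s'i; case: ifPn => i1; last first.
  have i1' : i = 1%N by lia.
  split=> //; split.
  - by rewrite (proj1 fr).
  - by move=> k kM; apply: sm => //; rewrite i1'; lia.
  - by move=> l' l'M; rewrite lv //; case: ifP => // _; apply: hl.
exists d.-1; first by case: d id {s'i} => // /andP[_]; lia.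
apply: (@tri_le _ _ _ (1 + 1).+1) => //; apply: tri_seq; apply: tri_iset; apply: tri_rset.
rewrite /= /upd /= s'i !addn1 (proj1 fr 8) // par //.
have i2 : (0 < i./2 < M)%N by lia.
exists i./2; split=> //.
- case: d id {s'i} => [|d]; first by lia.
  by rewrite [(2 ^ d.+2)%N]expnS /=; lia.
- by split; [framing|lia].
- move=> k kM ki; rewrite /= /upd /=.
  have [ki2|ki2] := eqVneq k i./2.
    by rewrite -ki2 !ifF //; lia.
  have [kk|kk] := eqVneq (k + k)%N i./2; first by rewrite -kk in ki; lia.
  have [kk'|kk'] := eqVneq (k + k).+1 i./2; first by rewrite -kk' in ki; lia.
  exact: sm.
- move=> l' l'M; rewrite /= /upd /= ifF ?lv //; lia.
Qed.

Lemma build_tree_tri s m w (Z : nat -> R) : (m <= M)%N -> int_mem s 0 1 = m ->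
  int_mem s 7 0 = M ->
  (forall l, (m <= l < M)%N -> real_mem s 3 (M + l)%N = 0) ->
  (forall s' k, (k < m)%N -> frame [:: 19] [:: 3] s s' -> int_mem s' 19 0 = k ->
     reval s' w = Z k) ->
  (forall k, (k < m)%N -> 0 <= Z k) ->
  tri (build_tree w) s (m * 6 + M * 5 + 9) (fun s' =>
    [/\ frame [:: 14; 19] [:: 3] s s', tree_ok s'
      & forall l, (l < M)%N -> real_mem s' 3 (M + l)%N = if (l < m)%N then Z l else 0]).
Proof.
move=> mM ms Ms s0 hw Z0.
have M0 : (0 < M)%N by rewrite expn_gt0.
apply: (@tri_le _ _ _ (m * (1 + 4) + 3 + (1 + (M * 3.+2).+1).+1).+1); last by lia.
apply: tri_seq.
pose I k s' := [/\ int_mem s' 19 0 = k, frame [:: 19] [:: 3] s s' &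
  forall l, (l < M)%N -> real_mem s' 3 (M + l)%N = if (l < k)%N then Z l else real_mem s 3 (M + l)%N].
apply: (@tri_weaken _ _ _ (m * (1 + 4) + 3) _ (I m)) => //.
  apply: tri_for => [|k s' _ [xk fr _]|k s' km [xk fr H]].
  - by split=> //; framing.
  - by rewrite /= (proj1 fr 0).
  apply: tri_rset; rewrite /= (hw _ k) // xk (proj1 fr 7) // Ms.
  split=> //=; first by framing.
  move=> l lM; rewrite /upd /= eqn_add2l ltnS leq_eqVlt; case: eqP => [->|_] //=.
  exact: H.
move=> s1 [_ fr1 H1]; apply: tri_seq; apply: tri_iset; rewrite /= (proj1 fr1 7) // Ms.
pose J d s' := exists i, [/\ int_mem s' 14 0 = i, (0 < i <= d)%N,
  frame [:: 14; 19] [:: 3] s s' /\ (i <= M)%N,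
  forall k, (i <= k < M)%N ->
    real_mem s' 3 k = real_mem s' 3 (k + k)%N + real_mem s' 3 (k + k).+1
  & forall l, (l < M)%N -> real_mem s' 3 (M + l)%N = if (l < m)%N then Z l else 0].
apply: (@tri_while _ _ _ J) => [d s' [i [s'i id [fr iM] sm lv]]|]; last first.
  exists M; split=> //=; last first.
  - move=> l lM; rewrite H1 //; case: ltnP => // ml; rewrite s0 // ml //.
  - by move=> k; lia.
  - split; last by [].
    apply: frame_set_int => //; exact: frame_sub fr1 _ _.
  - by rewrite M0 leqnn.
rewrite beval_ilt /= s'i; case: ifPn => i1; last first.
  have i1' : i = 1%N by lia.
  split=> //; split.
  - by rewrite (proj1 fr).
  - by move=> k kM; apply: sm => //; rewrite i1'.
  - by move=> l lM; rewrite lv //; case: ifP => // lm; apply: Z0.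
exists d.-1; first by lia.
apply: (@tri_le _ _ _ (1 + 1).+1) => //; apply: tri_seq; apply: tri_iset; apply: tri_rset.
rewrite /= /upd /= s'i addn1 subn1; exists i.-1; split=> //.
- by lia.
- by split; [framing|lia].
- move=> k kM; rewrite /= /upd /=.
  have [ki|ki] := eqVneq k i.-1; first by rewrite ki !ifF //; lia.
  rewrite !ifF; [apply: sm| |]; lia.
- by move=> l lM; rewrite /= /upd /= ifF ?lv //; lia.
Qed.

End SegmentTree.

(** Doubling stops below [m + m], so sweeps over the tree are linear in [m]. The machine cannot
    halve integers, hence a table of parents. *)
Lemma size_tree_tri (R : realType) (s : state R) m : (0 < m)%N -> int_mem s 0 1 = m ->
  tri size_tree s (m * 20 + 20) (fun s' => exists h,
    [/\ frame [:: 7; 8; 19] [::] s s', int_mem s' 7 0 = (2 ^ h)%N,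
        (m <= 2 ^ h < m + m)%N
      & forall k, (k < 2 ^ h + 2 ^ h)%N -> int_mem s' 8 k = k./2]).
Proof.
move=> m0 ms.
apply: (@tri_le _ _ _ (1 + ((m * 3).+1 + ((m + m) * (3 + 4) + 3)).+1).+1); last by lia.
apply: tri_seq; apply: tri_iset; apply: tri_seq.
pose I d s' := exists h, [/\ frame [:: 7] [::] s s', int_mem s' 7 0 = (2 ^ h)%N,
   (2 ^ h < m + m)%N & (m <= 2 ^ h + d)%N].
apply: (@tri_while _ _ _ I) => [d s' [h [fr hs hm md]]|]; last first.
  by exists 0%N; split; [framing|by []|rewrite expn0; lia|exact: leq_addl].
rewrite beval_ilt /= hs (proj1 fr 0) // ms; case: ifPn => [lt|ge].
  exists d.-1; first by lia.
  apply: tri_iset; exists h.+1; rewrite /= hs; split=> //; first by framing.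
  - by rewrite /upd /= expnS mul2n addnn.
  - by rewrite expnS; lia.
  - by have : (0 < 2 ^ h)%N; [rewrite expn_gt0|rewrite expnS; lia].
apply: (@tri_weaken _ _ _ (2 ^ h * (3 + 4) + 3) _ (fun s' =>
  [/\ int_mem s' 19 0 = (2 ^ h)%N, frame [:: 7; 8; 19] [::] s s', int_mem s' 7 0 = (2 ^ h)%N &
    forall k, (k < 2 ^ h + 2 ^ h)%N -> int_mem s' 8 k = k./2])); last first.
- by move=> s2 [h1 h2 h3 h4]; exists h; split=> //; rewrite hm andbT; lia.
- by lia.
pose J k s2 := [/\ int_mem s2 19 0 = k, frame [:: 7; 8; 19] [::] s s2, int_mem s2 7 0 = (2 ^ h)%N &
    forall i, (i < k + k)%N -> int_mem s2 8 i = i./2].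
apply: (@tri_for _ _ _ _ _ _ J) => [|k s2 _ [h1 h2 h3 h4]|k s2 kM [h1 h2 h3 h4]].
- by split=> //; apply: frame_set_int => //; apply: frame_sub fr _ _.
- by rewrite /= h3.
apply: (@tri_le _ _ _ (1 + 1).+1) => //; apply: tri_seq; apply: tri_iset; apply: tri_iset.
rewrite /= /upd /= h1 addn1; split=> //=; first by framing.
move=> i ik; rewrite /upd /=; case: eqP => [->|i1]; first by lia.
case: eqP => [->|i2]; first by lia.
by rewrite /= h4 //; lia.
Qed.
(** * The unboosted phase from a union-find structure *)

(** Array 22 numbers the roots consecutively and array 23 will give each vertex the number of its
    root; these are the initial slots and identifiers of the matrix phase. *)
Definition number_roots : cmd :=
  iset 24 (INum 0) ;;;
  For 19 (IGet 0 (INum 0))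
    (If (ieq (IGet 10 (IV 19)) (IV 19))
       (ISet 22 (IV 19) (IV 24) ;;; iset 24 (IAdd (IV 24) (INum 1))) Skip).

Definition number_vertices : cmd :=
  For 19 (IGet 0 (INum 0))
    (find_root 16 (IV 19) ;;; ISet 23 (IV 19) (IGet 22 (IV 16))).

Definition clear_matrix : cmd :=
  For 19 (IV 42)
    (RSet 5 (IV 19) (RNat (INum 0)) ;;;
     iset2 25 (IV 42) (IV 19) (IV 19) ;;;
     ISet 26 (IV 19) (IV 19) ;;;
     For 20 (IV 42) (rset2 4 (IV 19) (IV 20) (RNat (INum 0)))).

Definition fill_matrix : cmd :=
  For 19 (IGet 0 (INum 1))
    (iset 16 (IGet 23 (IGet 1 (IV 19))) ;;;
     iset 17 (IGet 23 (IGet 2 (IV 19))) ;;;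
     If (ieq (IV 16) (IV 17)) Skip
       (rset2 4 (IV 16) (IV 17) (RAdd (rcell 4 (IV 16) (IV 17)) (RGet 1 (IV 19))) ;;;
        rset2 4 (IV 17) (IV 16) (RAdd (rcell 4 (IV 17) (IV 16)) (RGet 1 (IV 19))) ;;;
        RSet 5 (IV 16) (RAdd (RGet 5 (IV 16)) (RGet 1 (IV 19))) ;;;
        RSet 5 (IV 17) (RAdd (RGet 5 (IV 17)) (RGet 1 (IV 19))))).

Definition inner_setup : cmd :=
  iset 42 (IV 4) ;;;
  number_roots ;;;
  number_vertices ;;;
  clear_matrix ;;;
  fill_matrix ;;;
  iset 29 (IV 42) ;;; iset 30 (INum 0) ;;; iset 32 (IV 42) ;;;
  iset 33 (INum 1) ;;; iset 34 (INum 1).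

(** An identifier is larger than its two parts, so one decreasing sweep carries the mark from the
    chosen side down to the initial metavertices. *)
Definition mark_side : cmd :=
  For 19 (IV 29) (ISet 40 (IV 19) (INum 0)) ;;;
  ISet 40 (IV 31) (INum 1) ;;;
  iset 19 (IV 29) ;;;
  While (ilt (IV 42) (IV 19))
    (iset 19 (ISub (IV 19) (INum 1)) ;;;
     If (ILe (INum 1) (IGet 40 (IV 19)))
       (ISet 40 (IGet 27 (IV 19)) (INum 1) ;;; ISet 40 (IGet 28 (IV 19)) (INum 1))
       Skip).

Definition write_cut : cmd :=
  For 19 (IGet 0 (INum 1))
    (iset 16 (IGet 40 (IGet 23 (IGet 1 (IV 19)))) ;;;
     iset 17 (IGet 40 (IGet 23 (IGet 2 (IV 19)))) ;;;
     If (ieq (IV 16) (IV 17)) (ISet 3 (IV 19) (INum 0)) (ISet 3 (IV 19) (INum 1))).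

Definition keep_lighter : cmd :=
  mark_side ;;;
  If (BAnd (ILe (INum 1) (IV 41)) (RLe (RV 8) (RV 7))) Skip
    (iset 41 (INum 1) ;;; rset 8 (RV 7) ;;; write_cut).

Definition inner_phase : cmd := inner_setup ;;; inner_loop ;;; keep_lighter.

Section Phase.
Variables (R : realType) (n m : nat) (G : wgraph R n m).
Implicit Types (s : state R) (f : labelling n) (u v : 'I_n).
Local Notation N := (n + n)%N.

Record graph_ok s : Prop := GraphOk {
  go_n : int_mem s 0 0 = n;
  go_m : int_mem s 0 1 = m;
  go_src : forall e : 'I_m, int_mem s 1 e = src G e;
  go_dst : forall e : 'I_m, int_mem s 2 e = dst G e;
  go_wt : forall e : 'I_m, real_mem s 1 e = wt G e }.

Lemma graph_ok_frame Li Lr s s' : frame Li Lr s s' ->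
  all (fun a => 2 < a)%N Li -> all (fun a => 2 < a)%N Lr -> graph_ok s -> graph_ok s'.
Proof.
move=> [fi fr] /allP hi /allP hr [h1 h2 h3 h4 h5].
have i a : (a <= 2)%N -> int_mem s' a = int_mem s a.
  by move=> a2; apply: fi; apply/negP => /hi; lia.
have r a : (a <= 2)%N -> real_mem s' a = real_mem s a.
  by move=> a2; apply: fr; apply/negP => /hr; lia.
by split=> *; rewrite ?i ?r.
Qed.

Lemma number_roots_tri s : int_mem s 0 0 = n ->
  tri number_roots s (n * 9 + 6) (fun s' => frame [:: 19; 22; 24] [::] s s' /\
    exists c, [/\ forall u, is_root s u -> (int_mem s' 22 u < c)%N,
      forall u v, is_root s u -> is_root s v -> int_mem s' 22 u = int_mem s' 22 v -> u = v
    & forall x, (x < c)%N -> exists u, is_root s u /\ int_mem s' 22 u = x]).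
Proof.
move=> ns.
apply: (@tri_le _ _ _ (1 + (n * (5 + 4) + 3)).+1); last by lia.
apply: tri_seq; apply: tri_iset => /=.
pose I k s' := [/\ int_mem s' 19 0 = k, frame [:: 19; 22; 24] [::] s s' &
  [/\ forall u, (u < k)%N -> is_root s u -> (int_mem s' 22 u < int_mem s' 24 0)%N,
      forall u v, (u < k)%N -> (v < k)%N -> is_root s u -> is_root s v ->
        int_mem s' 22 u = int_mem s' 22 v -> u = v
    & forall x, (x < int_mem s' 24 0)%N -> exists u,
        [/\ (u < k)%N, is_root s u & int_mem s' 22 u = x]]].
apply: (@tri_weaken _ _ _ _ _ (I n)) (leqnn _) _.
  apply: tri_for => [|k s' _ [xk fr _]|k s' kn [xk fr [H1 H2 H3]]].
  - by split=> //; framing.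
  - by rewrite /= (proj1 fr 0).
  apply: (@tri_if _ _ _ _ _ 4) => /=; rewrite /upd /= xk (proj1 fr 10) // -eqn_leq => rk.
    apply: (@tri_le _ _ _ (1 + 1).+1) => //; apply: tri_seq; apply: tri_iset; apply: tri_iset.
    rewrite /= /upd /= xk addn1; split=> //=; first by framing.
    rewrite /upd /=; split.
    - move=> u uk ru; case: eqP => // uk'; apply: ltnW; rewrite ltnS; apply: H1 => //.
      by move: uk; rewrite ltnS leq_eqVlt => /orP[/eqP|].
    - move=> u v uk vk ru rv.
      have lt (x : 'I_n) : (x < k.+1)%N -> x <> k :> nat -> (x < k)%N.
        by move=> + h; rewrite ltnS leq_eqVlt => /orP[/eqP|].
      case: (eqVneq (u : nat) k) => [uE|/eqP un]; case: (eqVneq (v : nat) k) => [vE|/eqP vn] //=.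
      + by move=> _; apply: val_inj; rewrite /= uE vE.
      + by move=> e; have := H1 v (lt v vk vn) rv; rewrite -e ltnn.
      + by move=> e; have := H1 u (lt u uk un) ru; rewrite e ltnn.
      + by apply: H2 => //; apply: lt.
    - move=> x; rewrite ltnS leq_eqVlt => /orP[/eqP ->|/H3 [u [uk ru ux]]].
        by exists (Ordinal kn); rewrite /is_root /= eqxx.
      by exists u; rewrite ltnW //= ltn_eqF.
  apply: (@tri_le _ _ _ 1) => //; apply: tri_skip.
  have lt u : (u < k.+1)%N -> is_root s u -> (u < k)%N.
    rewrite ltnS leq_eqVlt => /orP[/eqP uE|//]; rewrite /is_root uE => h.
    by rewrite h in rk.
  split=> //=; rewrite ?xk //; first by framing.
  split.
  - by move=> u /lt h ru; apply: H1 => //; apply: h.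
  - by move=> u v /lt hu /lt hv ru rv; apply: H2 => //; [apply: hu|apply: hv].
  - by move=> x /H3 [u [uk ru ux]]; exists u; rewrite ltnW.
move=> s' [_ fr [H1 H2 H3]]; split=> //; exists (int_mem s' 24 0); split.
- by move=> u; apply: H1.
- by move=> u v; apply: H2.
- by move=> x /H3 [u [_ ru ux]]; exists u.
Qed.

Lemma number_vertices_tri f s : int_mem s 0 0 = n -> sets_ok f s ->
  tri number_vertices s (n * (depth n * 3 + 9) + 3) (fun s' =>
    frame [:: 16; 19; 23] [::] s s' /\
    forall u, exists r : 'I_n, [/\ is_root s r, f r = f u & int_mem s' 23 u = int_mem s 22 r]).
Proof.
move=> ns so.
pose I k s' := [/\ int_mem s' 19 0 = k, frame [:: 16; 19; 23] [::] s s' &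
  forall u, (u < k)%N -> exists r : 'I_n,
    [/\ is_root s r, f r = f u & int_mem s' 23 u = int_mem s 22 r]].
apply: (@tri_weaken _ _ _ (n * ((depth n * 3 + 3 + 1).+1 + 4) + 3) _ (I n)); last 2 first.
- by lia.
- by move=> s' [_ fr H]; split=> // u; apply: H.
apply: tri_for => [|k s' _ [xk fr _]|k s' kn [xk fr H]].
- by split=> //; framing.
- by rewrite /= (proj1 fr 0).
apply: tri_seq.
have so' : sets_ok f s' by apply: sets_ok_frame so; rewrite (proj1 fr).
apply: tri_weaken; [apply: (find_root_tri (v := Ordinal kn) so')| exact: leqnn |] => //.
move=> s2 [fr2 [r [xr rr fr_]]]; apply: tri_iset.
have fr3 : frame [:: 16; 19; 23] [::] s s2.
  by apply: frame_trans fr _; apply: frame_sub fr2 _ _.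
rewrite /= xr (proj1 fr2 19) // xk (proj1 fr3 22) //; split.
- by rewrite /= /upd /= (proj1 fr2 19) // xk.
- by framing.
- move=> u; rewrite /= /upd /= ltnS leq_eqVlt; case: eqP => [uk _|_ /= uk].
    exists r; split=> //; first by move: rr; rewrite /is_root (proj1 fr).
    by rewrite fr_; congr (f _); apply: val_inj.
  by have [r' [h1 h2 h3]] := H u uk; exists r'; split=> //; rewrite (proj1 fr2).
Qed.

Lemma numbering_of_roots f s s1 s2 c : sets_ok f s ->
  (forall u, is_root s u -> (int_mem s1 22 u < c)%N) ->
  (forall u v, is_root s u -> is_root s v -> int_mem s1 22 u = int_mem s1 22 v -> u = v) ->
  (forall x, (x < c)%N -> exists u, is_root s u /\ int_mem s1 22 u = x) ->
  (forall u, exists r : 'I_n, [/\ is_root s r, f r = f u & int_mem s2 23 u = int_mem s1 22 r]) ->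
  numbering f c (fun u => int_mem s2 23 u).
Proof.
move=> so h1 h2 h3 h4; split.
- by move=> u; have [r [rr _ ->]] := h4 u; apply: h1.
- move=> x /h3 [u [ru ux]]; exists u; have [r [rr e ->]] := h4 u.
  by rewrite (so_root so rr ru e).
- move=> u v; have [r [rr eu ->]] := h4 u; have [r' [rr' ev ->]] := h4 v.
  rewrite -eu -ev; apply/eqP/eqP => [e|e]; first by rewrite (so_root so rr rr' e).
  by rewrite (h2 _ _ rr rr' e).
Qed.

Lemma clear_matrix_tri s K : (K <= n)%N -> rows_ok n s -> int_mem s 42 0 = K ->
  tri clear_matrix s (K * (K * 5 + 13) + 3) (fun s' =>
    [/\ frame [:: 19; 20; 25; 26] [:: 4; 5] s s',
        forall x y, (x < K)%N -> (y < K)%N -> Mx n s' x y = 0,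
        forall x, (x < K)%N -> real_mem s' 5 x = 0,
        forall x, (x < K)%N -> Act n s' K x = x
      & forall x, (x < K)%N -> int_mem s' 26 x = x]).
Proof.
move=> Kn rw Ks.
pose I k s' := int_mem s' 19 0 = k /\
    [/\ frame [:: 19; 20; 25; 26] [:: 4; 5] s s',
        forall x y, (x < k)%N -> (x < K)%N -> (y < K)%N -> Mx n s' x y = 0,
        forall x, (x < k)%N -> real_mem s' 5 x = 0,
        forall x, (x < k)%N -> (x < K)%N -> Act n s' K x = x
      & forall x, (x < k)%N -> int_mem s' 26 x = x].
apply: (@tri_weaken _ _ _ (K * ((1 + (1 + (1 + (K * (1 + 4) + 3)).+1).+1).+1 + 4) + 3) _ (I K)); last 2 first.
- by lia.
- by move=> s' [_ [? H1 ? H2 ?]]; split=> // *; [apply: H1|apply: H2].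
apply: tri_for => [|k s' _ [xk [fr _ _ _ _]]|k s' kK [xk [fr H1 H2 H3 H4]]].
- by split=> //; split=> //; framing.
- by rewrite /= (proj1 fr 42).
do 3!(apply: tri_seq; try apply: tri_rset; try apply: tri_iset).
rewrite /= /upd /= xk (proj1 fr 9) // (proj1 fr 42) // Ks rw; last by lia.
set s1 := set_int _ 26 k k.
have fr1 : frame [:: 19; 20; 25; 26] [:: 4; 5] s s1 by framing.
pose J l s2 := [/\ int_mem s2 20 0 = l, frame [:: 20] [:: 4] s1 s2,
   forall x y, (x < k)%N -> (y < K)%N -> Mx n s2 x y = 0
  & forall y, (y < l)%N -> (y < K)%N -> Mx n s2 k y = 0].
apply: (@tri_weaken _ _ _ _ _ (J K)) (leqnn _) _.
  apply: tri_for => [|l s2 _ [xl fr2 _ _]|l s2 lK [xl fr2 H5 H6]].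
  - split=> //; first by framing.
    by move=> x y xk'; apply: H1 => //; lia.
  - by rewrite /= (proj1 fr2 42) //= /upd /= (proj1 fr 42).
  apply: tri_rset; rewrite /= (proj1 fr2 19) //= /upd /= xk xl.
  rewrite (proj1 fr2 9) //= /upd /= (proj1 fr 9) // rw; last by lia.
  split=> //=; first by framing.
  - move=> x y xk' yK; have <- := H5 x y xk' yK.
    by rewrite /Mx /= /upd /= cell_eq ?(ltn_eqF xk') //; lia.
  - move=> y yl yK; rewrite /Mx /= /upd /= cell_eq ?eqxx; try lia.
    by case: eqVneq => // yl'; apply: H6 => //; lia.
move=> s2 [_ fr2 H5 H6]; have xk2 : int_mem s2 19 0 = k by rewrite (proj1 fr2) //= /upd /= xk.
split; first by rewrite /= /upd /= xk2.
split.
- by apply: frame_set_int => //; apply: frame_trans fr1 _; apply: frame_sub fr2 _ _.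
- move=> x y; rewrite ltnS leq_eqVlt => /orP[/eqP ->|xk'] xK yK; first exact: H6.
  exact: H5.
- move=> x; rewrite ltnS leq_eqVlt /= (proj2 fr2 5) //= /upd /=.
  by case: eqP => //= _ ?; apply: H2.
- move=> x; rewrite ltnS leq_eqVlt /Act /= /upd /= (proj1 fr2 25) //= /upd /= => xk' xK.
  rewrite cell_eq ?eqxx /=; try lia.
  by case: (eqVneq x k) xk' => [-> //|_ /=] xk'; apply: H3.
- move=> x; rewrite ltnS leq_eqVlt /= /upd /= (proj1 fr2 26) //= /upd /=.
  by case: eqP => //= _ ?; apply: H4.
Qed.

Lemma sum_ltS (F : 'I_m -> R) k (km : (k < m)%N) :
  \sum_(e < m | (e < k.+1)%N) F e = F (Ordinal km) + \sum_(e < m | (e < k)%N) F e.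
Proof.
rewrite (bigD1 (Ordinal km)) //=; congr (_ + _); apply: eq_bigl => e.
by rewrite ltnS -val_eqE /= [RHS]ltn_neqAle andbC.
Qed.

Lemma sum_lt_all (F : 'I_m -> R) : \sum_(e < m | (e < m)%N) F e = \sum_e F e.
Proof. by apply: eq_bigl => e; rewrite ltn_ord. Qed.

Definition pair_wt (pos : 'I_n -> nat) x y (e : 'I_m) : R :=
  wt G e * (((pos (src G e) == x) && (pos (dst G e) == y))%:R +
            ((pos (dst G e) == x) && (pos (src G e) == y))%:R).

Definition deg_wt (pos : 'I_n -> nat) x (e : 'I_m) : R :=
  wt G e * (((pos (src G e) == x) && (pos (dst G e) != x))%:R +
            ((pos (dst G e) == x) && (pos (src G e) != x))%:R).

Lemma fill_matrix_tri s K : (K <= n)%N -> rows_ok n s -> graph_ok s ->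
  (forall u, (int_mem s 23 u < K)%N) ->
  (forall x y, (x < K)%N -> (y < K)%N -> Mx n s x y = 0) ->
  (forall x, (x < K)%N -> real_mem s 5 x = 0) ->
  tri fill_matrix s (m * 16 + 3) (fun s' =>
    [/\ frame [:: 16; 17; 19] [:: 4; 5] s s',
        forall x, (x < K)%N -> real_mem s' 5 x =
          vcut G (block (fun u => int_mem s 23 u) x) (~: block (fun u => int_mem s 23 u) x)
      & forall x y, (x < K)%N -> (y < K)%N -> Mx n s' x y = if x == y then 0 else
          vcut G (block (fun u => int_mem s 23 u) x) (block (fun u => int_mem s 23 u) y)]).
Proof.
move=> Kn rw go pK M0 D0; set pos := fun u : 'I_n => int_mem s 23 u.
pose I k s' := [/\ int_mem s' 19 0 = k, frame [:: 16; 17; 19] [:: 4; 5] s s',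
   forall x, (x < K)%N -> real_mem s' 5 x = \sum_(e < m | (e < k)%N) deg_wt pos x e
  & forall x y, (x < K)%N -> (y < K)%N -> Mx n s' x y = if x == y then 0 else
      \sum_(e < m | (e < k)%N) pair_wt pos x y e].
apply: (@tri_weaken _ _ _ (m * (12 + 4) + 3) _ (I m)); last 2 first.
- by [].
- move=> s' [_ fr H1 H2]; split=> // [x xK|x y xK yK].
    by rewrite H1 // sum_lt_all; apply: eq_bigr => e _; rewrite !inE.
  rewrite H2 //; case: eqP => // _.
  by rewrite sum_lt_all; apply: eq_bigr => e _; rewrite !inE.
apply: tri_for => [|k s' _ [xk fr _ _]|k s' km [xk fr H1 H2]].
- split=> //=; first by framing.
  + by move=> x xK; rewrite big_pred0 ?D0.
  + by move=> x y xK yK; rewrite big_pred0 // -/(Mx n s x y) M0 //; case: eqP.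
- by rewrite /= (proj1 fr 0) // (go_m go).
set e := Ordinal km; set a := pos (src G e); set b := pos (dst G e).
have aK : (a < K)%N by apply: pK.
have bK : (b < K)%N by apply: pK.
have aN : (a < N)%N by lia.
have bN : (b < N)%N by lia.
apply: (@tri_le _ _ _ (1 + (1 + 8).+1).+1) => //.
do 2!(apply: tri_seq; apply: tri_iset).
rewrite /= /upd /= xk (proj1 fr 1) // (proj1 fr 2) // (proj1 fr 23) //.
rewrite (go_src go e) (go_dst go e) -/(pos (src G e)) -/(pos (dst G e)) -/a -/b.
apply: (@tri_if _ _ _ _ _ 7) => /=; rewrite /upd /= -eqn_leq => ab.
  apply: (@tri_le _ _ _ 1) => //; apply: tri_skip.
  rewrite /= /upd /= xk; split=> //=; first by framing.
  - move=> x xK; rewrite H1 // sum_ltS /deg_wt -/e -/a -/b (eqP ab).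
    by rewrite (_ : _ * _ = 0) ?add0r //; case: eqP => _ /=; ring.
  - move=> x y xK yK; have := H2 x y xK yK; rewrite /Mx /= => ->; case: (eqVneq x y) => // xy.
    rewrite sum_ltS /pair_wt -/e -/a -/b (eqP ab).
    rewrite (_ : _ * _ = 0) ?add0r //.
    have -> : (b == x) && (b == y) = false.
      by apply/negP => /andP[/eqP e1 /eqP e2]; rewrite -e1 -e2 eqxx in xy.
    by rewrite addr0 mulr0.
apply: (@tri_le _ _ _ (1 + (1 + (1 + 1).+1).+1).+1) => //.
apply: tri_seq; apply: tri_rset; apply: tri_seq; apply: tri_rset.
apply: tri_seq; apply: tri_rset; apply: tri_rset.
rewrite /= /upd /= xk !(proj1 fr 9) // !rw; try lia.
rewrite (proj2 fr 1) // (go_wt go e) !cell_eq // [b == a]eq_sym (negbTE ab) /=.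
rewrite -/(Mx n s' a b) -/(Mx n s' b a) !H2 // [b == a]eq_sym (negbTE ab) !H1 //.
split=> //=; first by framing.
- move=> x xK; rewrite /upd /= sum_ltS /deg_wt -/e -/a -/b.
  have [xb|xb] := eqVneq x b.
    by rewrite xb ab (negbTE ab) /=; ring.
  have [xa|xa] := eqVneq x a.
    by rewrite xa /=; ring.
  by rewrite H1 //=; ring.
- move=> x y xK yK; rewrite /Mx /= /upd /= !cell_eq; try lia.
  rewrite sum_ltS /pair_wt -/e -/a -/b.
  case: (eqVneq x y) => [<-|xy].
    have -> : (x == b) && (x == a) = false.
      by apply/negP => /andP[/eqP e1 /eqP e2]; rewrite -e1 -e2 eqxx in ab.
    have -> : (x == a) && (x == b) = false.
      by apply/negP => /andP[/eqP e1 /eqP e2]; rewrite -e1 -e2 eqxx in ab.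
    by have := H2 x x xK xK; rewrite eqxx /Mx.
  have := H2 x y xK yK; rewrite (negbTE xy) /Mx => ->.
  rewrite /pair_wt; have [xb|xb] := eqVneq x b; have [ya|ya] := eqVneq y a => /=.
  + by rewrite xb ya (negbTE ab) /=; ring.
  + by rewrite /pair_wt xb [b == a]eq_sym (negbTE ab) /=; ring.
  + case: (eqVneq x a) => [xa|_] /=; first by rewrite xa ya eqxx in xy.
    by ring.
  + case: (eqVneq x a) => [xa|xa] /=; last by ring.
    case: (eqVneq y b) => [yb|yb] /=; last by ring.
    by rewrite xa yb; ring.
Qed.

Lemma inner_setup_tri f K s : (1 < K <= n)%N -> graph_ok s -> rows_ok n s ->
  sets_ok f s -> (exists pos, numbering f K pos) -> int_mem s 4 0 = K ->
  tri inner_setup s (n * (depth n * 3 + 18) + K * (K * 5 + 13) + m * 16 + 40) (fun s' =>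
    [/\ frame [:: 16; 17; 19; 20; 22; 23; 24; 25; 26; 29; 30; 32; 33; 34; 42] [:: 4; 5] s s',
       numbering f K (fun u => int_mem s' 23 u), at_inner_down G K s' [:: f] None s',
       int_mem s' 29 0 = K & int_mem s' 42 0 = K]).
Proof.
move=> /andP[K1 Kn] go rw so [pos0 num0] Ks.
have Kn' : (K <= N)%N by lia.
apply: (@tri_le _ _ _ (1 + (n * 9 + 6 + (n * (depth n * 3 + 9) + 3 + (K * (K * 5 + 13) + 3 +
  (m * 16 + 3 + (1 + (1 + (1 + (1 + 1).+1).+1).+1).+1).+1).+1).+1).+1).+1); last by lia.
apply: tri_seq; apply: tri_iset; rewrite /= Ks.
set s1 := set_int _ _ _ _.
have go1 : graph_ok s1 by case: go.
have so1 : sets_ok f s1 by case: so.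
apply: tri_seq; apply: tri_weaken; [exact: (number_roots_tri (go_n go1))|exact: leqnn|].
move=> s2 [fr2 [c [r1 r2 r3]]].
have go2 : graph_ok s2 by apply: graph_ok_frame fr2 _ _ go1.
have so2 : sets_ok f s2 by apply: sets_ok_frame so1; rewrite (proj1 fr2).
apply: tri_seq; apply: tri_weaken; [exact: (number_vertices_tri (go_n go2) so2)|exact: leqnn|].
move=> s3 [fr3 vm].
have rE u : is_root s2 u = is_root s1 u by rewrite /is_root (proj1 fr2).
have num3 : numbering f c (fun u => int_mem s3 23 u).
  apply: (numbering_of_roots so2 (s1 := s2)); first by move=> u; rewrite rE; apply: r1.
  - by move=> u v; rewrite !rE; apply: r2.
  - by move=> x /r3 [u [ru ux]]; exists u; rewrite rE.
  - exact: vm.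
(* Any two numberings of one partition have the same size, so the number of roots counted is the
   level [K]. *)
have cK := numbering_size num3 num0; rewrite {}cK in num3 r1 r3.
have go3 : graph_ok s3 by apply: graph_ok_frame fr3 _ _ go2.
have fr13 : frame [:: 16; 19; 22; 23; 24; 42] [::] s s3.
  apply: frame_trans (_ : frame _ _ s s1) _; first by framing.
  apply: frame_trans (frame_sub fr2 _ _) (frame_sub fr3 _ _) => //.
have rw3 : rows_ok n s3 by move=> i iN; rewrite (proj1 fr13) // rw.
have Ks3 : int_mem s3 42 0 = K by rewrite (proj1 fr3) // (proj1 fr2).
apply: tri_seq; apply: tri_weaken; [exact: (clear_matrix_tri Kn rw3 Ks3)|exact: leqnn|].
move=> s4 [fr4 M4 D4 A4 N4].
have go4 : graph_ok s4 by apply: graph_ok_frame fr4 _ _ go3.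
have rw4 : rows_ok n s4 by move=> i iN; rewrite (proj1 fr4) // rw3.
have vm4 : int_mem s4 23 = int_mem s3 23 by rewrite (proj1 fr4).
have b4 u : (int_mem s4 23 u < K)%N by rewrite vm4; case: num3.
apply: tri_seq; apply: tri_weaken; [exact: (fill_matrix_tri Kn rw4 go4 b4 M4 D4)|exact: leqnn|].
move=> s5 [fr5 D5 M5].
do 4!(apply: tri_seq; apply: tri_iset); apply: tri_iset.
rewrite /= /upd /= (proj1 fr5 42) // (proj1 fr4 42) // Ks3.
set s6 := set_int _ 34 _ _.
have fr36 : frame [:: 16; 17; 19; 20; 25; 26; 29; 30; 32; 33; 34] [:: 4; 5] s3 s6.
  do 5!(apply: frame_set_int => //).
  apply: frame_trans (frame_sub fr4 _ _) (frame_sub fr5 _ _) => //.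
have vm6 : int_mem s6 23 = int_mem s4 23 by exact: (proj1 fr5 23 isT).
have act6 x : (x < K)%N -> Act n s6 K x = x.
  by move=> xK; have := A4 x xK; rewrite /Act /s6 /= /upd /= !(proj1 fr5).
have node6 x : (x < K)%N -> int_mem s6 26 x = x.
  by move=> xK; rewrite /s6 /= /upd /= (proj1 fr5) // N4.
split=> //.
- by apply: frame_trans (frame_sub fr13 _ _) (frame_sub fr36 _ _).
- by rewrite -[int_mem s5 23]/(int_mem s6 23) vm6 vm4.
split=> //.
exists (fun id => [set u : 'I_n | int_mem s6 23 u == id]); split=> //=.
- by split=> //= id; rewrite /upd /=; lia.
- split=> //; rewrite subn0; exists (fun u => int_mem s6 23 u); split.
  + by rewrite vm6 vm4.
  + by move=> x xK; rewrite act6 //; lia.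
  + by move=> x xK; rewrite act6 // node6.
  + by move=> x xK; rewrite act6 // D5 // vm6.
  + move=> x y xK yK; rewrite !act6 //; have := M5 x y xK yK; rewrite vm6 /Mx /= => ->.
    by [].
- by rewrite /level /= subSS subn0.
Qed.

Lemma mark_side_tri s K nid a (S : nat -> {set 'I_n}) : int_mem s 42 0 = K ->
  int_mem s 29 0 = nid -> int_mem s 31 0 = a -> (a < nid)%N -> (K <= nid)%N ->
  (forall u, (int_mem s 23 u < K)%N) ->
  (forall id, (id < K)%N -> S id = [set u : 'I_n | int_mem s 23 u == id]) ->
  (forall id, (K <= id < nid)%N -> [/\ (int_mem s 27 id < id)%N,
     (int_mem s 28 id < id)%N & S id = S (int_mem s 27 id) :|: S (int_mem s 28 id)]) ->
  tri mark_side s (nid * 13 + 12) (fun s' => frame [:: 19; 40] [::] s s' /\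
    forall u, (int_mem s' 40 (int_mem s 23 u) <= 1)%N /\
      (u \in S a) = (int_mem s' 40 (int_mem s 23 u) == 1%N)).
Proof.
move=> Ks ns as_ an Kn vK S0 Sd.
apply: (@tri_le _ _ _ (nid * (1 + 4) + 3 + (1 + (1 + (nid * 6.+2).+1).+1).+1).+1); last by lia.
apply: tri_seq.
pose I k s' := [/\ int_mem s' 19 0 = k, frame [:: 19; 40] [::] s s' &
  forall id, (id < k)%N -> int_mem s' 40 id = 0%N].
apply: (@tri_weaken _ _ _ _ _ (I nid)) (leqnn _) _.
  apply: tri_for => [|k s' _ [xk fr _]|k s' kn [xk fr H]].
  - by split=> //; framing.
  - by rewrite /= (proj1 fr 29).
  apply: tri_iset; rewrite /= /upd /= xk; split=> //=; first by framing.
  by move=> id; rewrite /upd /= ltnS leq_eqVlt; case: eqP => //= _; apply: H.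
move=> s1 [_ fr1 H1].
apply: tri_seq; apply: tri_iset; apply: tri_seq; apply: tri_iset.
rewrite /= /upd /= (proj1 fr1 31) // as_ (proj1 fr1 29) // ns.
(* Throughout the sweep, the side consists of the vertices covered by a marked identifier below [i];
   at [i = K] these are initial metavertices. *)
pose J d s' := exists i, [/\ int_mem s' 19 0 = i, (i <= K + d)%N /\ (K <= i <= nid)%N,
  frame [:: 19; 40] [::] s s', forall id, (id < nid)%N -> (int_mem s' 40 id <= 1)%N
  & forall u, u \in S a <-> exists id, [/\ (id < i)%N, int_mem s' 40 id = 1%N & u \in S id]].
apply: (@tri_while _ _ _ J) => [d s' [i [s'i [id /andP[Ki iN]] fr le1 H]]|]; last first.
  exists nid; split=> //=; first by lia.
  - by framing.
  - by move=> id idn; rewrite /upd /= ; case: eqP => //= _; rewrite H1.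
  - move=> u; split=> [ua|[id [idn + ui]]].
      by exists a; rewrite /upd /= eqxx.
    by rewrite /upd /=; case: eqP => [<- //|_ /=]; rewrite H1.
rewrite beval_ilt /= (proj1 fr 42) // Ks s'i; case: ifPn => iK; last first.
  have iE : i = K by lia.
  split=> // u; have uK := vK u; split; first by apply: le1; lia.
  apply/idP/eqP => [/H [id' [l1 l2 l3]]|mu]; last first.
    by apply/H; exists (int_mem s 23 u); rewrite iE S0 // inE eqxx.
  by move: l3; rewrite S0 -?iE // inE => /eqP ->.
exists d.-1; first by lia.
apply: (@tri_le _ _ _ (1 + 4).+1) => //; apply: tri_seq; apply: tri_iset.
rewrite /= s'i subn1.
have iN' : (K <= i.-1 < nid)%N by lia.
have [l1 l2 Si] := Sd _ iN'.
apply: (@tri_if _ _ _ _ _ 3) => /=; rewrite /upd /= => mk.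
  apply: (@tri_le _ _ _ (1 + 1).+1) => //; apply: tri_seq; apply: tri_iset; apply: tri_iset.
  rewrite /= /upd /= (proj1 fr 27) // (proj1 fr 28) //.
  exists i.-1; split=> //=; first by lia.
  - by framing.
  - by move=> id' ?; rewrite /upd /=; case: eqP => //= _; case: eqP => //= _; apply: le1.
  - move=> u; rewrite H; split=> [[id' [m1 m2 m3]]|[id' [m1 m2 m3]]].
      have [ii|ii] := eqVneq id' i.-1; last first.
        exists id'; rewrite /upd /= m2; split=> //; first by lia.
        by case: eqP => //= _; case: eqP.
      move: m3; rewrite ii Si inE => /orP[m3|m3].
        by exists (int_mem s 27 i.-1); rewrite /upd /= l1 eqxx; split=> //; case: eqP.
      by exists (int_mem s 28 i.-1); rewrite /upd /= l2 eqxx.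
    move: m2; rewrite /upd /=; case: eqP => /= [e _|_].
      exists i.-1; split; [lia| |by rewrite Si inE -e m3 orbT].
      by apply/eqP; rewrite eqn_leq mk le1 //; lia.
    case: eqP => /= [e _|_ m2]; last by exists id'; split=> //; lia.
    exists i.-1; split; [lia| |by rewrite Si inE -e m3].
    by apply/eqP; rewrite eqn_leq mk le1 //; lia.
apply: (@tri_le _ _ _ 1) => //; apply: tri_skip.
exists i.-1; split=> //=; first by lia.
- by framing.
- move=> u; rewrite H; split=> [[id' [m1 m2 m3]]|[id' [m1 m2 m3]]]; last first.
    by exists id'; split=> //; lia.
  exists id'; split=> //; have [ii|ii] := eqVneq id' i.-1; last by lia.
  by move: mk; rewrite -ii m2.
Qed.

Lemma write_cut_tri s K (S : {set 'I_n}) : graph_ok s -> (forall u, (int_mem s 23 u < K)%N) ->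
  (forall u, (int_mem s 40 (int_mem s 23 u) <= 1)%N /\
     (u \in S) = (int_mem s 40 (int_mem s 23 u) == 1%N)) ->
  tri write_cut s (m * 10 + 3) (fun s' => frame [:: 3; 16; 17; 19] [::] s s' /\
    output m s' = crossing G S).
Proof.
move=> go vK H.
pose I k s' := [/\ int_mem s' 19 0 = k, frame [:: 3; 16; 17; 19] [::] s s' &
  forall e : 'I_m, (e < k)%N -> (int_mem s' 3 e != 0%N) = (e \in crossing G S)].
apply: (@tri_weaken _ _ _ (m * (6 + 4) + 3) _ (I m)); last 2 first.
- by [].
- by move=> s' [_ fr H']; split=> //; apply/setP => e; rewrite inE H'.
apply: tri_for => [|k s' _ [xk fr _]|k s' km [xk fr H']].
- by split=> //; framing.
- by rewrite /= (proj1 fr 0) // (go_m go).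
set e := Ordinal km.
apply: (@tri_le _ _ _ (1 + (1 + 2).+1).+1) => //.
do 2!(apply: tri_seq; apply: tri_iset).
rewrite /= /upd /= xk (proj1 fr 1) // (proj1 fr 2) // (proj1 fr 23) // (proj1 fr 40) //.
rewrite (go_src go e) (go_dst go e).
have [u1 uS] := H (src G e); have [v1 vS] := H (dst G e).
have done b : (b : nat) != 0%N = (e \in crossing G S) -> I k.+1
    (set_int (set_int (set_int (set_int s' 16 0 (int_mem s 40 (int_mem s 23 (src G e)))) 17 0
        (int_mem s 40 (int_mem s 23 (dst G e)))) 3 k b) 19 0 k.+1).
  move=> bE; split=> //=; first by framing.
  move=> e'; rewrite /upd /= ltnS leq_eqVlt; case: eqP => [ek _|_ /= ek].
    by rewrite bE (_ : e' = e) //; apply: val_inj.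
  exact: H'.
apply: tri_if => /=; rewrite /upd /= -eqn_leq => uv; apply: tri_iset; rewrite /= /upd /= xk;
  apply: done; rewrite inE uS vS.
- by rewrite (eqP uv) !eqxx.
- by apply/esym; move: uv u1 v1; case: (int_mem s 40 _) => [|[|]] //; case: (int_mem s 40 _) => [|[|]].
Qed.

Definition outer_acc s (acc : option {set 'I_m}) := if acc is Some C then
  [/\ int_mem s 41 0 = 1%N, real_mem s 8 0 = weight G C & output m s = C]
  else int_mem s 41 0 = 0%N.

Lemma keep_lighter_tri K s0 s acc C : graph_ok s -> int_mem s 42 0 = K ->
  (forall u, (int_mem s0 23 u < K)%N) -> outer_acc s acc ->
  inner_done G K s0 (Some C) s ->
  tri keep_lighter s (int_mem s 29 0 * 13 + (m * 10 + 25)) (fun s' =>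
    frame [:: 3; 16; 17; 19; 40; 41] [:: 8] s s' /\ outer_acc s' (acc_join G acc C)).
Proof.
move=> go Ks vK oa [S [fr [d1 d2 d3] [a1 a2 a3 a4]]].
have vE : int_mem s 23 = int_mem s0 23 by rewrite (proj1 fr).
apply: (@tri_le _ _ _ (int_mem s 29 0 * 13 + 12 + (1 + (1 + (m * 10 + 3)).+1).+2).+1); last by lia.
apply: tri_seq; apply: tri_weaken; [apply: (mark_side_tri (S := S) Ks erefl erefl a2 d3)|exact: leqnn|].
- by move=> u; rewrite vE.
- by move=> id idK; rewrite vE d1.
- exact: d2.
move=> s1 [fr1 mk].
apply: tri_if => /=; rewrite !(proj1 fr1 41) // !(proj2 fr1) // a3 => cnd.
  apply: (@tri_le _ _ _ 1); [apply: tri_skip|by lia].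
  split; first by apply: frame_sub fr1 _ _.
  case: acc oa cnd => [C'|/= -> //] /= [b1 b2 b3]; rewrite b1 b2 /= => le.
  rewrite /lighter le (proj1 fr1) // (proj2 fr1) //; split=> //.
  by rewrite -b3; apply/setP => e; rewrite !inE (proj1 fr1).
do 2!(apply: tri_seq; try apply: tri_iset; try apply: tri_rset).
rewrite /= (proj2 fr1 7) // a3.
set s2 := set_real _ _ _ _.
have go2 : graph_ok s2.
  by have := graph_ok_frame fr1 isT isT go; case=> *; split.
apply: tri_weaken; [apply: (write_cut_tri (K := K) (S := S (int_mem s 31 0)) go2)|exact: leqnn|].
- by move=> u; rewrite /s2 /= /upd /= (proj1 fr1) // vE.
- by move=> u; rewrite /s2 /= /upd /= (proj1 fr1 23) //.
move=> s3 [fr3 out]; split.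
  apply: frame_trans (_ : frame _ _ s s2) (frame_sub fr3 _ _) => //.
  apply: frame_set_real => //; apply: frame_set_int => //; exact: frame_sub fr1 _ _.
have <- : C = if acc is Some D then lighter G D C else C.
  case: acc oa cnd => [C'|//] /= [b1 b2 _]; rewrite b1 b2 /= => nle.
  by rewrite /lighter (negbTE nle).
by split; rewrite ?(proj1 fr3) ?(proj2 fr3) // out -a4.
Qed.


Lemma outer_acc_frame Li Lr s s' acc : frame Li Lr s s' -> 3 \notin Li -> 41 \notin Li ->
  8 \notin Lr -> outer_acc s acc -> outer_acc s' acc.
Proof.
move=> [fi fr] n3 n41 n8; case: acc => [C|] /=; last by rewrite fi.
case=> h1 h2 h3; rewrite !(fi 41) // !(fr 8) //; split=> //.
by rewrite -h3; apply/setP => e; rewrite !inE fi.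
Qed.

(** The potential is taken at 13 per identifier, the rate of [mark_side]; the [K] initial
    identifiers account for raising [K * 13] to [K * 26]. *)
Lemma inner_phase_spec (V : seq cmd -> state R -> R) kappa D (tD : nat -> R)
    f K s acc rest X :
  supersolution kappa D V -> (1 < K <= n)%N -> connected_weights G ->
  (forall k, 0 <= tD k) -> 20%:R <= tD 2 ->
  (forall k, (2 < k <= K)%N ->
     (k * 32 + (70 + 13))%:R + tD k.-1 + 12%:R + (1 - (1 - 2 / k%:R)) * (0 + tD k) <= tD k) ->
  graph_ok s -> rows_ok n s -> sets_ok f s -> (exists pos, numbering f K pos) ->
  int_mem s 4 0 = K -> outer_acc s acc ->
  (forall C s', frame ([:: 3; 15; 16; 17; 19; 20] ++ iota 22 21)%N [:: 4; 5; 6; 7; 8; 9] s s' ->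
     outer_acc s' (acc_join G acc C) -> V rest s' <= X C) ->
  V (inner_phase :: rest) s <=
    kappa * ((n * (depth n * 3 + 18) + K * (K * 5 + 26) + m * 26 + 73)%:R + tD K) +
    mean (fpz_law G K f) X.
Proof.
move=> HV K2 conn t0 t2 tS go rw so num Ks oa HX; have [k0 _ _] := HV.
have K1 : (1 < K)%N by case/andP: K2.
have [mu1 _ _] := fpz_law_branching G K1.
have sp : subprob (fpz_law G K f) by apply: mu1; rewrite K1 leqnn.
set T := (n * (depth n * 3 + 18) + K * (K * 5 + 13) + m * 16 + 40)%N.
set Y : R := kappa * (13 * K)%:R + (kappa * (tD K + 6%:R) +
   mean (fpz_law G K f) (fun C => X C + kappa * (m * 10 + 25)%:R)).
have H : V (inner_phase :: rest) s <= kappa * (T + 1).+1%:R + Y.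
  apply: (V_seq HV); apply: (V_tri HV) (inner_setup_tri K2 go rw so num Ks) _.
  move=> s1 [fr1 num1 ds nid1 Ks1]; apply: (V_seq HV).
  have -> : kappa * 0%:R + Y = Y by rewrite mulr0 add0r.
  have rw1 : rows_ok n s1 by move=> i iN; rewrite (proj1 fr1) // rw.
  rewrite /Y -{1}nid1.
  apply: (inner_loop_spec K2 rw1 Ks1 conn HV _ t0 t2 tS ds) => C s2 dn.
  have fr2 : frame [:: 15; 19; 25; 26; 27; 28; 29; 30; 31; 32; 33; 34; 35; 36; 37; 38; 39]
            [:: 4; 5; 6; 7; 9] s1 s2 by case: dn => S [].
  have go2 : graph_ok s2.
    by apply: graph_ok_frame fr2 _ _ _ => //; apply: graph_ok_frame fr1 _ _ go.
  have Ks2 : int_mem s2 42 0 = K by rewrite (proj1 fr2).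
  have b1 u : (int_mem s1 23 u < K)%N by case: num1.
  have oa2 : outer_acc s2 acc.
    by apply: (outer_acc_frame fr2) => //; apply: (outer_acc_frame fr1).
  rewrite addrCA -mulrDr -natrD addrC mulnC.
  apply: (keep_lighter_tri go2 Ks2 b1 oa2 dn HV) => s3 [fr3 oa3].
  apply: HX oa3.
  apply: frame_trans (frame_sub fr1 _ _) _ => //.
  by apply: frame_trans (frame_sub fr2 _ _) (frame_sub fr3 _ _).
apply: le_trans H _.
have := mean_addr_le X sp (mulr_ge0 k0 (ler0n R (m * 10 + 25))).
rewrite /Y; set M := mean _ _; set M' := mean _ _ => MM.
rewrite (_ : (n * (depth n * 3 + 18) + K * (K * 5 + 26) + m * 26 + 73)%N =
  ((T + 1).+1 + 13 * K + (m * 10 + 25) + 6)%N); last by rewrite /T; lia.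
rewrite !natrD; lra.
Qed.

End Phase.

(** * The outer recursion *)

Definition sample_edge : cmd :=
  iset 13 (INum 0) ;;;
  While (ILe (IV 13) (INum 0))
    (descend ;;;
     iset 18 (ISub (IV 14) (IV 7)) ;;;
     clear_leaf ;;;
     find_root 16 (IGet 1 (IV 18)) ;;;
     find_root 17 (IGet 2 (IV 18)) ;;;
     If (ieq (IV 16) (IV 17)) Skip (iset 13 (INum 1))).

Section Sampling.
Variables (R : realType) (n m : nat) (G : wgraph R n m) (w : 'I_m -> R) (h : nat).
Implicit Types (s : state R) (f : labelling n) (u v : 'I_n).
Local Notation M := (2 ^ h)%N.
Hypothesis mM : (m <= M)%N.

Definition leaf s l := real_mem s 3 (M + l)%N.

(** Edges inside a metavertex may still have a nonzero leaf; they are detected only when drawn. *)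
Definition leaves_ok f s := [/\ tree_ok h s, forall l, (m <= l < M)%N -> leaf s l = 0
  & forall e : 'I_m, e \in live G f -> leaf s e = w e].

Definition parents_ok s := int_mem s 7 0 = M /\
  forall k, (k < M + M)%N -> int_mem s 8 k = k./2.

(* Every trial of the rejection sampler clears a nonzero leaf, which pays for it. *)
Definition supply s := (\sum_(e < m) (0 < leaf s e)%R)%N.

Lemma supply_le s : (supply s <= m)%N.
Proof.
apply: (@leq_trans (\sum_(e < m) 1)%N); last by rewrite sum1_card card_ord.
by apply: leq_sum => e _; case: (_ < _)%R.
Qed.

Lemma supply_clear s s' (e : 'I_m) : 0 < leaf s e ->
  (forall l, (l < M)%N -> leaf s' l = if l == e :> nat then 0 else leaf s l) ->
  supply s = (supply s').+1.
Proof.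
move=> e0 H; rewrite /supply (bigD1 e) //= [in RHS](bigD1 e) //= e0 H; last first.
  exact: leq_trans (ltn_ord e) mM.
rewrite eqxx ltxx add0n add1n; congr _.+1; apply: eq_bigr => i ie.
by rewrite H ?(leq_trans (ltn_ord i)) // ifN.
Qed.

Definition trial_cost := (h * 9 + depth n * 6 + 22)%N.

Variables (kappa D : R) (V : seq cmd -> state R -> R) (rest : seq cmd).
Hypothesis HV : supersolution kappa D V.
Variables (f : labelling n) (s : state R) (X : 'I_m -> R).
Hypotheses (go : graph_ok G s) (par : parents_ok s) (so : sets_ok f s).
Hypothesis w_gt0 : 0 < \sum_(e in live G f) w e.
Hypothesis sampled : forall e s', e \in live G f ->
  frame [:: 13; 14; 15; 16; 17; 18] [:: 3] s s' -> leaves_ok (contract G f e) s' ->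
  int_mem s' 18 0 = e ->
  (exists a b : 'I_n, [/\ int_mem s' 16 0 = a, int_mem s' 17 0 = b,
     is_root s' a /\ is_root s' b, f a = f (src G e) & f b = f (dst G e)]) ->
  V rest s' <= kappa * (trial_cost * supply s')%:R + X e.

Local Notation E := (\sum_e dpick (live G f) w e * X e).

Lemma sum_leaves s' (F : nat -> R) : leaves_ok f s' ->
  \sum_(l < M) leaf s' l * F l = \sum_(e < m) leaf s' e * F e.
Proof.
move=> [_ z _]; rewrite -!(big_mkord xpredT (fun l => leaf s' l * F l)).
rewrite (@big_cat_nat _ _ _ m) //= [X in _ + X]big_nat [X in _ + X]big1 ?addr0 // => l lm.
by rewrite z // mul0r.
Qed.

(** Live leaves keep their weights through rejections, so the accepted edge has the law [dpick]
    whatever was rejected before. Accordingly the bound reproduces itself: a rejected draw leads to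
    a smaller supply with the same [E]. *)
Lemma sample_edge_spec : leaves_ok f s -> V (sample_edge :: rest) s <=
  kappa * (trial_cost * supply s + 2)%:R + E.
Proof.
move=> lo; rewrite addnC addSn add1n; apply: (V_seq HV); apply: (V_iset HV) => /=.
set W := While _ _.
have [k0 _ _] := HV.
suff main k : forall s', (supply s' < k)%N -> frame [:: 13; 14; 15; 16; 17; 18] [:: 3] s s' ->
    leaves_ok f s' -> int_mem s' 13 0 = 0%N ->
    V (W :: rest) s' <= kappa * (trial_cost * supply s')%:R + E.
  apply: (main (supply s).+1) => //; first by framing.
elim: k => // k IH s' sk fr lo' a0; have [tok zs lv] := lo'.
have liveM e : (e < m)%N -> (e < M)%N by move/leq_trans; apply.
have lf0 (e : 'I_m) : 0 <= leaf s' e by case: tok => _ _; apply; apply: liveM.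
have WT : \sum_(e in live G f) w e <= \sum_(e < m) leaf s' e.
  rewrite [leRHS](bigID [in live G f]) /= -[leLHS]addr0 lerD ?sumr_ge0 //.
  by apply: ler_sum => e el; rewrite lv.
have T0 : 0 < \sum_(e < m) leaf s' e by apply: lt_le_trans WT.
have TE : real_mem s' 3 1 = \sum_(e < m) leaf s' e.
  rewrite (tree_total tok); have := sum_leaves (fun=> 1) lo'.
  by under eq_bigr do rewrite mulr1; under [in RHS]eq_bigr do rewrite mulr1.
have S0 : (0 < supply s')%N.
  rewrite lt0n; apply: contraTneq T0 => S0; rewrite -leNgt; apply: sumr_le0 => e _.
  have : (((0 < leaf s' e)%R : bool) <= supply s')%N by rewrite /supply (bigD1 e) //= leq_addr.
  by rewrite S0 leqn0 eqb0 -leNgt.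
(* Value after drawing leaf [l]: [X e] if the edge is live, and the bound [E] by induction if it is
   rejected. *)
pose Y l := kappa * (h * 5 + depth n * 6 + 17 + trial_cost * (supply s').-1)%:R +
  (if insub l is Some e then if e \in live G f then X e else E else 0).
have step : V (W :: rest) s' <= kappa * (h * 4 + 3).+2%:R +
    (\sum_(l < M) real_mem s' 3 (M + l)%N * Y l) / \sum_(l < M) real_mem s' 3 (M + l)%N.
  apply: (V_loop HV); first by rewrite /= a0.
  apply: (V_seq HV); apply: (descend_spec HV) => //; first by rewrite TE.
  move=> l s1 lM l0 fr1 s1l.
  have lm : (l < m)%N.
    by rewrite ltnNge; apply: contraTN l0 => ml; rewrite -[real_mem _ _ _]/(leaf s' l) zs ?ltxx // ml.
  pose e := Ordinal lm.
  rewrite /Y; case: insubP => [e' _ e'l|]; last by rewrite lm.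
  have {e'l}-> : e' = e by apply: val_inj.
  set XX := if _ then _ else _.
  have [par1 par2] := par.
  have fr' : frame [:: 13; 14; 15; 16; 17; 18] [:: 3] s s1.
    by apply: frame_trans fr (frame_sub fr1 _ _).
  rewrite (_ : (_ + trial_cost * _ = (h * 5 + 3 + (depth n * 3 + 3 + (depth n * 3 + 3 + (2 + trial_cost * (supply s').-1).+1).+1).+1).+3)%N); last by lia.
  apply: (V_seq HV); apply: (V_iset HV); apply: (V_seq HV).
  rewrite /= s1l (proj1 fr' 7) // par1 addKn.
  set s2 := set_int _ _ _ _.
  have fr2 : frame [:: 13; 14; 15; 16; 17; 18] [:: 3] s s2 by rewrite /s2; framing.
  have tok2 : tree_ok h s2.
    by case: tok => t1 t2 t3; split; rewrite /s2 /sums /= /upd /= ?(proj1 fr1) ?(proj2 fr1).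
  apply: (V_tri HV) (clear_leaf_tri tok2 lM s1l _) _.
    by move=> k' kM; rewrite (proj1 fr2) // par2.
  move=> s3 [fr3 tok3 lf3].
  have lf3' l' : (l' < M)%N -> leaf s3 l' = if l' == e :> nat then 0 else leaf s' l'.
    by move=> l'M; rewrite /leaf lf3 // /s2 /= (proj2 fr1).
  have fr03 : frame [:: 13; 14; 15; 16; 17; 18] [:: 3] s s3.
    by apply: frame_trans fr2 (frame_sub fr3 _ _).
  have sup3 : supply s' = (supply s3).+1 by apply: supply_clear lf3'.
  have so3 : sets_ok f s3 by apply: sets_ok_frame so; rewrite (proj1 fr03).
  have e3 : int_mem s3 18 0 = e by rewrite (proj1 fr3) // /s2 /= /upd /=.
  apply: (V_seq HV); apply: (V_tri HV).
    apply: (find_root_tri (v := src G e) so3) => //=.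
    by rewrite e3 (proj1 fr03) // (go_src go).
  move=> s4 [fr4 [a [a16 ra fa]]].
  have so4 : sets_ok f s4 by apply: sets_ok_frame so3; rewrite (proj1 fr4).
  apply: (V_seq HV); apply: (V_tri HV).
    apply: (find_root_tri (v := dst G e) so4) => //=.
    by rewrite (proj1 fr4 18) // e3 (proj1 fr4) // (proj1 fr03) // (go_dst go).
  move=> s5 [fr5 [b [b17 rb fb]]].
  have a5 : int_mem s5 16 0 = a by rewrite (proj1 fr5).
  have fr35 : frame [:: 16; 17] [::] s3 s5.
    by apply: frame_trans (frame_sub fr4 _ _) (frame_sub fr5 _ _).
  have fr05 : frame [:: 13; 14; 15; 16; 17; 18] [:: 3] s s5.
    by apply: frame_trans fr03 (frame_sub fr35 _ _).
  have ra5 : is_root s5 a by rewrite /is_root (proj1 fr35).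
  have rb5 : is_root s5 b by move: rb; rewrite /is_root (proj1 fr5).
  have abl : (a == b) = (e \notin live G f).
    rewrite inE negbK -fa -fb; apply/eqP/eqP => [->//|].
    by apply: (so_root (so4)); rewrite /is_root ?(proj1 fr4) //; move: ra rb; rewrite /is_root ?(proj1 fr4).
  have sup5 : supply s5 = (supply s').-1.
    by rewrite sup3; apply: eq_bigr => i _; rewrite /leaf (proj2 fr35).
  have tok5 : tree_ok h s5.
    by case: tok3 => t1 t2 t3; split; rewrite /sums ?(proj1 fr35) ?(proj2 fr35).
  have lf5 l' : (l' < M)%N -> leaf s5 l' = if l' == e :> nat then 0 else leaf s' l'.
    by move=> l'M; rewrite /leaf (proj2 fr35) // -lf3'.
  have z5 l' : (m <= l' < M)%N -> leaf s5 l' = 0.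
    by move=> l'm; rewrite lf5; [case: eqP => // _; exact: zs | case/andP: l'm].
  apply: (V_if HV) => /=; rewrite a5 b17 -eqn_leq -[(_ == _ :> nat)]/(a == b) abl => el.
    apply: (V_skip HV); apply: (V_weaken HV) (leqnSn _); rewrite -sup5 /XX (negbTE el).
    apply: (IH s5) => //; first by rewrite sup5 -ltnS prednK.
    - split=> // e'' e'l; rewrite lf5; last exact: liveM.
      by rewrite ifN ?lv //; apply: contraNneq el => /val_inj <-.
    - by rewrite (proj1 fr35) // (proj1 fr3) // /s2 /= /upd /= (proj1 fr1).
  move: el; rewrite negbK => el; rewrite /XX el.
  apply: (V_iset HV); apply: (V_exit HV); rewrite //= -sup5.
  set s6 := set_int _ _ _ _.
  have -> : supply s5 = supply s6 by [].
  apply: sampled => //.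
  - by rewrite /s6; framing.
  - split=> // x xl; have [ee|ee] := eqVneq x e.
      move: xl; rewrite inE ee => /eqP[]; apply/eqP.
      by rewrite contractE !inE !eqxx !orbT.
    rewrite -[leaf s6 x]/(leaf s5 x) lf5; last exact: liveM.
    rewrite ifN // lv // inE; apply: contraTN xl; rewrite inE negbK => /eqP ff.
    by apply/eqP; rewrite !ffunE ff.
  - by rewrite /s6 /= /upd /= (proj1 fr35).
  - by exists a, b; split; rewrite /s6 //= /upd /=.
apply: le_trans step _.
have TM : \sum_(l < M) real_mem s' 3 (M + l)%N = \sum_(e < m) leaf s' e by rewrite -(tree_total tok).
rewrite (sum_leaves Y lo') TM.
set c := kappa * (h * 5 + depth n * 6 + 17 + trial_cost * (supply s').-1)%:R.
(* The live leaves contribute their total times [E] by definition of [dpick], the others their total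
   times [E] by induction, so the average is again [E]. *)
have -> : \sum_(e < m) leaf s' e * Y e = (c + E) * \sum_(e < m) leaf s' e.
  transitivity (\sum_(e < m) leaf s' e * (c + if e \in live G f then X e else E)).
    by apply: eq_bigr => e _; rewrite /Y valK.
  under eq_bigr do rewrite mulrDr; rewrite big_split /= -mulr_suml mulrC mulrDl; congr (_ + _).
  have lw : \sum_(e in live G f) leaf s' e = \sum_(e in live G f) w e by apply: eq_bigr => e /lv.
  set E0 := \sum_e dpick _ _ _ * _.
  rewrite (bigID [in live G f]) /= [in RHS](bigID [in live G f]) /= mulrDr; congr (_ + _).
    rewrite /E0 sum_dpick lw mulfVK ?gt_eqF //.
    by apply: eq_bigr => e el; rewrite el lv.
  by rewrite mulr_sumr; apply: eq_bigr => e /negbTE ->; rewrite mulrC.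
rewrite mulfK ?gt_eqF // addrA -mulrDr -natrD lerD2r ler_wpM2l // ler_nat.
by rewrite -(prednK S0) mulnS /trial_cost; lia.
Qed.

End Sampling.

(** * Reruns and the main loop of the boosted phase *)

Definition boosted_weight : rexp :=
  RMul (RAdd (RNat (INum 1))
          (RMul (RSub (RGet 0 (INum 0)) (RNat (INum 1))) (RSub (RNat (INum 1)) (RGet 2 (IV 19)))))
    (RGet 1 (IV 19)).

Definition stop_prob : rexp :=
  RSub (RNat (INum 1))
    (RDiv (RAdd (RNat (INum 1))
             (RMul (RSub (RGet 0 (INum 0)) (RNat (INum 1))) (RGet 0 (INum 1))))
       (RSub (RDiv (RMul (RGet 0 (INum 0)) (RNat (IV 4))) (RNat (INum 2)))
          (RMul (RSub (RGet 0 (INum 0)) (RNat (INum 1)))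
             (RAdd (RGet 0 (INum 2)) (RSub (RNat (INum 1)) (RGet 0 (INum 1))))))).

(** Links are not undone but redone from the discrete partition: the edges recorded in array 12 are
    relinked from level [n] down to the level just above the current one. *)
Definition replay : cmd :=
  iset 21 (IGet 0 (INum 0)) ;;;
  While (ilt (IV 4) (IV 21))
    (find_root 16 (IGet 1 (IGet 12 (IV 21))) ;;;
     find_root 17 (IGet 2 (IGet 12 (IV 21))) ;;;
     link ;;;
     iset 21 (ISub (IV 21) (INum 1))).

Definition restart : cmd := reset_sets ;;; build_tree boosted_weight ;;; replay.

(* Cells 4, 5 and 6 play the role of 32, 33 and 34 in inner_loop.  The best cut
   is kept in array 3, its weight in real cell 8; cell 41 tells whether it exists. *)
Definition outer_loop : cmd :=
  While (ILe (INum 1) (IV 6))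
    (If (ILe (INum 1) (IV 5))
       (If (ilt (IGet 0 (INum 2)) (IV 4))
          (sample_edge ;;; ISet 12 (IV 4) (IV 18) ;;; link ;;; iset 4 (ISub (IV 4) (INum 1)))
          (inner_phase ;;; iset 5 (INum 0)))
       (If (ILe (IGet 0 (INum 0)) (IV 4))
          (iset 6 (INum 0))
          (iset 4 (IAdd (IV 4) (INum 1)) ;;;
           Flip 15 (INum 0) stop_prob ;;;
           If (ILe (INum 1) (IV 15)) Skip (iset 5 (INum 1) ;;; restart)))).

Section Outer.
Variables (R : realType) (n m : nat) (G : wgraph R n m) (p : 'I_m -> R).
Variables (B et rh : R) (t h : nat).
Implicit Types (s : state R) (f : labelling n) (u v : 'I_n) (st fs : seq (labelling n)).
Local Notation M := (2 ^ h)%N.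
Local Notation wB := (boosted_wt G p B).
Local Notation q := (boosted_q B et rh).
Local Notation b := (minn n t).
Hypotheses (mM : (m <= M)%N) (n1 : (1 < n)%N) (t1 : (1 < t)%N).
Hypotheses (p01 : forall e, 0 <= p e <= 1) (adm : admissible n B et rh t).
Hypothesis conn : connected_weights G.

Definition static s := [/\ graph_ok G s, int_mem s 0 2 = t, rows_ok n s, parents_ok h s
  & [/\ real_mem s 0 0 = B, real_mem s 0 1 = et, real_mem s 0 2 = rh
      & forall e : 'I_m, real_mem s 2 e = p e]].

Lemma static_frame Li Lr s s' : frame Li Lr s s' ->
  all (fun a => a \notin [:: 0; 1; 2; 7; 8; 9]%N) Li -> all (fun a => 2 < a)%N Lr ->
  static s -> static s'.
Proof.
move=> [fi fr] /allP hi /allP hr [h1 h2 h3 [h4 h5] [h6 h7 h8 h9]].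
have i a : a \in [:: 0; 1; 2; 7; 8; 9]%N -> int_mem s' a = int_mem s a.
  by move=> a2; apply: fi; apply/negP => /hi; rewrite a2.
have r a : (a <= 2)%N -> real_mem s' a = real_mem s a.
  by move=> a2; apply: fr; apply/negP => /hr; lia.
split; rewrite ?i //.
- by case: h1 => *; split=> *; rewrite ?i ?r.
- by move=> *; rewrite i // h3.
- by split; rewrite i.
- by split=> *; rewrite ?i ?r.
Qed.

Definition spare s := forall l, (m <= l < M)%N -> leaf h s l = 0.

(* Array 12 records the edge contracted at every level. *)
Fixpoint chain s st := match st with
  | [::] => True
  | f :: fs => match fs with
    | [::] => f = [ffun v => v]
    | g :: _ => (exists e : 'I_m, [/\ int_mem s 12 (level n fs) = e, e \in live G g
                   & f = contract G g e]) /\ chain s fs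
    end
  end.

Lemma chain_tail s f fs : chain s (f :: fs) -> chain s fs.
Proof. by case: fs => [//|g fs [_ ]]. Qed.

Lemma chain_frame s s' st : int_mem s' 12 = int_mem s 12 -> chain s st -> chain s' st.
Proof.
move=> e12; elim: st => // f [//|g fs] IH [[e [h1 h2 h3]] /IH c].
by split=> //; exists e; rewrite e12.
Qed.

(** Only levels strictly above the current one record how the stack arose, so the entry of the
    current level may be overwritten by the next contraction. *)
Lemma chain_above s s' st : (size st <= n)%N ->
  (forall k, (level n st < k)%N -> int_mem s' 12 k = int_mem s 12 k) -> chain s st -> chain s' st.
Proof.
elim: st => // f [//|g fs] IH sn H [[e [h1 h2 h3]] c].
have lt : (level n [:: f, g & fs] < level n (g :: fs))%N.
  by rewrite !level_cons /= in sn *; lia.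
split; first by exists e; rewrite H.
by apply: IH c => [|k kl]; [exact: ltnW|apply: H; apply: ltn_trans kl].
Qed.

Lemma contract_numbering f k pos e : numbering f k pos -> e \in live G f ->
  exists pos', numbering (contract G f e) k.-1 pos'.
Proof.
move=> num; rewrite (live_numbering _ num) inE => ne.
by eexists; apply: (numbering_contract num ne); left.
Qed.

Lemma chain_numbering s f fs : chain s (f :: fs) ->
  exists pos, numbering f (level n (f :: fs)) pos.
Proof.
elim: fs f => [|g fs IH] f; first by move=> -> ; rewrite level_cons subn0; eexists; exact: numbering_id.
move=> [[e [_ el ->]] /IH [pos num]].
have [pos' num'] := contract_numbering num el.
by exists pos'; move: num'; rewrite !level_cons /= subnS.
Qed.

Definition outer_inv st acc s :=
  [/\ static s, spare s, chain s st, int_mem s 6 0 = 1%N & outer_acc G s acc].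

Definition outer_down st acc s :=
  [/\ outer_inv st acc s, int_mem s 5 0 = 1%N, int_mem s 4 0 = level n st
    & if st is f :: _ then sets_ok f s /\ leaves_ok G wB h f s else False].

Definition outer_up fs acc s :=
  [/\ outer_inv fs acc s, int_mem s 5 0 = 0%N & int_mem s 4 0 = (n - size fs)%N].

Definition restart_cost := (n * (depth n * 6 + 30) + m * 6 + M * 5 + 20)%N.

Lemma restart_tri s f fs : static s -> spare s -> chain s (f :: fs) ->
  (size fs < n)%N -> int_mem s 4 0 = level n (f :: fs) ->
  tri restart s restart_cost (fun s' => [/\ frame [:: 10; 11; 14; 16; 17; 19; 21] [:: 3] s s',
    sets_ok f s' & leaves_ok G wB h f s']).
Proof.
move=> sta sp ch fn J; have [go ts rw [par1 par2] [b1 b2 b3 b4]] := sta.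
apply: (@tri_le _ _ _ (n * 7 + 3 + (m * 6 + M * 5 + 9 +
  (1 + (size fs * (depth n * 3 + 3 + (depth n * 3 + 3 + (6 + 1).+1).+1).+3).+1).+1).+1).+1); last first.
  rewrite /restart_cost.
  have : (size fs * (depth n * 6 + 18) <= n * (depth n * 6 + 18))%N by rewrite leq_mul2r ltnW // orbT.
  lia.
apply: tri_seq; apply: tri_weaken; [exact: (reset_sets_tri (go_n go))|exact: leqnn|].
move=> s1 [fr1 so1].
apply: tri_seq; apply: tri_weaken; [apply: (@build_tree_tri _ h s1 m boosted_weight (array 0 wB))|exact: leqnn|] => //.
- by rewrite (proj1 fr1) // (go_m go).
- by rewrite (proj1 fr1).
- by move=> l lm; rewrite (proj2 fr1) //; apply: sp.
- move=> s' k km fr' s'k; rewrite /array insubT /= s'k.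
  rewrite !(proj2 fr' 0) // !(proj2 fr1 0) // (proj2 fr' 2) // (proj2 fr' 1) // (proj2 fr1) // (proj2 fr1) //.
  by rewrite b1 (b4 (Ordinal km)) (go_wt go (Ordinal km)).
- move=> k km; rewrite /array insubT /=.
  exact: le_trans (wt_ge0 _ _) (boosted_wt_ge G p01 adm _).
move=> s2 [fr2 tok2 lf2].
have fr02 : frame [:: 10; 11; 14; 16; 17; 19; 21] [:: 3] s s2.
  by apply: frame_trans (frame_sub fr1 _ _) (frame_sub fr2 _ _).
have lo g s' : frame [:: 10; 11; 16; 17; 21] [::] s2 s' -> leaves_ok G wB h g s'.
  move=> fr; split.
  - by case: tok2 => t2 t3 t4; split; rewrite /sums ?(proj1 fr) ?(proj2 fr).
  - by move=> l /andP[ml lM]; rewrite /leaf (proj2 fr) // lf2 // ltnNge ml.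
  - move=> e _; rewrite /leaf (proj2 fr) // lf2; last exact: leq_trans (ltn_ord e) mM.
    by rewrite ltn_ord /array valK.
apply: tri_seq; apply: tri_iset; rewrite /= (proj1 fr02) // (go_n go).
(* The stack is split at the graph [g] that the union-find structure represents so far; [p0] lists
   the graphs still to be reached. *)
pose I i s' := frame [:: 10; 11; 16; 17; 21] [::] s2 s' /\ exists p0 g gs,
  [/\ f :: fs = p0 ++ g :: gs, size p0 = i, int_mem s' 21 0 = level n (g :: gs) & sets_ok g s'].
apply: (@tri_while _ _ _ I) => [i s' [fr [p0 [g [gs [fE pi s'l so']]]]]|]; last first.
  split; first by framing.
  have fE : f :: fs = belast f fs ++ [:: last f fs] by rewrite cats1 -lastI.
  exists (belast f fs), (last f fs), [::]; split=> //; first exact: size_belast.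
    by rewrite level_cons subn0.
  have -> : last f fs = [ffun v => v].
    by elim: (fs) (f) (ch) => [//|g gs IH] f' [_ c]; exact: IH c.
  by apply: sets_ok_frame so1; [exact: (proj1 fr2 10 isT)|exact: (proj1 fr2 11 isT)].
have fr0 : frame [:: 10; 11; 14; 16; 17; 19; 21] [:: 3] s s'.
  by apply: frame_trans fr02 (frame_sub fr _ _).
have szE : size fs = (size p0 + size gs)%N by have := congr1 size fE; rewrite size_cat /= addnS => -[].
rewrite beval_ilt /= s'l (proj1 fr0) // J !level_cons.
case: (lastP p0) fE pi szE => [|p1 f1] fE pi szE.
  move: szE => /= ->; rewrite ltnn.
  case: fE pi => fg _ _; rewrite fg; split=> //.
  - exact: lo.
rewrite size_rcons in szE pi.
have -> : (n - size fs < n - size gs)%N by lia.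
exists (size p1); first by lia.
have [e [e12 el f1E]] : exists e : 'I_m, [/\ int_mem s 12 (level n (g :: gs)) = e,
    e \in live G g & f1 = contract G g e].
  have : chain s (f1 :: g :: gs).
    move: ch; rewrite fE cat_rcons; elim: (p1) => [//|x p2 IH] c.
    by apply: IH; exact: chain_tail c.
  by case.
have so3 : sets_ok g s' by [].
apply: tri_seq; apply: tri_weaken; [apply: (find_root_tri (v := src G e) so3) => //=|exact: leqnn|].
  by rewrite s'l (proj1 fr0 12) // e12 (proj1 fr0) // (go_src go).
move=> s4 [fr4 [a [a16 ra fa]]].
have so4 : sets_ok g s4 by apply: sets_ok_frame so3; rewrite (proj1 fr4).
apply: tri_seq; apply: tri_weaken; [apply: (find_root_tri (v := dst G e) so4) => //=|exact: leqnn|].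
  by rewrite (proj1 fr4 21) // s'l (proj1 fr4 12) // (proj1 fr0 12) // e12 (proj1 fr4) // (proj1 fr0) // (go_dst go).
move=> s5 [fr5 [c [c17 rc fc]]].
have so5 : sets_ok g s5 by apply: sets_ok_frame so4; rewrite (proj1 fr5).
apply: tri_seq; apply: tri_weaken; [apply: (link_tri (a := a) (b := c) so5 el) => //|exact: leqnn|].
- by rewrite (proj1 fr5).
- by move: ra; rewrite /is_root (proj1 fr5) // (proj1 fr4).
- by move: rc; rewrite /is_root (proj1 fr5).
move=> s6 [fr6 so6]; apply: tri_iset => /=.
have fr46 : frame [:: 10; 11; 16; 17; 21] [::] s' s6.
  apply: frame_trans (frame_sub fr4 _ _) _ => //.
  by apply: frame_trans (frame_sub fr5 _ _) (frame_sub fr6 _ _).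
have frs2 : frame [:: 10; 11; 16; 17; 21] [::] s2 s6 by apply: frame_trans fr46.
split; first by framing.
exists p1, f1, (g :: gs); split=> //; first by rewrite fE cat_rcons.
- by rewrite /upd /= (proj1 fr6) // (proj1 fr5) // (proj1 fr4) // s'l !level_cons /= subn1 subnS.
- by rewrite f1E; case: so6.
Qed.

Lemma live_boosted_gt0 s f fs : chain s (f :: fs) -> (1 < level n (f :: fs))%N ->
  0 < \sum_(e in live G f) wB e.
Proof.
move=> /chain_numbering [pos num] k1.
apply: lt_le_trans (weight_live_gt0 conn num k1) _.
by apply: ler_sum => e _; apply: boosted_wt_ge p01 adm _.
Qed.

Section OuterLoop.
Variables (kappa D : R) (V : seq cmd -> state R -> R) (rest : seq cmd) (X : {set 'I_m} -> R).
Hypothesis HV : supersolution kappa D V.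
Hypothesis doneX : forall C s, static s -> outer_acc G s (Some C) -> V rest s <= X C.

Let k0 : 0 <= kappa. Proof. by case: HV. Qed.

Local Notation supply := (supply m h).
Local Notation trial := (trial_cost n h).

(** The potential sets aside the cost of a trial for each nonzero leaf. A contraction then has
    constant cost, however many draws it rejects. *)
Definition outer_v s := V (outer_loop :: rest) s - kappa * (trial * supply s)%:R.

Lemma outer_v_le s (Y : R) : outer_v s <= Y ->
  V (outer_loop :: rest) s <= kappa * (trial * supply s)%:R + Y.
Proof. by rewrite /outer_v lerBlDr [leRHS]addrC. Qed.

Lemma outer_contract_step f fs acc s (Y : 'I_m -> R) : (b < level n (f :: fs))%N ->
  outer_down (f :: fs) acc s ->
  (forall e s', e \in live G f -> outer_down [:: contract G f e, f & fs] acc s' ->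
     outer_v s' <= Y e) ->
  outer_v s <= kappa * 20%:R + \sum_e dpick (live G f) wB e * Y e.
Proof.
move=> bl [[sta sp ch run oa] md J [so lo]] HY.
have [go ts rw par [b1 b2 b3 b4]] := sta.
have ln : (level n (f :: fs) <= n)%N by rewrite level_cons leq_subr.
have tl : (t < level n (f :: fs))%N by move: bl ln; rewrite gtn_min; case: ltnP => //= ?; lia.
have l1 : (1 < level n (f :: fs))%N by apply: ltn_trans tl.
rewrite /outer_v lerBlDr.
pose Y' e := kappa * 10%:R + Y e.
have H : V (outer_loop :: rest) s <= kappa * (trial * supply s + 2).+4%:R +
    \sum_e dpick (live G f) wB e * Y' e.
  apply: (V_loop HV); first by rewrite /= run.
  apply: (V_if HV); last by rewrite /= md.
  move=> _; apply: (V_if HV); last by rewrite beval_ilt /= ts J tl.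
  move=> _; apply: (V_seq HV).
  apply: (sample_edge_spec mM HV go par so (live_boosted_gt0 ch l1) _ lo).
  move=> e s1 el fr1 lo1 e18 [x [y [x16 y17 [rx ry] fx fy]]].
  rewrite /Y' addrA [_ + kappa * 10%:R]addrC -addrA.
  apply: (V_seq HV); apply: (V_iset HV); apply: (V_seq HV).
  rewrite /= (proj1 fr1 4) // J e18; set s2 := set_int _ _ _ _.
  have so2 : sets_ok f s2.
    by apply: sets_ok_frame so; [exact: (proj1 fr1 10 isT)|exact: (proj1 fr1 11 isT)].
  rewrite (_ : 7 = (6 + 1)%N%:R :> R) //; apply: (V_tri HV) (link_tri (a := x) (b := y) so2 el _ _ _ _ fx fy) _ => //.
  move=> s3 [fr3 so3]; apply: (V_iset HV); rewrite mulr0 add0r /= (proj1 fr3) //.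
  rewrite {1}/s2 /= /upd /= (proj1 fr1 4) // J.
  set s4 := set_int _ _ _ _.
  have frs : frame [:: 4; 10; 11; 12; 13; 14; 15; 16; 17; 18] [:: 3] s s4.
    apply: frame_set_int => //; apply: frame_trans (_ : frame _ _ s s2) (frame_sub fr3 _ _) => //.
    by apply: frame_set_int => //; apply: frame_sub fr1 _ _.
  have r3 : real_mem s4 3 = real_mem s1 3 by exact: (proj2 fr3 3 isT).
  have -> : supply s1 = supply s4 by rewrite /supply /leaf r3.
  apply: outer_v_le; apply: HY => //; split.
  - split.
    + exact: static_frame frs _ _ sta.
    + by move=> l lm; rewrite /leaf r3; case: lo1 => _ + _; apply.
    + have e12 : int_mem s4 12 = int_mem s2 12 by exact: (proj1 fr3 12 isT).
      split; first by exists e; rewrite e12 /s2 /= /upd /= eqxx.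
      apply: chain_above ch => [|k lk]; first by rewrite level_cons in l1; rewrite /=; lia.
      by rewrite e12 /s2 /= /upd /= gtn_eqF // (proj1 fr1).
    + by rewrite (proj1 frs).
    + exact: (outer_acc_frame frs).
  - by rewrite (proj1 frs).
  - by rewrite (level_push _ bl) -subn1.
  split; first by case: so3.
  case: lo1 => [[z1 z2 z3] z4 z5]; split=> [|l lm|e' el'].
  + split; [by rewrite (proj1 frs) //; case: par|by move=> i iM; rewrite r3 z2|].
    by move=> l lM; rewrite r3 z3.
  + by rewrite /leaf r3; apply: z4.
  + by rewrite /leaf r3; apply: z5.
apply: le_trans H _.
have -> : \sum_e dpick (live G f) wB e * Y' e = kappa * 10%:R * \sum_e dpick (live G f) wB e +
    \sum_e dpick (live G f) wB e * Y e.
  by rewrite mulr_sumr -big_split /=; apply: eq_bigr => e _; rewrite /Y'; ring.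
have : kappa * 10%:R * \sum_e dpick (live G f) wB e <= kappa * 10%:R * 1.
  by rewrite ler_wpM2l ?mulr_ge0 // sum_dpick_le1.
rewrite (_ : (trial * supply s + 2).+4%:R = (trial * supply s)%:R + 6%:R :> R); last first.
  by rewrite -natrD -addn4 -addnA.
move: k0; set S1 := \sum_e dpick _ _ _; set S2 := \sum_e _ * _; lra.
Qed.

Variable tI : nat -> R.
Hypotheses (tI_ge0 : forall k, 0 <= tI k) (tI_base : 20%:R <= tI 2).
Hypothesis tI_step : forall k, (2 < k <= b)%N ->
  (k * 32 + (70 + 13))%:R + tI k.-1 + 12%:R + (1 - (1 - 2 / k%:R)) * (0 + tI k) <= tI k.

Definition leaf_cost : R :=
  (n * (depth n * 3 + 18) + b * (b * 5 + 26) + m * 26 + 80)%:R + tI b.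

Lemma outer_leaf_step f fs acc s (Y : {set 'I_m} -> R) : level n (f :: fs) = b ->
  outer_down (f :: fs) acc s ->
  (forall C s', outer_up fs (acc_join G acc C) s' -> outer_v s' <= Y C) ->
  outer_v s <= kappa * leaf_cost + mean (fpz_law G b f) Y.
Proof.
move=> lb [[sta sp ch run oa] md J [so lo]] HY.
have [go ts rw par _] := sta.
have b2 : (1 < b <= n)%N by rewrite leq_min n1 t1 geq_minl.
rewrite /outer_v lerBlDr; set kc := kappa * (trial * supply s)%:R.
pose Y' C := Y C + (kappa * 2%:R + kc).
have num : exists pos, numbering f b pos by rewrite -lb; apply: chain_numbering ch.
have [mu1 _ _] := fpz_law_branching G (proj1 (andP b2)).
have sp1 : subprob (fpz_law G b f) by apply: mu1; case/andP: b2 => ->; rewrite leqnn.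
have H : V (outer_loop :: rest) s <= kappa * 4%:R +
    (kappa * ((n * (depth n * 3 + 18) + b * (b * 5 + 26) + m * 26 + 73)%:R + tI b) +
     mean (fpz_law G b f) Y').
  apply: (V_loop HV); first by rewrite /= run.
  apply: (V_if HV); last by rewrite /= md.
  move=> _; apply: (V_if HV) => [|_]; first by rewrite beval_ilt /= ts J lb ltnNge geq_minr.
  apply: (V_seq HV); rewrite mulr0 add0r.
  rewrite lb in J.
  apply: (inner_phase_spec HV b2 conn tI_ge0 tI_base tI_step go rw so num J oa).
  move=> C s1 fr1 oa1; rewrite /Y' addrC -addrA.
  apply: (V_iset HV) => /=; apply: (V_done HV).
  set s2 := set_int _ _ _ _.
  have fr2 : frame ([:: 3; 5; 15; 16; 17; 19; 20] ++ iota 22 21)%N [:: 4; 5; 6; 7; 8; 9] s s2.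
    by apply: frame_set_int => //; apply: frame_sub fr1 _ _.
  have r3 : real_mem s2 3 = real_mem s 3 by exact: (proj2 fr1 3 isT).
  rewrite /kc (_ : supply s = supply s2); last by rewrite /supply /leaf r3.
  apply: outer_v_le; apply: HY; split=> //.
    split.
    - exact: static_frame fr2 _ _ sta.
    - by move=> l lm; rewrite /leaf r3; apply: sp.
    - by apply: chain_frame (chain_tail ch); exact: (proj1 fr1 12 isT).
    - by rewrite (proj1 fr2).
    - by case: (acc_join G acc C) oa1.
  rewrite /s2 /= /upd /= (proj1 fr1 4) // J -lb level_cons.
  by [].
apply: le_trans H _.
have c0 : 0 <= kappa * 2%:R + kc by rewrite addr_ge0 // mulr_ge0.
have := mean_addr_le Y sp1 c0; rewrite -/(Y' _) /leaf_cost.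
set M1 := mean _ _; set M2 := mean _ _ => M12.
rewrite (_ : (n * (depth n * 3 + 18) + b * (b * 5 + 26) + m * 26 + 80)%N =
  (n * (depth n * 3 + 18) + b * (b * 5 + 26) + m * 26 + 73 + 7)%N); last by rewrite -!addnA.
set Q := (_ + 73)%N; rewrite (natrD _ Q 7); move: k0; lra.
Qed.

(** A rerun refills the tree and therefore has to provide the potential of up to [m] nonzero leaves
    again. *)
Definition redo_cost : R := (restart_cost + trial * m)%:R.

Lemma outer_up_step f fs acc s (Y Z : R) : (b < level n (f :: fs) <= n)%N ->
  outer_up (f :: fs) acc s ->
  (forall s', outer_up fs acc s' -> outer_v s' <= Y) ->
  (forall s', outer_down (f :: fs) acc s' -> outer_v s' <= Z) ->
  outer_v s <= kappa * 15%:R + (q (level n (f :: fs)) * Y +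
    (1 - q (level n (f :: fs))) * (kappa * redo_cost + Z)).
Proof.
move=> /andP[bl ln] [[sta sp ch run oa] md J] HY HZ.
have [go ts rw par [B0 e0 r0 _]] := sta.
set k := level n (f :: fs) in bl ln *.
have kE : k = (n - size fs)%N by rewrite /k level_cons.
have tl : (t < k)%N by move: bl ln; rewrite gtn_min; case: ltnP => //= ?; lia.
have J1 : ((n - size (f :: fs)) + 1 = k)%N by rewrite kE /=; move: tl; rewrite kE; lia.
have qk : 0 <= q k <= 1 by case: adm => _; apply; rewrite tl.
set kc := kappa * (trial * supply s)%:R.
have kc0 : 0 <= kc by rewrite mulr_ge0.
rewrite /outer_v lerBlDr -/kc.
have H : V (outer_loop :: rest) s <= kappa * 10%:R +
    (q k * (Y + kc) + (1 - q k) * (kappa * redo_cost + Z + kc)).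
  apply: (V_loop HV); first by rewrite /= run.
  apply: (V_if HV); first by rewrite /= md.
  move=> _; apply: (V_if HV).
    by rewrite /= J (go_n go) => h1; move: tl t1; rewrite kE /= in h1 *; lia.
  move=> _; apply: (V_seq HV); apply: (V_iset HV); apply: (V_seq HV); rewrite /= J J1.
  set s1 := set_int _ _ _ _.
  have stq : reval s1 stop_prob = q k by rewrite /= /upd /= B0 e0 r0.
  have fr1 : frame [:: 4; 15] [::] s s1 by rewrite /s1; framing.
  apply: (V_flip HV stq qk) => _; set s2 := set_int _ _ _ _.
    have fr2 : frame [:: 4; 15] [::] s s2 by rewrite /s2; framing.
    apply: (V_if HV); last by rewrite /= /upd /=.
    move=> _; apply: (V_skip HV); apply: (V_done HV).
    rewrite addrC (_ : kc = kappa * (trial * supply s2)%:R) //.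
    apply: outer_v_le; apply: HY; split.
    - split.
      + exact: static_frame fr2 _ _ sta.
      + exact: sp.
      + exact: chain_frame (chain_tail ch).
      + by [].
      + by case: (acc) oa.
    - by [].
    - by rewrite -kE.
  have fr2 : frame [:: 4; 15] [::] s s2 by rewrite /s2; framing.
  apply: (V_if HV); first by rewrite /= /upd /=.
  move=> _; apply: (V_seq HV); apply: (V_iset HV); apply: (V_done HV) => /=.
  set s3 := set_int s2 _ _ _.
  have fr3 : frame [:: 4; 5; 15] [::] s s3 by rewrite /s3; framing.
  have sta3 : static s3 by exact: static_frame fr3 _ _ sta.
  have sp3 : spare s3 by exact: sp.
  have ch3 : chain s3 (f :: fs) by exact: chain_frame ch.
  have J3 : int_mem s3 4 0 = level n (f :: fs) by [].
  have fn : (size fs < n)%N by move: tl; rewrite kE; lia.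
  rewrite /redo_cost natrD mulrDr -!addrA.
  apply: (restart_tri sta3 sp3 ch3 fn J3 HV) => s4 [fr4 so4 lo4].
  have sm : kappa * (trial * supply s4)%:R <= kappa * (trial * m)%:R.
    by rewrite ler_wpM2l // ler_nat leq_mul2l supply_le orbT.
  apply: (@le_trans _ _ (kappa * (trial * supply s4)%:R + Z)); last by lra.
  have fr : frame [:: 4; 5; 10; 11; 14; 15; 16; 17; 19; 21] [:: 3] s s4.
    by apply: frame_trans (frame_sub fr3 _ _) (frame_sub fr4 _ _).
  apply: outer_v_le; apply: HZ; split=> //; last 2 first.
  - by rewrite (proj1 fr4).
  - by rewrite (proj1 fr4).
  split.
  - exact: static_frame fr _ _ sta.
  - by case: lo4.
  - by apply: chain_frame ch; exact: (proj1 fr 12 isT).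
  - by rewrite (proj1 fr).
  - exact: outer_acc_frame fr _ _ _ oa.
apply: le_trans H _; case/andP: qk => q0 q1.
by move: k0 kc0; lra.
Qed.

Lemma outer_exit_step acc s : outer_up [::] acc s ->
  outer_v s <= kappa * 5%:R + if acc is Some C then X C else D.
Proof.
move=> [[sta sp ch run oa] md J]; have [go ts rw par _] := sta.
rewrite /outer_v lerBlDr -addrA.
apply: (V_loop HV); first by rewrite /= run.
apply: (V_if HV); first by rewrite /= md.
move=> _; apply: (V_if HV); last by rewrite /= J (go_n go) subn0 leqnn.
move=> _; apply: (V_iset HV); apply: (V_exit HV) => //=; apply: (V_done HV).
set s1 := set_int s 6 _ _.
have fr1 : frame [:: 6] [::] s s1 by rewrite /s1; framing.
have kc0 : 0 <= kappa * (trial * supply s)%:R by rewrite mulr_ge0.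
apply: (@le_trans _ _ (if acc is Some C then X C else D)); last by rewrite lerDl.
case: acc oa => [C|] oa; last by case: HV.
apply: doneX; first exact: static_frame fr1 _ _ sta.
exact: oa.
Qed.

Variables (q0 : R) (tO : nat -> R).
Hypotheses (q0P : 0 < q0 <= 1) (qP : forall k, (b < k <= n)%N -> q0 <= q k <= 1).
Hypotheses (tO_ge0 : forall k, 0 <= tO k) (tO_base : leaf_cost <= tO b).
Hypothesis tO_step : forall k, (b < k <= n)%N ->
  20%:R + tO k.-1 + 15%:R + (1 - q k) * (redo_cost + tO k) <= tO k.

Lemma outer_loop_spec s : outer_down [:: [ffun v => v]] None s ->
  V (outer_loop :: rest) s <= kappa * ((trial * m)%:R + tO n + 5%:R) +
    mean (bfpz_law G p B et rh t n [ffun v => v]) X.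
Proof.
move=> ds.
pose F acc : R := kappa * 5%:R + if acc is Some C then X C else D.
have b1 : (1 < b)%N by rewrite leq_min n1 t1.
have muP := bfpz_law_branching G p01 adm erefl b1.
have [mu1 _ _] := muP.
have sp : subprob (bfpz_law G p B et rh t n [ffun v => v]) by apply: mu1; rewrite geq_minl leqnn.
have w0 e : 0 <= wB e by apply: le_trans (wt_ge0 _ _) (boosted_wt_ge G p01 adm _).
have := @control_bound R n m G wB q b n (fpz_law G b) (bfpz_law G p B et rh t) muP (geq_minl _ _)
  q0 q0P qP _ outer_v outer_down outer_up kappa (fun=> 20%:R) leaf_cost 15%:R redo_cost F k0 _ _
  outer_contract_step outer_leaf_step outer_up_step outer_exit_step
  D _ tO tO_ge0 tO_base tO_step [ffun v => v] None s (`|D| + \sum_C `|X C|) _ _ ds.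
have aX C : `|X C| <= \sum_C `|X C| by rewrite (bigD1 C) //= lerDl sumr_ge0.
have aF acc : - (`|D| + \sum_C `|X C|) <= F acc.
  have k6 : 0 <= kappa * 5%:R by rewrite mulr_ge0.
  rewrite /F; case: acc => [C|].
    by have := aX C; have := lerNnormlW (lexx `|X C|); have := normr_ge0 D; lra.
  have := aX set0; have := normr_ge0 (X set0).
  by have := lerNnormlW (lexx `|D|); lra.
have vD s' : outer_v s' <= D.
  have [_ VD _] := HV; have := VD (outer_loop :: rest) s'; rewrite /outer_v.
  have : 0 <= kappa * (trial * supply s')%:R by rewrite mulr_ge0.
  lra.
move=> /(_ (ler0n _ _) (ler0n _ _) vD _ aF) H.
apply: le_trans (outer_v_le (H _)) _; first by rewrite addr_ge0 ?sumr_ge0.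
rewrite /F /= (_ : mean _ (fun C => kappa * 5%:R + X C) =
  mean (bfpz_law G p B et rh t n [ffun v => v]) (fun C => X C + kappa * 5%:R)); last first.
  by apply: eq_bigr => C _; rewrite addrC.
have c0 : 0 <= kappa * 5%:R by rewrite mulr_ge0.
have := mean_addr_le X sp c0.
have : kappa * (trial * supply s)%:R <= kappa * (trial * m)%:R.
  by rewrite ler_wpM2l // ler_nat leq_mul2l supply_le orbT.
set M1 := mean _ _; set M2 := mean _ _; lra.
Qed.

End OuterLoop.

End Outer.

(** * The complete program, its output law and its expected running time *)

Definition row_table : cmd :=
  For 19 (IAdd (IGet 0 (INum 0)) (IGet 0 (INum 0)))
    (ISet 9 (IAdd (IV 19) (INum 1))
       (IAdd (IGet 9 (IV 19)) (IAdd (IGet 0 (INum 0)) (IGet 0 (INum 0))))).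

Definition boosted_program : cmd :=
  row_table ;;; size_tree ;;; iset 4 (IGet 0 (INum 0)) ;;; iset 5 (INum 1) ;;;
  iset 6 (INum 1) ;;; restart ;;; outer_loop.

Section Program.
Variables (R : realType) (n m : nat) (G : wgraph R n m) (p : 'I_m -> R).
Variables (B et rh : R) (t : nat).
Implicit Types (s : state R).
Local Notation q := (boosted_q B et rh).
Local Notation b := (minn n t).
Hypotheses (n1 : (1 < n)%N) (t1 : (1 < t)%N).
Hypotheses (p01 : forall e, 0 <= p e <= 1) (adm : admissible n B et rh t).
Hypothesis conn : connected_weights G.

Lemma row_table_tri s : int_mem s 0 0 = n -> int_mem s 9 0 = 0%N ->
  tri row_table s (n * 10 + 3) (fun s' => frame [:: 9; 19] [::] s s' /\ rows_ok n s').
Proof.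
move=> ns z.
pose I k s' := [/\ int_mem s' 19 0 = k, frame [:: 9; 19] [::] s s' &
  forall i, (i <= k)%N -> int_mem s' 9 i = (i * (n + n))%N].
apply: (@tri_weaken _ _ _ ((n + n) * (1 + 4) + 3) _ (I (n + n)%N)) => //; last first.
- by move=> s' [_ fr H].
- by rewrite leq_add2r addnn -mul2n mulnAC mulnC.
apply: tri_for => [|k s' _ [xk fr _]|k s' kn [xk fr H]].
- by split=> //=; [framing|case].
- by rewrite /= (proj1 fr) // ns.
apply: tri_iset; rewrite /= /upd /= xk (proj1 fr 0) // ns; split=> //=; first by framing.
move=> i; rewrite /upd /= addn1 leq_eqVlt; case: eqP => [-> _|_ /= ik].
  by rewrite H // mulSn addnC.
exact: H.
Qed.

Lemma edges_gt0 : (0 < m)%N.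
Proof.
pose S := [set Ordinal (ltnW n1)].
have S0 : S != set0 by apply/set0Pn; exists (Ordinal (ltnW n1)); rewrite inE.
have S1 : ~: S != set0 by apply/set0Pn; exists (Ordinal n1); rewrite !inE.
have := conn S0 S1; rewrite /weight; case: (posnP m) => // m0.
by rewrite big1 ?ltxx // => e; have := ltn_ord e; rewrite {2}m0.
Qed.

(** The number of leaves is a power of two below [m + m], so this bounds the height that [size_tree]
    arrives at. *)
Definition tree_height := trunc_log 2 (m + m).

(** Bounds [redo_cost] without reference to the height found at run time: with fewer than [m + m]
    leaves, [m * 6 + M * 5] is at most [m * 16]. *)
Definition redo_steps :=
  (n * (depth n * 6 + 30) + m * 16 + 20 + trial_cost n tree_height * m)%N.

Variables (kappa D : R) (V : seq cmd -> state R -> R) (X : {set 'I_m} -> R).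
Hypothesis HV : supersolution kappa D V.
Hypothesis doneX : forall s, V [::] s <= X (output m s).
Variables (q0 : R) (tI tO : nat -> R).
Hypotheses (tI_ge0 : forall k, 0 <= tI k) (tI_base : 20%:R <= tI 2).
Hypothesis tI_step : forall k, (2 < k <= b)%N ->
  (k * 32 + (70 + 13))%:R + tI k.-1 + 12%:R + (1 - (1 - 2 / k%:R)) * (0 + tI k) <= tI k.
Hypotheses (q0P : 0 < q0 <= 1) (qP : forall k, (b < k <= n)%N -> q0 <= q k <= 1).
Hypotheses (tO_ge0 : forall k, 0 <= tO k) (tO_base : leaf_cost n m t tI <= tO b).
Hypothesis tO_step : forall k, (b < k <= n)%N ->
  20%:R + tO k.-1 + 15%:R + (1 - q k) * (redo_steps%:R + tO k) <= tO k.

Lemma boosted_program_spec : V [:: boosted_program] (input G p B et rh t) <=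
  kappa * ((redo_steps * 2 + n * 10 + m * 20 + 60)%:R + tO n) +
  mean (boosted_fpz G p B et rh t) X.
Proof.
have [k0 _ _] := HV; set s := input _ _ _ _ _ _.
have arrE (T : Type) (x0 : T) k (f : 'I_k -> T) (e : 'I_k) : array x0 f e = f e.
  by rewrite /array valK.
have go : graph_ok G s by split=> //= e; rewrite arrE.
have H : V [:: boosted_program] s <= kappa * (n * 10 + 3 + (m * 20 + 20 + 7).+1).+1%:R +
    (kappa * (redo_steps%:R + (redo_steps%:R + tO n + 5%:R)) + mean (boosted_fpz G p B et rh t) X).
  apply: (V_seq HV); apply: (V_tri HV) (row_table_tri (s := s) erefl erefl) _.
  move=> s1 [fr1 rw1]; have go1 : graph_ok G s1.
    have [fi fr] := fr1.
    by case: go => *; split=> *; rewrite ?fi ?fr.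
  apply: (V_seq HV); apply: (V_tri HV) (size_tree_tri edges_gt0 (go_m go1)) _.
  move=> s2 [h [fr2 h7 /andP[mM Mm] h8]].
  apply: (V_seq HV); apply: (V_iset HV); apply: (V_seq HV); apply: (V_iset HV).
  apply: (V_seq HV); apply: (V_iset HV); apply: (V_seq HV).
  set s3 := set_int _ 6 _ _; rewrite mulr0 add0r.
  have fr12 : frame [:: 7; 8; 9; 19] [::] s s2.
    by apply: frame_trans (frame_sub fr1 _ _) (frame_sub fr2 _ _).
  have fr3 : frame [:: 4; 5; 6; 7; 8; 9; 19] [::] s s3.
    do 3![apply: frame_set_int => //]; exact: frame_sub fr12 _ _.
  have J3 : int_mem s3 4 0 = n by rewrite /s3 /= /upd /= (proj1 fr12).
  have sta3 : static G p B et rh t h s3.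
    split.
    - by have [fi fr] := fr3; case: go => *; split=> *; rewrite ?fi ?fr.
    - by rewrite (proj1 fr3).
    - by move=> i iN; rewrite -[LHS]/(int_mem s2 9 i) (proj1 fr2) // rw1.
    - by split=> [|k kM]; [exact: h7|exact: h8].
    - by split=> [|||e]; rewrite (proj2 fr3) //= arrE.
  have sp3 : spare m h s3 by move=> l lm; rewrite /leaf (proj2 fr3).
  have ch3 : chain G s3 [:: [ffun v => v]] by [].
  have hH : (h <= tree_height)%N.
    by apply: trunc_log_max => //; apply: ltnW.
  have tH : (trial_cost n h * m <= trial_cost n tree_height * m)%N.
    by rewrite leq_mul2r /trial_cost !leq_add2r leq_mul2r hH !orbT.
  have rH : (restart_cost n m h + trial_cost n h * m <= redo_steps)%N.
    by rewrite /redo_steps leq_add // /restart_cost; lia.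
  have lv3 : int_mem s3 4 0 = level n [:: [ffun v => v] : labelling n].
    by rewrite J3 level_cons subn0.
  have rc : kappa * (restart_cost n m h)%:R <= kappa * redo_steps%:R.
    by rewrite ler_wpM2l // ler_nat; apply: leq_trans rH; rewrite leq_addr.
  rewrite mulrDr -addrA.
  apply: le_trans (lerD rc (lexx _)).
  have rt3 := restart_tri mM n1 t1 p01 adm sta3 sp3 ch3 (ltnW n1) lv3.
  apply: (rt3 _ _ _ _ _ HV) => s4 [fr4 so4 lo4].
  have fr : frame [:: 4; 5; 6; 7; 8; 9; 10; 11; 14; 16; 17; 19; 21] [:: 3] s s4.
    by apply: frame_trans (frame_sub fr3 _ _) (frame_sub fr4 _ _).
  have ds : outer_down G p B et rh t h [:: [ffun v => v]] None s4.
    split.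
    - split=> //.
      + exact: static_frame fr4 _ _ sta3.
      + by case: lo4.
      + by rewrite (proj1 fr4).
      + by rewrite /= (proj1 fr).
    - by rewrite (proj1 fr4).
    - by rewrite (proj1 fr4).
    - by [].
  have doneX' C s' : static G p B et rh t h s' -> outer_acc G s' (Some C) -> V [::] s' <= X C.
    by move=> _ [_ _ <-]; apply: doneX.
  have tS k : (b < k <= n)%N ->
      20%:R + tO k.-1 + 15%:R + (1 - q k) * (redo_cost R n m h + tO k) <= tO k.
    move=> kb; apply: le_trans (tO_step kb); rewrite lerD2l ler_wpM2l //.
      by have /andP[_] := qP kb; rewrite subr_ge0.
    by rewrite lerD2r /redo_cost ler_nat.
  have := outer_loop_spec mM n1 t1 p01 adm conn HV doneX' tI_ge0 tI_base tI_step q0P qP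
    tO_ge0 tO_base tS ds.
  move=> /le_trans; apply; rewrite lerD2r ler_wpM2l // !lerD2r ler_nat.
  by apply: leq_trans rH; rewrite leq_addl.
apply: le_trans H _; rewrite addrA lerD2r -mulrDr ler_wpM2l //.
rewrite (_ : (redo_steps * 2 + n * 10 + m * 20 + 60)%N =
  ((n * 10 + 3 + (m * 20 + 20 + 7).+1).+1 + redo_steps + redo_steps + 28)%N); last by lia.
rewrite !natrD; lra.
Qed.

End Program.

Section Execution.
Variables (R : realType) (n m : nat) (G : wgraph R n m) (p : 'I_m -> R).
Variables (B et rh : R) (t : nat).
Local Notation q := (boosted_q B et rh).
Local Notation b := (minn n t).
Hypotheses (n1 : (1 < n)%N) (t1 : (1 < t)%N).
Hypotheses (p01 : forall e, 0 <= p e <= 1) (adm : admissible n B et rh t).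
Hypothesis conn : connected_weights G.
Variables (q0 : R) (tI tO : nat -> R).
Hypotheses (tI_ge0 : forall k, 0 <= tI k) (tI_base : 20%:R <= tI 2).
Hypothesis tI_step : forall k, (2 < k <= b)%N ->
  (k * 32 + (70 + 13))%:R + tI k.-1 + 12%:R + (1 - (1 - 2 / k%:R)) * (0 + tI k) <= tI k.
Hypotheses (q0P : 0 < q0 <= 1) (qP : forall k, (b < k <= n)%N -> q0 <= q k <= 1).
Hypotheses (tO_ge0 : forall k, 0 <= tO k) (tO_base : leaf_cost n m t tI <= tO b).
Hypothesis tO_step : forall k, (b < k <= n)%N ->
  20%:R + tO k.-1 + 15%:R + (1 - q k) * ((redo_steps n m)%:R + tO k) <= tO k.

(** The program bound at [kappa = 0] is applied to [win] with the indicator of [C], and to the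
    negative of [win] with the negated indicator; the two inequalities give the equality. *)
Lemma boosted_program_implements : implements_boosted_fpz boosted_program G p B et rh t.
Proof.
move=> C; set s := input _ _ _ _ _ _; pose Q := fun s : state R => output m s == C.
pose X (C' : {set 'I_m}) : R := (C' == C)%:R.
have mX : mean (boosted_fpz G p B et rh t) X = boosted_fpz G p B et rh t C.
  rewrite /mean (bigD1 C) //= /X eqxx mulr1 big1 ?addr0 // => C' /negbTE ->.
  by rewrite mulr0.
rewrite -[LHS]/(win Q [:: boosted_program] s); apply/eqP; rewrite eq_le; apply/andP; split.
  have := boosted_program_spec (X := X) n1 t1 p01 adm conn (win_supersolution Q) _ tI_ge0 tI_base
    tI_step q0P qP tO_ge0 tO_base tO_step.
  rewrite mul0r add0r mX; apply => s'; by rewrite win_nil.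
have := boosted_program_spec (X := fun C' => - X C') n1 t1 p01 adm conn (win_opp_supersolution Q) _
  tI_ge0 tI_base tI_step q0P qP tO_ge0 tO_base tO_step.
have mN : mean (boosted_fpz G p B et rh t) (fun C' => - X C') = - boosted_fpz G p B et rh t C.
  by rewrite -mX /mean -sumrN; apply: eq_bigr => C' _; rewrite mulrN.
by rewrite mul0r add0r mN lerN2; apply => s'; rewrite win_nil.
Qed.

(** The bound on the truncated expectation does not depend on [N], so it passes to the infinite
    sum. *)
Lemma boosted_program_steps :
  (expected_steps boosted_program (input G p B et rh t) <=
   ((redo_steps n m * 2 + n * 10 + m * 20 + 60)%:R + tO n)%:E)%E.
Proof.
rewrite /expected_steps; apply: lime_le.
  by apply: is_cvg_nneseries => k _ _; rewrite lee_fin subr_ge0 run_prob_le1.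
apply: nearW => N; rewrite sumEFin lee_fin.
have := boosted_program_spec (X := fun=> 0) n1 t1 p01 adm conn (steps_upto_supersolution R N) _
  tI_ge0 tI_base tI_step q0P qP tO_ge0 tO_base tO_step.
rewrite mul1r /mean big1 => [|C _]; last by rewrite mulr0.
rewrite addr0 /steps_upto big_mkord; apply => s'.
by rewrite -/(steps_upto N [::] s') steps_upto_nil.
Qed.

End Execution.
(** * Success probability *)

Section Success.
Variables (R : realType) (n m : nat) (G : wgraph R n m).
Local Notation lab := (labelling n).
Local Notation cut := {set 'I_m}.
Implicit Types (f : lab) (C : cut).

Definition respects (S : {set 'I_n}) f := forall u v, f u = f v -> (u \in S) = (v \in S).

Lemma respects_contract S f e : respects S f -> e \notin crossing G S ->
  respects S (contract G f e).
Proof.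
move=> h; rewrite inE negbK => /eqP eS u v /eqP; rewrite contractE !inE.
case/orP => [/eqP/h //|/andP[/orP hu /orP hv]].
by case: hu => /eqP/h ->; case: hv => /eqP/h ->; rewrite ?eS.
Qed.

Lemma crossing_live S f : respects S f -> crossing G S \subset live G f.
Proof.
move=> h; apply/subsetP => e; rewrite !inE; apply: contraNneq => /h ->.
by rewrite eqxx.
Qed.

(** [S] and its complement are nonempty unions of metavertices, so each of them is one of the only
    two. *)
Lemma live_respects S f pos : S != set0 -> ~: S != set0 -> numbering f 2 pos -> respects S f ->
  live G f = crossing G S.
Proof.
move=> /set0Pn[u uS] /set0Pn[v]; rewrite !inE => vS [b _ eqf] h.
have ne : pos u != pos v by rewrite -eqf; apply: contraNneq vS => /h <-.
have inS x : (x \in S) = (pos x == pos u).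
  rewrite -eqf; apply/idP/eqP => [xS|/h -> //].
  apply/eqP; rewrite eqf; apply: contraTT xS => xu.
  rewrite (h x v) //; apply/eqP; rewrite eqf; have := b x; have := b u; have := b v.
  by move: ne xu; case: (pos x) => [|[|]] //; case: (pos u) => [|[|]] //; case: (pos v) => [|[|]].
apply/setP => e; rewrite !inE !inS eqf; have := b (src G e); have := b (dst G e); have := b u.
by case: (pos u) => [|[|]] //; case: (pos (src G e)) => [|[|]] //; case: (pos (dst G e)) => [|[|]].
Qed.

(* Every metavertex is one side of a cut, and a live edge lies in two of these cuts. *)
Lemma degree_bound Cs f k pos : is_min_cut G Cs -> numbering f k pos -> (1 < k)%N ->
  k%:R * weight G Cs <= 2 * weight G (live G f).
Proof.
move=> /andP[_ /forallP mC] num k1; have [b s eqf] := num.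
pose S (x : 'I_k) := [set u | pos u == x :> nat].
have cx x : weight G Cs <= weight G (crossing G (S x)).
  apply/(implyP (mC _))/existsP; exists (S x); rewrite eqxx andbT; apply/andP; split; apply/set0Pn.
    by have [u ux] := s x (ltn_ord x); exists u; rewrite inE ux.
  have [y yk yx] : exists2 y, (y < k)%N & y != x.
    by exists (x == 0%N :> nat); case: (x : nat) => [|y] //=; apply: ltnW.
  by have [u uy] := s y yk; exists u; rewrite !inE uy.
apply: (@le_trans _ _ (\sum_(x < k) weight G (crossing G (S x)))).
  by rewrite mulr_natl -[k in leLHS]card_ord -sumr_const; apply: ler_sum.
rewrite /weight mulr_sumr (exchange_big_dep xpredT) //=.
rewrite [leRHS]big_mkcond; apply: ler_sum => e _.
rewrite sumr_const (live_numbering G num) inE.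
set a := pos (src G e); set c := pos (dst G e).
rewrite (@eq_card _ _ [pred x : 'I_k | (a == x) != (c == x)]) => [|x]; last first.
  by rewrite [RHS]inE -[LHS]/(e \in crossing G (S x)) !inE.
have [ac|ac] := eqVneq a c => /=.
  by rewrite eq_card0 // => x; rewrite !inE ac eqxx.
rewrite -[leLHS]mulr_natl ler_wpM2r ?wt_ge0 // ler_nat.
rewrite (@eq_card _ _ (pred2 (Ordinal (b (src G e))) (Ordinal (b (dst G e))))); last first.
  move=> x; rewrite !inE -!val_eqE /= -/a -/c [a == _]eq_sym [c == _]eq_sym.
  case: (eqVneq (x : nat) a) => [->|_]; first by rewrite (negbTE ac).
  by case: (_ == c).
by rewrite card2; case: (_ != _).
Qed.

Variables (Cs : cut) (S : {set 'I_n}).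
Hypotheses (minC : is_min_cut G Cs) (SC : Cs = crossing G S).

Definition success (mu : cut -> R) := \sum_(C | is_min_cut G C) mu C.

(* A run reports the lightest of several cuts, so it succeeds as soon as one of them is minimum. *)
Definition reliable (mu : cut -> R) f (g : R) :=
  [/\ \sum_C mu C = 1, forall C, mu C != 0 -> is_cut G C
    & respects S f -> g^-1 <= success mu].

Lemma lighter_cut C D : is_cut G C -> is_cut G D -> is_cut G (lighter G C D).
Proof. by rewrite /lighter; case: ifP. Qed.

Lemma lighter_min C D : is_cut G C -> is_cut G D ->
  is_min_cut G C || is_min_cut G D -> is_min_cut G (lighter G C D).
Proof.
move=> cC cD h; rewrite /is_min_cut lighter_cut //=; apply/forallP => E; apply/implyP => cE.
have ml : weight G (lighter G C D) <= weight G C /\ weight G (lighter G C D) <= weight G D.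
  by rewrite /lighter; case: ifP => //; case: (ltP (weight G D) (weight G C)) => // /ltW.
by case/orP: h => /andP[_ /forallP /(_ E)]; rewrite cE; apply: le_trans; case: ml.
Qed.

Variables (w : 'I_m -> R) (q : nat -> R) (b N : nat) (base : lab -> cut -> R).
Variables (mu : nat -> lab -> cut -> R) (g : nat -> R).
Hypothesis muP : branching_law G w q b N base mu.
Hypotheses (b1 : (1 < b)%N) (w0 : forall e, 0 <= w e).
Hypothesis w_live : forall f k pos, numbering f k pos -> (1 < k)%N -> 0 < \sum_(e in live G f) w e.
Hypothesis q01 : forall k, (b < k <= N)%N -> 0 < q k <= 1.
Hypothesis collision : forall f k pos, numbering f k pos -> (b < k <= N)%N ->
  \sum_(e in Cs) w e <= (1 - q k) * \sum_(e in live G f) w e.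
Hypothesis base_reliable : forall f pos, numbering f b pos -> reliable (base f) f (g b).
Hypothesis g_step : forall k, (b < k <= N)%N -> 0 < g k.-1 /\ g k.-1 + (1 - q k) <= g k.

(** Let [a] be the average success probability of the run after one contraction. Then
    [a + (1 - x) * (1 - a) * P <= P], that is, [1 / P] is at most [x / a + (1 - x)], and the
    collision bound gives [x / a <= g k]. *)
Lemma branching_reliable k f pos : (b <= k <= N)%N -> numbering f k pos ->
  reliable (mu k f) f (g k).
Proof.
have [mu1 mub mus] := muP.
elim: k f pos => [|k IH] f pos kN num; first by case/andP: kN; rewrite leqNgt (ltnW b1).
have [kb|kb] := eqVneq k.+1 b.
  have -> : mu k.+1 f = base f by apply/funext => C; rewrite kb mub.
  by move: num; rewrite kb => num; apply: base_reliable num.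
have bk : (b < k.+1 <= N)%N by case/andP: kN; rewrite leq_eqVlt eq_sym (negbTE kb) /= => -> ->.
have k1 : (1 < k.+1)%N by apply: ltn_trans (proj1 (andP bk)).
have W0 := w_live num k1; set W := \sum_(e in live G f) w e in W0.
have /andP[q0 q1] := q01 bk; set x := q k.+1 in q0 q1.
have IHe e : e \in live G f -> reliable (mu k (contract G f e)) (contract G f e) (g k).
  move=> el; have [pos' num'] := contract_numbering num el; apply: IH num'.
  by move: bk; lia.
have sp : subprob (mu k.+1 f) by apply: mu1.
have nu0 C : 0 <= mu k.+1 f C by case: sp.
have fix_ F : mean (mu k.+1 f) F = \sum_e dpick (live G f) w e * mean (mu k (contract G f e))
    (fun C1 => x * F C1 + (1 - x) * mean (mu k.+1 f) (fun C2 => F (lighter G C1 C2))).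
  by rewrite mus // mean_branch.
have pick F F' : (forall e, e \in live G f -> F e = F' e) ->
    \sum_e dpick (live G f) w e * F e = \sum_e dpick (live G f) w e * F' e.
  by move=> FF; rewrite !sum_dpick; congr (_ / _); apply: eq_bigr => e /FF ->.
have pick1 : \sum_e dpick (live G f) w e = 1.
  under eq_bigr do rewrite -[dpick _ _ _]mulr1.
  by rewrite sum_dpick; under eq_bigr do rewrite mulr1; rewrite divff // gt_eqF.
(* The total mass [T] satisfies [T = x + (1 - x) * T], and [x] is positive. *)
have T1 : \sum_C mu k.+1 f C = 1.
  have := fix_ (fun=> 1); rewrite (pick _ (fun=> x + (1 - x) * mean (mu k.+1 f) (fun=> 1))).
    rewrite -mulr_suml pick1 mul1r mean_1 => e.
    have : x * (\sum_C mu k.+1 f C - 1) = 0 by move: e; set T := \sum_C _; lra.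
    by move/eqP; rewrite mulf_eq0 gt_eqF //= subr_eq0 => /eqP.
  move=> e /IHe[t _ _]; rewrite /mean -mulr_suml t; ring.
(* The mass [M] on sets that are not cuts satisfies [M <= (1 - x) * M]: the contracted run returns
   cuts, and the lighter of two cuts is a cut. *)
have cuts C : mu k.+1 f C != 0 -> is_cut G C.
  apply: contraNT => nC.
  pose F D : R := (~~ is_cut G D)%:R.
  have : mean (mu k.+1 f) F <= (1 - x) * mean (mu k.+1 f) F.
    rewrite {1}fix_ (pick _ (fun e => mean (mu k (contract G f e)) (fun C1 => (1 - x) *
       mean (mu k.+1 f) (fun C2 => F (lighter G C1 C2))))); last first.
      move=> e /IHe[_ c _]; apply: eq_bigr => D _; have [->|/c cD] := eqVneq (mu k (contract G f e) D) 0.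
        by rewrite !mul0r.
      by rewrite {1}/F cD mulr0 add0r.
    have -> : (1 - x) * mean (mu k.+1 f) F =
        \sum_e dpick (live G f) w e * ((1 - x) * mean (mu k.+1 f) F).
      by rewrite -mulr_suml pick1 mul1r.
    apply: ler_sum => e _.
    have [el|el] := boolP (e \in live G f); last by rewrite /dpick (negbTE el) !mul0r.
    rewrite ler_wpM2l ?dpick_ge0 //; have [t c _] := IHe _ el.
    have -> : (1 - x) * mean (mu k.+1 f) F =
        \sum_D mu k (contract G f e) D * ((1 - x) * mean (mu k.+1 f) F).
      by rewrite -mulr_suml t mul1r.
    apply: ler_sum => D _.
    have sp' : subprob (mu k (contract G f e)) by apply: mu1; move: bk; lia.
    have [->|/c cD] := eqVneq (mu k (contract G f e) D) 0; first by rewrite !mul0r.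
    rewrite ler_wpM2l //; first by case: sp'.
    rewrite ler_wpM2l ?subr_ge0 //; apply: mean_le => // E; rewrite /F ler_nat.
    by case: (boolP (is_cut G E)) => [cE|_]; [rewrite lighter_cut|exact: leq_b1].
  have : mu k.+1 f C <= mean (mu k.+1 f) F.
    rewrite /mean (bigD1 C) //= /F nC mulr1 lerDl sumr_ge0 // => D _.
    by rewrite mulr_ge0 // ler0n.
  move: (nu0 C); set M := mean _ _; set c := mu _ _ _ => c0 cM Mx.
  have : x * M <= 0 by lra.
  by rewrite pmulr_rle0 // => M0; apply/eqP; lra.
split=> // rf.
have [gk gs] := g_step bk; rewrite /= -/x in gk gs.
pose F D : R := (is_min_cut G D)%:R.
have meanF nu : mean nu F = success nu.
  rewrite /success big_mkcond; apply: eq_bigr => D _; rewrite /F.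
  by case: (is_min_cut G D); rewrite ?mulr1 ?mulr0.
set P := success (mu k.+1 f).
pose a := \sum_e dpick (live G f) w e * success (mu k (contract G f e)).
have spe e : subprob (mu k (contract G f e)) by apply: mu1; move: bk; lia.
have P0 : 0 <= P by apply: sumr_ge0.
(* Either the first cut is minimum, or a rerun takes place and finds one. When both happen,
   [lighter_min] still returns a minimum cut, so no success is lost. *)
have PE : a + (1 - x) * ((1 - a) * P) <= P.
  rewrite -[leRHS]meanF fix_.
  have -> : a + (1 - x) * ((1 - a) * P) = \sum_e dpick (live G f) w e *
      (success (mu k (contract G f e)) + (1 - x) * ((1 - success (mu k (contract G f e))) * P)).
    rewrite -{2}pick1 /a -sumrB mulr_suml mulr_sumr -big_split /=.
    by apply: eq_bigr => e _; ring.
  apply: ler_sum => e _.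
  have [el|el] := boolP (e \in live G f); last by rewrite /dpick (negbTE el) !mul0r.
  rewrite ler_wpM2l ?dpick_ge0 //; have [t c _] := IHe _ el.
  set nu := mu k (contract G f e) in t c *.
  have -> : success nu + (1 - x) * ((1 - success nu) * P) =
      \sum_D nu D * (x * F D + (1 - x) * (F D + (1 - F D) * P)).
    transitivity (mean nu F + (1 - x) * ((\sum_D nu D - mean nu F) * P)); first by rewrite t meanF.
    rewrite /mean -sumrB mulr_suml mulr_sumr -big_split /=.
    by apply: eq_bigr => D _; ring.
  apply: ler_sum => D _; have [->|/c cD] := eqVneq (nu D) 0; first by rewrite !mul0r.
  rewrite ler_wpM2l //; first by case: (spe e).
  rewrite lerD2l ler_wpM2l ?subr_ge0 //.
  have -> : F D + (1 - F D) * P = \sum_E mu k.+1 f E * (F D + (1 - F D) * F E).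
    transitivity (F D * \sum_E mu k.+1 f E + (1 - F D) * mean (mu k.+1 f) F).
      by rewrite T1 mulr1 meanF.
    by rewrite /mean !mulr_sumr -big_split /=; apply: eq_bigr => E _; ring.
  apply: ler_sum => E _.
  have [->|/cuts cE] := eqVneq (mu k.+1 f E) 0; first by rewrite !mul0r.
  rewrite ler_wpM2l //; have := lighter_min cD cE; rewrite /F.
  case: (is_min_cut G D) => /= [->//|]; first by rewrite subrr mul0r addr0.
  by rewrite add0r subr0 mul1r; case: (is_min_cut G E) => [->//|_]; rewrite ?ler0n.
have aE : a = (\sum_(e in live G f) w e * success (mu k (contract G f e))) / W by rewrite /a sum_dpick.
have s0 e : 0 <= success (mu k (contract G f e)) by apply: sumr_ge0 => C _; case: (spe e).
have sub : Cs \subset live G f by rewrite SC; apply: crossing_live.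
(* An edge outside [Cs] is drawn with probability at least [x], and the contraction then still
   respects [S], so the induction hypothesis applies. *)
have ag : x <= a * g k.
  rewrite aE mulrAC ler_pdivlMr // -ler_pdivrMr //.
  apply: (@le_trans _ _ (\sum_(e in live G f :\: Cs) w e * (g k)^-1)).
    rewrite -mulr_suml; apply: ler_wpM2r; first by rewrite invr_ge0 ltW.
    have := collision num bk; rewrite -/W -/x.
    have : W = \sum_(e in Cs) w e + \sum_(e in live G f :\: Cs) w e.
      by rewrite /W (big_setID Cs) /= (setIidPr sub).
    lra.
  rewrite [leRHS](big_setID Cs) /= -[leLHS]add0r lerD //.
    by apply: sumr_ge0 => e _; rewrite mulr_ge0.
  apply: ler_sum => e; rewrite inE => /andP[eC el]; rewrite ler_wpM2l //.
  have [_ _] := IHe _ el; apply; apply: respects_contract rf _; by rewrite -SC.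
have a0 : 0 < a.
  by rewrite -(pmulr_lgt0 _ gk); apply: lt_le_trans ag.
have gx : a <= P * (a * (g k + (1 - x))).
  have : P * (x * (1 - a) + a) <= P * (a * (g k + (1 - x))) by rewrite ler_wpM2l //; lra.
  lra.
have P1 : 1 <= P * (g k + (1 - x)).
  by rewrite -(ler_pM2l a0) mulr1; move: gx; rewrite mulrCA.
have G0 : 0 < g k.+1 by lra.
rewrite -[leLHS]mulr1 ler_pdivrMl //; apply: le_trans P1 _; rewrite mulrC; apply: ler_wpM2r => //; lra.
Qed.

End Success.

Section RunBound.
Variable R : realType.

Lemma inv_le_ln_diff k : (1 < k)%N -> k%:R^-1 <= ln (k%:R : R) - ln k.-1%:R.
Proof.
move=> k1; have k0 : 0 < k%:R :> R by rewrite ltr0n ltnW.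
have k10 : 0 < k.-1%:R :> R by rewrite ltr0n; lia.
have kV : k%:R^-1 < 1 :> R by rewrite invf_lt1 // ltr1n.
have := @le_ln1Dx R (- k%:R^-1) (ltac:(by rewrite ltrN2)).
have -> : 1 - k%:R^-1 = k.-1%:R / k%:R :> R.
  by rewrite -subn1 natrB ?(ltnW k1) // mulrBl divff ?gt_eqF // mul1r.
rewrite lnM ?posrE ?invr_gt0 // lnV ?posrE //; lra.
Qed.

(** The 8 is that of the bound [1 - q k <= 8 / k] in the boosted phase; the summand 1 serves the
    case of two metavertices, and the logarithm bounds the harmonic sum of the increments. *)
Definition run_bound k : R := 1 + 8 * ln k%:R.

Lemma run_bound_step x k : (2 < k)%N -> x <= 8 / k%:R ->
  0 < run_bound k.-1 /\ run_bound k.-1 + x <= run_bound k.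
Proof.
move=> k2 xk; split.
  by rewrite /run_bound ltr_wpDr ?ltr01 // mulr_ge0 // ln_ge0 // ler1n; lia.
have := @inv_le_ln_diff k (ltnW k2); rewrite /run_bound; lra.
Qed.

End RunBound.

(** * Survival of the minimum cut in both phases *)

Section MinCut.
Variables (R : realType) (n m : nat) (G : wgraph R n m) (p : 'I_m -> R) (Cs : {set 'I_m}).
Variables (S : {set 'I_n}).
Hypotheses (p01 : forall e, 0 <= p e <= 1) (minC : is_min_cut G Cs) (SC : Cs = crossing G S).
Hypotheses (S0 : S != set0) (S1 : ~: S != set0) (C0 : 0 < weight G Cs).
Local Notation et := (eta G p Cs).
Local Notation rh := (rho G p Cs).

Lemma min_cut_connected : connected_weights G.
Proof.
move=> T T0 T1; apply: lt_le_trans C0 _; case/andP: minC => _ /forallP/(_ (crossing G T))/implyP.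
by apply; apply/existsP; exists T; rewrite T0 T1 eqxx.
Qed.

Lemma eta_weight : \sum_(e in Cs) (1 - p e) * wt G e = et * weight G Cs.
Proof. by rewrite /eta mulfVK // gt_eqF. Qed.

Lemma rho_weight : \sum_(e in ~: Cs) p e * wt G e = rh * weight G Cs.
Proof. by rewrite /rho mulfVK // gt_eqF. Qed.

Lemma eta01 : 0 <= et <= 1.
Proof.
rewrite /eta ler_pdivlMr // ler_pdivrMr // mul0r mul1r; apply/andP; split.
  by apply: sumr_ge0 => e _; rewrite mulr_ge0 ?wt_ge0 // subr_ge0; case/andP: (p01 e).
apply: ler_sum => e _; rewrite -[leRHS]mul1r ler_wpM2r ?wt_ge0 //.
by rewrite lerBlDr lerDl; case/andP: (p01 e).
Qed.

(** As [1 - q k = 2 / k], the collision bound is [degree_bound] itself, and the increments stay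
    below the [8 / k] allowed by [run_bound]. *)
Lemma fpz_reliable b f pos : (1 < b)%N -> numbering f b pos ->
  reliable G S (fpz_law G b f) f (run_bound R b).
Proof.
move=> b1 num.
have q01 k : (2 < k <= b)%N -> 0 < (1 - 2 / k%:R : R) <= 1.
  move=> /andP[k2 _]; have k0 : 0 < k%:R :> R by rewrite ltr0n; lia.
  rewrite subr_gt0 ltr_pdivrMr // mul1r ltr_nat k2 /=.
  by rewrite lerBlDr lerDl divr_ge0 // ltW.
apply: (branching_reliable minC SC (fpz_law_branching G b1) _ _ _ q01) num => //.
- by move=> e; apply: wt_ge0.
- by move=> f' k pos' num' k1; apply: weight_live_gt0 num' k1; exact: min_cut_connected.
- move=> f' k pos' num' /andP[k2 _]; have := degree_bound minC num' (ltnW k2).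
  have k0 : 0 < k%:R :> R by rewrite ltr0n; lia.
  rewrite opprB addrCA subrr addr0 -/(weight G Cs) -/(weight G _) mulrAC ler_pdivlMr //.
  by rewrite [leLHS]mulrC mulrC.
- move=> f' pos' num'; split.
  + by rewrite -mean_1 mean_dret.
  + move=> C; rewrite /dret pnatr_eq0 eqb0 negbK => /eqP <-; exact: live_cut num'.
  + move=> rf; rewrite /success (bigD1 Cs) //= (live_respects G S0 S1 num' rf) -SC /dret eqxx.
    rewrite big1 ?addr0 => [|C /andP[_]]; last by rewrite eq_sym => /negbTE ->.
    by rewrite invf_le1 /run_bound ?lerDl ?ltr_wpDr ?ltr01 ?mulr_ge0 ?ln_ge0 // ler1n.
- move=> k /andP[k2 _]; apply: run_bound_step => //.
  have k0 : 0 < k%:R :> R by rewrite ltr0n; lia.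
  by rewrite opprB addrCA subrr addr0 ler_pM2r ?invr_gt0 // ler_nat.
- by rewrite b1 leqnn.
Qed.

Variables (B : R) (t : nat).
Local Notation q := (boosted_q B et rh).
Local Notation b := (minn n t).
Hypotheses (B1 : 1 <= B) (n1 : (1 < n)%N) (t1 : (1 < t)%N).
Hypothesis adm : admissible n B et rh t.
Hypothesis denominator_gt0 : forall k, (b < k <= n)%N ->
  0 < B * k%:R / 2 - (B - 1) * (rh + (1 - et)).
Hypothesis q_bounds : forall k, (b < k <= n)%N -> 0 < q k /\ 1 - q k <= 8 / k%:R.

(** [1 - q k] is a quotient of two bounds in units of the weight of [Cs]. Boosting multiplies the
    weight of [Cs] by [1 + (B - 1) * et]. The live edges have boosted weight at least [B * k / 2] by
    [degree_bound], less [(B - 1)] times the sum of [p e * wt G e], which over all edges is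
    [rh + (1 - et)]. *)
Lemma boosted_collision f k pos : numbering f k pos -> (b < k <= n)%N ->
  \sum_(e in Cs) boosted_wt G p B e <= (1 - q k) * \sum_(e in live G f) boosted_wt G p B e.
Proof.
move=> num kb; have D0 := denominator_gt0 kb.
have k1 : (1 < k)%N by move: kb; rewrite gtn_min; lia.
have := degree_bound minC num k1; set lam := weight G Cs => deg.
have -> : \sum_(e in Cs) boosted_wt G p B e = (1 + (B - 1) * et) * lam.
  rewrite mulrDl mul1r -mulrA -eta_weight mulr_sumr -big_split /=.
  by apply: eq_bigr => e _; rewrite /boosted_wt; ring.
have tot : (B * k%:R / 2 - (B - 1) * (rh + (1 - et))) * lam <= \sum_(e in live G f) boosted_wt G p B e.
  have -> : \sum_(e in live G f) boosted_wt G p B e =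
      B * weight G (live G f) - (B - 1) * \sum_(e in live G f) p e * wt G e.
    by rewrite /weight !mulr_sumr -sumrB; apply: eq_bigr => e _; rewrite /boosted_wt; ring.
  have pw : \sum_(e in live G f) p e * wt G e <= (rh + (1 - et)) * lam.
    have pw0 e : 0 <= p e * wt G e by rewrite mulr_ge0 ?wt_ge0 //; case/andP: (p01 e).
    apply: (@le_trans _ _ (\sum_e p e * wt G e)).
      by rewrite [leRHS](bigID [in live G f]) /= lerDl sumr_ge0.
    rewrite (bigID [in Cs]) /= [X in _ + X](_ : _ = rh * lam); last first.
      by rewrite -rho_weight; apply: eq_bigl => e; rewrite inE.
    have -> : \sum_(e in Cs) p e * wt G e = lam - et * lam.
      by rewrite -eta_weight /lam /weight -sumrB; apply: eq_bigr => e _; ring.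
    lra.
  have B0 : 0 <= B - 1 by rewrite subr_ge0.
  have := ler_wpM2l B0 pw; have := ler_wpM2l (ltW (lt_le_trans ltr01 B1)) deg; lra.
have -> : 1 - q k = (1 + (B - 1) * et) / (B * k%:R / 2 - (B - 1) * (rh + (1 - et))).
  by rewrite /boosted_q opprB addrCA subrr addr0.
rewrite [leRHS]mulrAC ler_pdivlMr // -[leLHS]mulrA ler_wpM2l //.
  by rewrite addr_ge0 // mulr_ge0 ?subr_ge0 //; case/andP: eta01.
by rewrite mulrC.
Qed.

Lemma boosted_reliable : (run_bound R n)^-1 <= \sum_(C | is_min_cut G C) boosted_fpz G p B et rh t C.
Proof.
have b1 : (1 < b)%N by rewrite leq_min n1 t1.
have idr : respects S [ffun v => v] by move=> u v; rewrite !ffunE => ->.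
suff [_ _] : reliable G S (boosted_fpz G p B et rh t) [ffun v => v] (run_bound R n) by apply.
have q01 k : (b < k <= n)%N -> 0 < q k <= 1.
  move=> kb; have [-> _] := q_bounds kb.
  have /(proj2 adm)/andP[_ ->] // : (t < k <= n)%N by move: kb; rewrite gtn_min; lia.
apply: (branching_reliable minC SC (bfpz_law_branching G p01 adm erefl b1) b1 _ _ q01 _ _ _
  _ (numbering_id n)) => //.
- by move=> e; apply: le_trans (wt_ge0 _ _) (boosted_wt_ge G p01 adm _).
- move=> f k pos num k1; apply: lt_le_trans (weight_live_gt0 min_cut_connected num k1) _.
  by apply: ler_sum => e _; apply: boosted_wt_ge p01 adm _.
- by move=> f k pos num kb; exact: boosted_collision num kb.
- by move=> f pos num; exact: fpz_reliable num.
- move=> k kb; have [_ xk] := q_bounds kb; apply: run_bound_step => //.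
  by apply: leq_ltn_trans b1 (proj1 (andP kb)).
- by rewrite geq_minl leqnn.
Qed.

End MinCut.
(** * Running time *)

Section Numerics.
Variable R : realType.
Implicit Types (x u beta : R) (k n : nat).

Lemma half_le_ln2 : 2^-1 <= ln (2 : R).
Proof.
have := @le_ln1Dx R (- 2^-1) ltac:(lra).
have -> : 1 - 2^-1 = 2^-1 :> R by field.
rewrite lnV ?posrE //; lra.
Qed.

Lemma ln_nat_ge n : (1 < n)%N -> 2^-1 <= ln (n%:R : R).
Proof.
move=> n1; apply: le_trans half_le_ln2 _; rewrite ler_ln ?posrE ?ltr0n ?ler_nat //; lia.
Qed.

Lemma trunc_log_le k : (0 < k)%N -> (trunc_log 2 k)%:R <= 2 * ln (k%:R : R).
Proof.
move=> k0; have := trunc_logP (isT : (1 < 2)%N) k0; set d := trunc_log 2 k => dk.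
have : ln ((2 : R) ^+ d) <= ln k%:R.
  by rewrite ler_ln ?posrE ?exprn_gt0 ?ltr0n // -natrX ler_nat.
have := ler_wpM2l (ler0n R d) half_le_ln2; rewrite lnXn // -[ln _ *+ d]mulr_natl; lra.
Qed.

(** [k * (k - 1)] solves the recurrence without the linear cost of a contraction, since [(1 - 2 / k)
    * k * (k - 1) = (k - 1) * (k - 2)]; the linear cost adds a harmonic sum, hence the logarithm. *)
Definition inner_time k : R := 288 * (k%:R * (k%:R - 1)) * (1 + ln k%:R).

Lemma inner_time_ge0 k : 0 <= inner_time k.
Proof.
case: k => [|k]; first by rewrite /inner_time mul0r mulr0 mul0r.
have l0 : 0 <= ln (k.+1%:R : R) by rewrite ln_ge0 // ler1n.
have k1 : 0 <= k.+1%:R - 1 :> R by rewrite subr_ge0 ler1n.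
by rewrite /inner_time; apply: mulr_ge0; [apply: mulr_ge0; [exact: ler0n|apply: mulr_ge0]|apply: addr_ge0].
Qed.

Lemma inner_time_step k : (2 < k)%N ->
  (k * 32 + (70 + 13))%:R + inner_time k.-1 + 12%:R + (1 - (1 - 2 / k%:R)) * (0 + inner_time k)
    <= inner_time k.
Proof.
move=> k2; have k0 : (0 : R) < k%:R by rewrite ltr0n; lia.
have k3 : (3 : R) <= k%:R by rewrite ler_nat.
have ld := @inv_le_ln_diff R k (ltnW k2).
rewrite /inner_time.
have k1E : k.-1%:R = k%:R - 1 :> R by rewrite -subn1 natrB //; lia.
rewrite k1E in ld *; rewrite natrD natrM (_ : (70 + 13)%N = 83%N) //; set K : R := k%:R in k0 k3 ld *.
set L := ln K in ld *; set L' := ln _ in ld *.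
have -> : (1 - (1 - 2 / K)) * (0 + 288 * (K * (K - 1)) * (1 + L)) = 2 * 288 * (K - 1) * (1 + L).
  by field; rewrite gt_eqF.
have L1 : (K - 1) * (K - 2) * K^-1 <= (K - 1) * (K - 2) * (L - L').
  by rewrite ler_wpM2l // mulr_ge0 //; lra.
(* Equality holds at [K = 3]. With the factor 288 this yields [64 * K], which covers the cost
   [32 * K + 95] from [K = 3] on. *)
have L2 : 2 / 9 * K <= (K - 1) * (K - 2) * K^-1.
  by rewrite ler_pdivlMr //; nra.
lra.
Qed.

(** [(1 - 1 / u) ^ beta] is at most [exp (- beta / u)], hence at most [1 / (1 + beta / u) = 1 - beta
    / (u + beta)]; the 4 in the hypothesis bounds [beta]. *)
Lemma power_step u beta x : 1 < u -> 0 <= beta <= 4 -> x <= beta / (u + 4) ->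
  (u - 1) `^ beta <= (1 - x) * u `^ beta.
Proof.
move=> u1 /andP[b0 b4] xb; have u0 : 0 < u by lra.
have -> : u - 1 = u * (1 - u^-1) by rewrite mulrBr mulr1 divff // gt_eqF.
have iu : u^-1 < 1 by rewrite invf_lt1.
rewrite powRM ?subr_ge0 ?(ltW iu) ?(ltW u0) // mulrC ler_wpM2r ?powR_ge0 //.
rewrite /powR ifF; last by rewrite gt_eqF // subr_gt0.
have l1 : ln (1 - u^-1) <= - u^-1 by apply: le_ln1Dx; lra.
apply: (@le_trans _ _ (expR (- (beta / u)))).
  by rewrite ler_expR; have := ler_wpM2l b0 l1; lra.
rewrite expRN; have e1 : 1 + beta / u <= expR (beta / u) := expR_ge1Dx _.
have bu : 0 <= beta / u by rewrite divr_ge0 // ltW.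
have p1 : 0 < 1 + beta / u by lra.
apply: (@le_trans _ _ (1 + beta / u)^-1); first by rewrite lef_pV2 ?posrE ?expR_gt0.
have -> : (1 + beta / u)^-1 = 1 - beta / (u + beta).
  by field; apply/andP; split; rewrite gt_eqF //; lra.
rewrite lerD2l lerN2; apply: le_trans xb _.
by rewrite ler_wpM2l // lef_pV2 ?posrE; lra.
Qed.


(** The denominator is at least [B / 2 * (k - (2 * rh + 2))] and the numerator at most
    [B / 2 * (2 * et + 2 / B)]. The hypothesis on [k] makes [k - (2 * rh + 2)] a fixed fraction of
    [k], and gives [k >= 16] for the last bound. *)
Lemma boosted_q_bounds (B et rh : R) k : 2 <= B -> 0 <= et <= 1 -> 1 <= rh ->
  4 * rh + 12 <= k%:R ->
  [/\ 0 < B * k%:R / 2 - (B - 1) * (rh + (1 - et)), 0 <= 1 - boosted_q B et rh k,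
      1 - boosted_q B et rh k <= (2 * et + 2 / B) / (k%:R - (2 * rh + 2)),
      1 - boosted_q B et rh k <= 8 / k%:R & 1 - boosted_q B et rh k <= 2^-1].
Proof.
move=> B2 /andP[e0 e1] rh1.
have -> : 1 - boosted_q B et rh k =
    (1 + (B - 1) * et) / (B * k%:R / 2 - (B - 1) * (rh + (1 - et))).
  by rewrite /boosted_q opprB addrCA subrr addr0.
set K : R := k%:R => Kb; set De := _ - _ * _.
have K0 : 0 < K by lra.
have B0 : 0 < B by lra.
have KS : 0 < K - (2 * rh + 2) by lra.
have DB : B / 2 * (K - (2 * rh + 2)) <= De.
  by rewrite /De; have : 0 <= (B - 1) * et by [apply: mulr_ge0; lra]; lra.
have D0 : 0 < De by apply: lt_le_trans DB; apply: mulr_gt0 => //; lra.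
have num0 : 0 <= 1 + (B - 1) * et by rewrite addr_ge0 // mulr_ge0 //; lra.
have b3 : 2 * et + 2 / B <= 3.
  by have : 2 / B <= 1; [rewrite ler_pdivrMr //; lra|lra].
have b0 : 0 <= 2 * et + 2 / B by apply: addr_ge0; [exact: mulr_ge0|rewrite divr_ge0 // ltW].
have x1 : (1 + (B - 1) * et) / De <= (2 * et + 2 / B) / (K - (2 * rh + 2)).
  rewrite ler_pdivrMr //.
  apply: (@le_trans _ _ ((2 * et + 2 / B) / (K - (2 * rh + 2)) * (B / 2 * (K - (2 * rh + 2))))).
    rewrite (_ : _ * (B / 2 * _) = B * et + 1); first lra.
    by field; apply/andP; split; rewrite gt_eqF.
  by rewrite ler_wpM2l // divr_ge0 // ltW.
have x2 : (2 * et + 2 / B) / (K - (2 * rh + 2)) <= 8 / K.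
  rewrite ler_pdivrMr // mulrAC ler_pdivlMr //.
  have := ler_wpM2r (ltW K0) b3; lra.
have x3 : 8 / K <= 2^-1 by rewrite ler_pdivrMr //; lra.
split=> //; first by rewrite divr_ge0 // ltW.
- exact: le_trans x2.
- by apply: le_trans (le_trans x1 x2) x3.
Qed.

(** The reason why boosting by [B = n] is strong enough: the term [2 / B] in the exponent costs only
    a constant factor. *)
Lemma powR_2_div_le n : (0 < n)%N -> (n%:R : R) `^ (2 / n%:R) <= expR 2.
Proof.
move=> n0; have N0 : 0 < n%:R :> R by rewrite ltr0n.
rewrite /powR gt_eqF // ler_expR -mulrA ler_piMr // mulrC ler_pdivrMr // mul1r.
apply: le_trans (_ : n%:R - 1 <= _); last by lra.
rewrite -{1}[n%:R](addrNK 1) addrC; apply: le_ln1Dx; lra.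
Qed.

(** For [U k = tO k + redo] the recurrence reads [U (k - 1) + 35 <= q k * U k]. It is solved by a
    product: [H] grows by a factor of at least [1 / q k] according to [power_step], and [P] collects
    the 35 steps of each level. *)
Lemma outer_time_exists n t (et rh Tb redo : R) :
  let q := boosted_q n%:R et rh in let b := minn n t in
  (1 < n)%N -> (1 < t)%N -> 0 <= et <= 1 -> 1 <= rh -> 4 * rh + 12 <= t%:R ->
  0 <= Tb -> 0 <= redo ->
  exists tO : nat -> R, [/\ forall k, 0 <= tO k, Tb <= tO b,
    forall k, (b < k <= n)%N ->
      20%:R + tO k.-1 + 15%:R + (1 - q k) * (redo + tO k) <= tO k
  & tO n <= (Tb + redo + 35 * n%:R) * (16 * expR 2 * (n%:R / b%:R) `^ (2 * et))].
Proof.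
move=> q b n1 t1 e01 rh1 tb Tb0 r0; have /andP[e0 e1] := e01.
have N2 : 2 <= n%:R :> R by rewrite ler_nat.
have N0 : 0 < n%:R :> R by lra.
have ex2 : 1 <= expR 2 :> R by have := @expR_ge1Dx R 2; lra.
have [nt|tn] := leqP n t.
  exists (fun=> Tb); rewrite /b (minn_idPl nt); split=> //.
    by move=> k /andP[nk kn]; move: nk; rewrite ltnNge kn.
  rewrite divff ?gt_eqF // powR1 mulr1.
  have := ler_wpM2l Tb0 ex2; have : 0 <= (redo + 35 * n%:R) * (16 * expR 2).
    by rewrite mulr_ge0 ?addr_ge0 // mulr_ge0 ?ltW // expR_gt0.
  lra.
have bE : b = t by rewrite /b; apply/minn_idPr/ltnW.
rewrite bE; pose beta : R := 2 * et + 2 / n%:R; pose s : R := 2 * rh + 2.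
have beta0 : 0 <= beta by apply: addr_ge0; [exact: mulr_ge0|rewrite divr_ge0 // ltW].
have beta4 : beta <= 4.
  by have : 2 / n%:R <= 1 :> R; [rewrite ler_pdivrMr //; lra|rewrite /beta; lra].
pose H k : R := (k%:R - s - 4) `^ beta.
have T0 : 0 < t%:R :> R by lra.
have Ht0 : 0 < H t by rewrite /H powR_gt0 // /s; lra.
have H0 k : 0 <= H k by apply: powR_ge0.
have step k : (t < k <= n)%N -> H k.-1 <= q k * H k.
  move=> /andP[tk kn]; have kt : t%:R + 1 <= k%:R :> R by rewrite natr1 ler_nat.
  have [|_ _ xb _ _] := boosted_q_bounds (k := k) N2 e01 rh1; first by lra.
  have := @power_step (k%:R - s - 4) beta (1 - q k); rewrite /H.
  have -> : k.-1%:R - s - 4 = k%:R - s - 4 - 1 :> R.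
    have k0 : (0 < k)%N by apply: leq_ltn_trans tk.
    have -> : k%:R = k.-1%:R + 1 :> R by rewrite natr1 prednK.
    clear; lra.
  rewrite [1 - (1 - q k)]subKr; apply; first by rewrite /s; lra.
  - by rewrite beta0.
  - by rewrite subrK.
have mono k : (t <= k)%N -> H t <= H k.
  move=> tk; have kt : t%:R <= k%:R :> R by rewrite ler_nat.
  by apply: ge0_ler_powR; rewrite ?nnegrE /s; lra.
pose P k : R := Tb + redo + 35 * (k - t)%:R.
have P0 k : 0 <= P k by rewrite !addr_ge0 // mulr_ge0.
pose tO k := if (k < t)%N then 0 else P k * (H k / H t) - redo.
have tOE k : (t <= k)%N -> tO k = P k * (H k / H t) - redo by move=> tk; rewrite /tO ltnNge tk.
have tO_ge k : (t <= k)%N -> Tb <= tO k.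
  move=> tk; rewrite tOE // lerBrDr.
  apply: (@le_trans _ _ (P k * 1)); first by rewrite mulr1 lerDl mulr_ge0.
  by rewrite ler_wpM2l // ler_pdivlMr // mul1r mono.
exists tO; split.
- move=> k; have [kt|tk] := ltnP k t; first by rewrite /tO kt.
  exact: le_trans (tO_ge k tk).
- exact: tO_ge.
- move=> k tkn; have /andP[tk kn] := tkn.
  have k0 : (0 < k)%N by apply: leq_ltn_trans tk.
  have tk1 : (t <= k.-1)%N by rewrite -ltnS prednK.
  rewrite !tOE ?(ltnW tk) //.
  have PE : P k = P k.-1 + 35.
    have e : (k - t)%N = (k.-1 - t).+1 by rewrite -subSn // prednK.
    by rewrite /P e -[(_ - t).+1%:R]natr1 mulrDr mulr1 addrA.
  have h1 : 1 <= H k.-1 / H t by rewrite ler_pdivlMr // mul1r mono.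
  have h2 : H k.-1 / H t <= q k * (H k / H t).
    by rewrite mulrA ler_pM2r ?invr_gt0 // step.
  have := ler_wpM2l (P0 k) h2; rewrite {1}PE; set h := H k / _ in h2 *; set h' := H _ / _ in h1 h2 *.
  lra.
rewrite tOE ?(ltnW tn) //.
have PP : P n <= Tb + redo + 35 * n%:R by rewrite lerD2l ler_wpM2l // ler_nat leq_subr.
(* By [t >= 4 * rh + 12], the base [t - s - 4] is at least [t / 2], so the ratio is at most
   [(2 * n / t) ^ beta]. Here [2 ^ beta <= 16] as [beta <= 4], and the part [2 / n] of the exponent
   contributes at most [expR 2]. *)
have ratio : H n / H t <= 16 * expR 2 * (n%:R / t%:R) `^ (2 * et).
  have nt : t%:R <= n%:R :> R by rewrite ler_nat ltnW.
  have nt0 : 0 < n%:R / t%:R :> R by rewrite divr_gt0.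
  have nt2 : 0 <= 2 * (n%:R / t%:R) :> R by rewrite mulr_ge0 // ltW.
  have us : 0 <= t%:R - s - 4 :> R by rewrite /s; lra.
  have uu : n%:R - s - 4 <= 2 * (n%:R / t%:R) * (t%:R - s - 4).
    apply: (@le_trans _ _ (2 * (n%:R / t%:R) * (t%:R / 2))); last first.
      by rewrite ler_wpM2l // /s; lra.
    rewrite (_ : 2 * _ * _ = n%:R); first by rewrite /s; lra.
    by field; rewrite gt_eqF.
  apply: (@le_trans _ _ ((2 * (n%:R / t%:R)) `^ beta)).
    rewrite ler_pdivrMr // /H -powRM //; apply: ge0_ler_powR; rewrite ?nnegrE //.
      by rewrite /s; lra.
    exact: mulr_ge0.
  rewrite powRM // ?(ltW nt0) // -mulrA; apply: ler_pM; rewrite ?powR_ge0 //.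
    apply: le_trans (ler_powR _ beta4) _; first by lra.
    by rewrite powR_mulrn //; lra.
  rewrite /beta powRD; last by apply/implyP => _; rewrite gt_eqF.
  rewrite [leRHS]mulrC ler_wpM2l ?powR_ge0 //.
  apply: le_trans (powR_2_div_le (ltnW n1)).
  have n20 : 0 <= 2 / n%:R :> R by rewrite divr_ge0 // ltW.
  apply: (ge0_ler_powR n20); rewrite ?nnegrE ?(ltW nt0) ?(ltW N0) //.
  by rewrite ler_pdivrMr // ler_peMr ?(ltW N0) // ler1n ltnW.
have r1 : 0 <= H n / H t by rewrite divr_ge0 // ltW.
apply: (@le_trans _ _ (P n * (H n / H t))); first by rewrite lerBlDr lerDl.
by apply: ler_pM.
Qed.

Section Totals.
Variables n m t : nat.
Local Notation b := (minn n t).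
Local Notation L := (ln (n%:R : R)).
Hypotheses (n1 : (1 < n)%N) (m0 : (0 < m)%N) (b1 : (1 < b)%N).
Hypotheses (nm : (n <= m + m)%N) (mn : (m <= n * n)%N) (mb : (m <= b * b)%N).

Let L2 : 2^-1 <= L. Proof. exact: ln_nat_ge. Qed.

Let mL : m%:R <= 2 * (m%:R * L).
Proof. by have := L2; have := ler_wpM2l (ler0n R m) L2; lra. Qed.

Let depth_le : (depth n)%:R <= 2 * L.
Proof. by apply: trunc_log_le; apply: ltnW. Qed.

Let nm2 : n%:R <= 2 * m%:R :> R.
Proof. by rewrite mulr2n mulrDl mul1r -natrD ler_nat. Qed.

Let m1 : 1 <= m%:R :> R. Proof. by rewrite ler1n. Qed.

Let height_le : (tree_height m)%:R <= 6 * L.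
Proof.
have n0 : (0 < n)%N by apply: ltnW.
apply: le_trans (trunc_log_le _) _; first by rewrite addn_gt0 m0.
suff : ln ((m + m)%:R : R) <= 3 * L by lra.
have -> : 3 * L = ln ((n%:R : R) ^+ 3) by rewrite lnXn ?ltr0n // mulr_natl.
rewrite ler_ln ?posrE ?exprn_gt0 ?ltr0n ?addn_gt0 ?m0 // -natrX ler_nat.
apply: (@leq_trans (2 * (n * n))); first by rewrite mul2n addnn leq_double.
by rewrite !expnS expn0 muln1 leq_mul2r n1 orbT.
Qed.

(** Terms in [n], [m] and 1 are turned into multiples of [m * L] by [n <= 2 * m] and [1/2 <= L]: 326
    is 144 for relinking, 110 for the trials, 32 for [m * 16] and 40 for the constant 20. *)
Lemma redo_steps_le : (redo_steps n m)%:R <= 326 * (m%:R * L) :> R.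
Proof.
have [l2 dl hl] := And3 L2 depth_le height_le; have [ml nm' m1'] := And3 mL nm2 m1.
rewrite /redo_steps /trial_cost !natrD !natrM !natrD !natrM.
have mm : 0 <= m%:R :> R by [].
have h1 : n%:R * ((depth n)%:R * 6 + 30) <= 2 * m%:R * (72 * L) :> R.
  by apply: ler_pM => //; lra.
have h2 : ((tree_height m)%:R * 9 + (depth n)%:R * 6 + 22) * m%:R <= 110 * L * m%:R :> R.
  by rewrite ler_wpM2r //; lra.
lra.
Qed.

(** The main term is [inner_time], at most [288 * 3 = 864] units because [1 + ln b <= 3 * L];
    [m <= b * b] absorbs the scan of the edges. *)
Lemma leaf_cost_le : leaf_cost n m t inner_time <= 1196 * (b%:R ^+ 2 * L).
Proof.
have [l2 dl hl] := And3 L2 depth_le height_le; have [ml nm' m1'] := And3 mL nm2 m1.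
rewrite /leaf_cost !natrD !natrM !natrD !natrM.
have b0 : 2 <= b%:R :> R by rewrite ler_nat.
have bL : ln b%:R <= L.
  by rewrite ler_ln ?posrE ?ltr0n ?ler_nat ?geq_minl // ltnW.
have mb2 : m%:R <= b%:R ^+ 2 :> R by rewrite -natrX ler_nat -mulnn.
have L0 : 0 <= L by apply: le_trans L2; rewrite invr_ge0.
have h1 : n%:R * ((depth n)%:R * 3 + 18) <= 2 * m%:R * (42 * L) :> R.
  by apply: ler_pM => //; lra.
have h2 : m%:R * L <= b%:R ^+ 2 * L by rewrite ler_wpM2r.
have h3 : b%:R ^+ 2 <= 2 * (b%:R ^+ 2 * L) :> R.
  by have := ler_wpM2l (sqr_ge0 (b%:R : R)) L2; lra.
have h4 : 2 * b%:R <= b%:R ^+ 2 :> R by rewrite expr2 ler_wpM2r.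
have h5 : inner_time b <= 864 * (b%:R ^+ 2 * L).
  have l0 : 0 <= ln (b%:R : R) by rewrite ln_ge0 // ler1n ltnW.
  have b2' : b%:R * (b%:R - 1) <= b%:R ^+ 2 :> R by rewrite expr2 ler_wpM2l // lerBlDr lerDl.
  have b10 : 0 <= b%:R * (b%:R - 1) :> R by rewrite mulr_ge0 // subr_ge0 ler1n ltnW.
  have l1 : 1 + ln b%:R <= 3 * L by move: l2 bL; lra.
  have l01 : 0 <= 1 + ln (b%:R : R) by rewrite addr_ge0.
  by have := ler_pM b10 l01 b2' l1; rewrite /inner_time; lra.
have := expr2 (b%:R : R); lra.
Qed.

Lemma total_steps_le (C : R) : 1 <= C ->
  (redo_steps n m * 2 + n * 10 + m * 20 + 60)%:R +
  (leaf_cost n m t inner_time + (redo_steps n m)%:R + 35 * n%:R) * C <=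
  2600 * (b%:R ^+ 2 * L) * C.
Proof.
move=> C1; have [l2 dl hl] := And3 L2 depth_le height_le; have [ml nm' m1'] := And3 mL nm2 m1.
have r := redo_steps_le; have l := leaf_cost_le.
have L0 : 0 <= L by apply: le_trans L2; rewrite invr_ge0.
have mb2 : m%:R <= b%:R ^+ 2 :> R by rewrite -natrX ler_nat -mulnn.
have h2 : m%:R * L <= b%:R ^+ 2 * L by rewrite ler_wpM2r.
move: r; move: (redo_steps n m) => Q r; rewrite !natrD !natrM.
set W := b%:R ^+ 2 * L in l h2 *; have W0 : 0 <= W by rewrite /W mulr_ge0 // sqr_ge0.
have h3 : leaf_cost n m t inner_time + Q%:R + 35 * n%:R <= 1700 * W by lra.
have C0 : 0 <= C by apply: le_trans C1.
have h4 : Q%:R * 2 + n%:R * 10 + m%:R * 20 + 60 <= 900 * W by lra.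
apply: le_trans (lerD h4 (ler_wpM2r C0 h3)) _.
rewrite (_ : 2600 * W * C = 900 * W * C + 1700 * W * C); last by ring.
rewrite lerD2r; exact: ler_peMr (mulr_ge0 (ler0n R 900) W0) C1.
Qed.

End Totals.
End Numerics.

(** * Sizes of the graph, the threshold and the final balance *)

Section Sizes.
Variables (R : realType) (n m : nat) (G : wgraph R n m).

(** The absence of parallel edges enters here; it bounds the height of the segment tree by a
    multiple of [ln n]. *)
Lemma edges_le : (m <= n * n)%N.
Proof.
pose ends e := (src G e, dst G e).
have inj : injective ends by move=> e e' [es ed]; apply: (ends_inj (w := G)); rewrite es ed.
by have := leq_card _ inj; rewrite card_prod !card_ord.
Qed.

(** Each vertex alone is one side of a cut of positive weight, so it is an end of some edge. *)
Lemma vertices_le : (1 < n)%N -> connected_weights G -> (n <= m + m)%N.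
Proof.
move=> n1 conn.
have cover : [set: 'I_n] \subset (src G @: [set: 'I_m]) :|: (dst G @: [set: 'I_m]).
  apply/subsetP => u _; pose S := [set u].
  have S0 : S != set0 by apply/set0Pn; exists u; rewrite inE.
  have S1 : ~: S != set0.
    rewrite -card_gt0 cardsCs setCK cards1 card_ord subn_gt0; exact: n1.
  have := conn S S0 S1; rewrite /weight; have [->|[e]] := set_0Vmem (crossing G S).
    by rewrite big_set0 ltxx.
  rewrite !inE => h _; apply/orP; move: h.
  have [<-|_] := eqVneq (src G e) u; first by left; apply: imset_f.
  have [<-|_] := eqVneq (dst G e) u; first by right; apply: imset_f.
  by [].
have := subset_leq_card cover; rewrite cardsT card_ord => /leq_trans; apply.
apply: leq_trans (leq_card_setU _ _) _; apply: leq_add.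
  by apply: leq_trans (leq_imset_card _ _) _; rewrite cardsT card_ord.
by apply: leq_trans (leq_imset_card _ _) _; rewrite cardsT card_ord.
Qed.

Lemma powR_scale_le (x y c a : R) : 0 <= x <= c * y -> 1 <= c -> 0 <= y -> 0 <= a <= 2 ->
  x `^ a <= c ^+ 2 * y `^ a.
Proof.
move=> /andP[x0 xy] c1 y0 /andP[a0 a2]; have c0 : 0 <= c by apply: le_trans c1.
apply: (@le_trans _ _ ((c * y) `^ a)).
  by apply: ge0_ler_powR; rewrite ?nnegrE // mulr_ge0.
rewrite powRM // ler_wpM2r ?powR_ge0 //.
by rewrite -powR_mulrn //; apply: ler_powR.
Qed.

(** The root of [m] makes the matrix as large as the list of edges; [4 * rh + 12] is what the bounds
    on [boosted_q] ask for. As [rh >= 1], the constant and the rounding fit into [17 * rh]. *)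
Definition threshold (rh : R) : nat := (Num.truncn (Num.sqrt m%:R + 4 * rh + 12)).+1.

Lemma threshold_bounds (rh : R) : 1 <= rh ->
  [/\ (1 < threshold rh)%N, 4 * rh + 12 <= (threshold rh)%:R, Num.sqrt m%:R <= (threshold rh)%:R :> R
    & (threshold rh)%:R <= Num.sqrt m%:R + 17 * rh].
Proof.
move=> r1; have s0 : 0 <= Num.sqrt m%:R :> R := sqrtr_ge0 _.
have x0 : 0 <= Num.sqrt m%:R + 4 * rh + 12 :> R by lra.
have /andP[h1 h2] := truncn_itv x0.
have h3 : (threshold rh)%:R <= Num.sqrt m%:R + 17 * rh :> R.
  by rewrite /threshold -natr1; lra.
split=> //; [|by rewrite /threshold; lra|by rewrite /threshold; lra].
by rewrite /threshold ltnS truncn_gt0; lra.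
Qed.

(** The left side is [b ^ (2 * (1 - et)) * n ^ (2 * et) * ln n] and [b <= sqrt m + 17 * rh]. In the
    first case [rh] is at most [K * sqrt m], in the second [sqrt m] is below [rh / K]; either way
    [b] is at most [17 * (1 + K + 1 / K)] times the dominant one, and this factor is squared because
    the exponent is at most 2. *)
Lemma budget_le (et rh K : R) (t := threshold rh) (b := minn n t) :
  (1 < n)%N -> (0 < m)%N -> 0 <= et <= 1 -> 1 <= rh -> 0 < K ->
  b%:R ^+ 2 * (n%:R / b%:R) `^ (2 * et) * ln n%:R <= (17 * (1 + K + K^-1)) ^+ 2 *
    (if rh <= K * Num.sqrt m%:R then m%:R `^ (1 - et) * n%:R `^ (2 * et) * ln n%:R
     else rh `^ (2 * (1 - et)) * n%:R `^ (2 * et) * ln n%:R) :> R.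
Proof.
move=> n1 m0 /andP[e0 e1] r1 K0; have [t1 t2 t3 t4] := threshold_bounds r1.
have L0 : 0 <= ln (n%:R : R) by rewrite ln_ge0 // ler1n ltnW.
have b1 : (1 < b)%N by rewrite leq_min n1.
have b0 : 0 < b%:R :> R by rewrite ltr0n ltnW.
have -> : b%:R ^+ 2 * (n%:R / b%:R) `^ (2 * et) = b%:R `^ (2 * (1 - et)) * n%:R `^ (2 * et) :> R.
  have nb : 0 <= n%:R / b%:R :> R by rewrite divr_ge0 // ltW.
  have -> : n%:R `^ (2 * et) = (n%:R / b%:R) `^ (2 * et) * b%:R `^ (2 * et) :> R.
    by rewrite -powRM ?(ltW b0) // divfK ?gt_eqF.
  rewrite mulrCA -powRD; last by apply/implyP => _; rewrite gt_eqF.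
  rewrite (_ : 2 * (1 - et) + 2 * et = 2%:R); last by ring.
  by rewrite powR_mulrn ?(ltW b0) // mulrC.
have Ki : 0 < K^-1 by rewrite invr_gt0.
set c := 17 * (1 + K + K^-1); have c1 : 1 <= c by rewrite /c; lra.
have a02 : 0 <= 2 * (1 - et) <= 2 by apply/andP; split; lra.
have bt : b%:R <= t%:R :> R by rewrite ler_nat geq_minr.
have s0 : 0 <= Num.sqrt m%:R :> R := sqrtr_ge0 _.
have main X : 0 <= X -> t%:R <= c * X ->
    b%:R `^ (2 * (1 - et)) * n%:R `^ (2 * et) * ln n%:R <=
    c ^+ 2 * (X `^ (2 * (1 - et)) * n%:R `^ (2 * et) * ln n%:R).
  move=> X0 tX; rewrite !mulrA ler_wpM2r // ler_wpM2r ?powR_ge0 //.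
  by apply: powR_scale_le => //; rewrite ?(ltW b0) //= (le_trans bt).
case: ifPn => [h|]; last rewrite -ltNge => h.
  have -> : m%:R `^ (1 - et) = Num.sqrt m%:R `^ (2 * (1 - et)) :> R.
    by rewrite -powR12_sqrt // -powRrM mulrA mulVf // mul1r.
  apply: main => //; apply: le_trans t4 _; rewrite /c.
  have := mulr_ge0 (ltW Ki) s0; lra.
apply: main; first lra.
have h' : Num.sqrt m%:R <= K^-1 * rh by rewrite ler_pdivlMl // ltW.
apply: le_trans t4 _; rewrite /c; have r0 : 0 <= rh by lra.
have := mulr_ge0 (ltW K0) r0; have := mulr_ge0 (ltW Ki) r0; lra.
Qed.

End Sizes.

Theorem theorem2 (R : realType) :
  exists (prog : cmd)
         (Bof : nat -> nat -> R -> R -> R) (tof : nat -> nat -> R -> R -> nat)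
         (c : R) (A : R -> R),
    0 < c /\
    forall (n m : nat) (G : wgraph R n m) (p : 'I_m -> R) (Cs : {set 'I_m}),
      (forall e, 0 <= p e <= 1) ->
      is_min_cut G Cs ->
      1 <= rho G p Cs ->
      let et := eta G p Cs in
      let rh := rho G p Cs in
      let B := Bof n m et rh in
      let t := tof n m et rh in
      [/\ admissible n B et rh t,
          implements_boosted_fpz prog G p B et rh t,
          (forall K : R, 0 < K ->
             (expected_steps prog (input G p B et rh t) <=
              (A K * (if rh <= K * Num.sqrt m%:R
                      then m%:R `^ (1 - et) * n%:R `^ (2 * et) * ln n%:R
                      else rh `^ (2 * (1 - et)) * n%:R `^ (2 * et)
                           * ln n%:R))%:E)%E)
        & c / ln n%:R <= \sum_(C | is_min_cut G C) boosted_fpz G p B et rh t C].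
Proof.
pose Bof (n m : nat) (et rh : R) : R := n%:R.
pose tof (n m : nat) (et rh : R) := threshold m rh.
(* 2600 comes from [total_steps_le], [16 * expR 2] from [outer_time_exists] and the square from
   [budget_le]. The 20 suffices because [1 + 8 * ln n <= 20 * ln n] when [ln n >= 1/2]. *)
exists boosted_program, Bof, tof, (20%:R^-1),
  (fun K => 2600 * (16 * expR 2) * (17 * (1 + K + K^-1)) ^+ 2).
split=> [|n m G p Cs p01 minC rho1 et rh B t]; first by rewrite invr_gt0 ltr0n.
have C0 : 0 < weight G Cs.
  rewrite lt_neqAle eq_sym sumr_ge0 => [|e _]; last exact: wt_ge0.
  rewrite andbT; apply: contraTneq rho1 => C0.
  by rewrite /rho C0 invr0 mulr0 -ltNge ltr01.
have [S /and3P[S0 S1 /eqP SC]] : exists S, [&& S != set0, ~: S != set0 & Cs == crossing G S].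
  by apply/existsP; case/andP: minC.
have conn := min_cut_connected minC C0.
have e01 : 0 <= et <= 1 := eta01 p01 C0.
have n1 : (1 < n)%N.
  case/set0Pn: (S0) => u uS; case/set0Pn: S1 => v; rewrite inE => vS.
  have : u != v by apply: contraNneq vS => <-.
  by case: (n) u v {uS vS} => [[]//|[|//]] u v; rewrite !ord1.
have N2 : 2 <= B by rewrite ler_nat.
have m0 := edges_gt0 n1 conn.
have [t1 t2 t3 t4] := threshold_bounds m rho1.
have ltk k : (t < k)%N -> 4 * rh + 12 <= k%:R.
  by move=> tk; apply: le_trans t2 _; rewrite ler_nat ltnW.
have adm : admissible n B et rh t.
  split=> [|k /andP[tk _]]; first by lra.
  have [_ h1 _ _ h2] := boosted_q_bounds N2 e01 rho1 (ltk k tk); apply/andP; split; lra.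
have tkb k : (minn n t < k <= n)%N -> (t < k)%N.
  by rewrite gtn_min => /andP[/orP[nk|//] kn]; rewrite ltnNge kn in nk.
have half : 0 < (2^-1 : R) <= 1 by apply/andP; split; lra.
have qP k : (minn n t < k <= n)%N -> 2^-1 <= boosted_q B et rh k <= 1.
  move=> /tkb /ltk kb; have [_ h1 _ _ h2] := boosted_q_bounds N2 e01 rho1 kb.
  by apply/andP; split; lra.
have tI_ge0 := @inner_time_ge0 R.
have tI2 : 20%:R <= inner_time R 2.
  by have := @half_le_ln2 R; rewrite /inner_time; lra.
have tI_step k : (2 < k <= minn n t)%N -> _ := fun h => @inner_time_step R k (proj1 (andP h)).
have leaf0 : 0 <= leaf_cost n m t (@inner_time R) by rewrite addr_ge0.
have [tO [tO0 tOb tOs tOn]] := outer_time_exists n1 t1 e01 rho1 t2 leaf0 (ler0n R (redo_steps n m)).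
split=> //.
- exact: (boosted_program_implements n1 t1 p01 adm conn tI_ge0 tI2 tI_step half qP tO0 tOb tOs).
- move=> K K0.
  have steps := boosted_program_steps n1 t1 p01 adm conn tI_ge0 tI2 tI_step half qP tO0 tOb tOs.
  apply: (le_trans steps); rewrite lee_fin; apply: le_trans (lerD (lexx _) tOn) _.
  set b := minn n t; have b1 : (1 < b)%N by rewrite leq_min n1.
  have b0 : 0 < b%:R :> R by rewrite ltr0n ltnW.
  have e2 : 1 <= expR 2 :> R by have := @expR_ge1Dx R 2; lra.
  have ratio1 : 1 <= (n%:R / b%:R) `^ (2 * et) :> R.
    rewrite -[leLHS](powRr0 (n%:R / b%:R)); apply: ler_powR; last by lra.
    by rewrite ler_pdivlMr // mul1r ler_nat geq_minl.
  have C1 : 1 <= 16 * expR 2 * (n%:R / b%:R) `^ (2 * et) :> R.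
    apply: le_trans ratio1 _; rewrite ler_peMl ?powR_ge0 //; lra.
  have mn := edges_le G.
  have mt : (m <= t * t)%N.
    rewrite -(ler_nat R) natrM -[leLHS](sqr_sqrtr (ler0n R m)) -expr2.
    by rewrite ler_pXn2r ?nnegrE ?sqrtr_ge0.
  have mb : (m <= b * b)%N by rewrite /b /minn; case: ifP.
  apply: le_trans (total_steps_le n1 m0 b1 (vertices_le n1 conn) mn mb C1) _.
  have bud := budget_le n1 m0 e01 rho1 K0.
  have C0' : 0 <= 2600 * (16 * expR 2) :> R.
    exact: mulr_ge0 (ler0n R 2600) (mulr_ge0 (ler0n R 16) (expR_ge0 _)).
  rewrite -[leRHS]mulrA; apply: le_trans (ler_wpM2l C0' bud).
  have regroup (c d x l r : R) : c * (x * l) * (d * r) = c * d * (x * r * l) by ring.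
  by rewrite regroup.
- have L2 := @ln_nat_ge R n n1.
  have den k : (minn n t < k <= n)%N -> 0 < B * k%:R / 2 - (B - 1) * (rh + (1 - et)).
    by move=> /tkb /ltk kb; have [] := boosted_q_bounds N2 e01 rho1 kb.
  have qb k : (minn n t < k <= n)%N ->
      0 < boosted_q B et rh k /\ 1 - boosted_q B et rh k <= 8 / k%:R.
    move=> /tkb /ltk kb; have [_ _ _ h1 h2] := boosted_q_bounds N2 e01 rho1 kb.
    by split=> //; lra.
  have B1 : 1 <= B by lra.
  apply: le_trans (boosted_reliable p01 minC SC S0 S1 C0 B1 n1 t1 adm den qb).
  rewrite /run_bound; set L := ln _ in L2 *.
  rewrite ler_pdivrMr; last by lra.
  rewrite mulrC ler_pdivlMr; lra.
Qed.
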